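(* For any $\gamma\in(0,1)$ there exists an entire function $F$ of order exactly $\gamma^{-1}$ such that all its zeros $t_n$ are simple and lie in an angle of size $\pi\gamma$ (a set $\{\theta_0<\arg z<\theta_0+\pi\gamma\}$), and $$\sum_n\frac{1}{|F'(t_n)|}<\infty,\qquad \frac{1}{F(z)}=\sum_n\frac{1}{F'(t_n)(z-t_n)}.$$ *)

(* Defs.v *)
From Stdlib Require Import Reals.
Open Scope R_scope.

Definition Cx : Type := (R * R)%type.

Definition Cmk (a b : R) : Cx := (a, b).
Definition C0 : Cx := (0, 0).
Definition C1 : Cx := (1, 0).
Definition Cadd (z w : Cx) : Cx := (fst z + fst w, snd z + snd w).
Definition Copp (z : Cx) : Cx := (- fst z, - snd z).
Definition Csub (z w : Cx) : Cx := Cadd z (Copp w).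
Definition Cmul (z w : Cx) : Cx :=
  (fst z * fst w - snd z * snd w, fst z * snd w + snd z * fst w).
Definition Cnorm (z : Cx) : R := sqrt (fst z * fst z + snd z * snd z).
(* multiplicative inverse (only meaningful for z <> C0) *)
Definition Cinv (z : Cx) : Cx :=
  let d := fst z * fst z + snd z * snd z in (fst z / d, - snd z / d).

Definition has_cderiv (F : Cx -> Cx) (z l : Cx) : Prop :=
  forall eps : R, 0 < eps -> exists delta : R, 0 < delta /\
    forall h : Cx, 0 < Cnorm h < delta ->
      Cnorm (Csub (Csub (F (Cadd z h)) (F z)) (Cmul l h)) <= eps * Cnorm h.

Definition entire_with_deriv (F F' : Cx -> Cx) : Prop :=
  forall z : Cx, has_cderiv F z (F' z).

(* order of an entire function equals rho, i.e.
   limsup_{r -> oo} log log M(r) / log r = rho, M(r) = max_{|z|=r} |F z|,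
   unfolded into its two eps-characterizations *)
Definition entire_order (F : Cx -> Cx) (rho : R) : Prop :=
  (forall eps : R, 0 < eps -> exists r0 : R, 0 < r0 /\
     forall z : Cx, r0 <= Cnorm z -> Cnorm (F z) <= exp (Rpower (Cnorm z) (rho + eps)))
  /\
  (forall eps : R, 0 < eps -> forall r0 : R, exists z : Cx,
     r0 <= Cnorm z /\ exp (Rpower (Cnorm z) (rho - eps)) < Cnorm (F z)).

Definition in_angle (theta0 alpha : R) (z : Cx) : Prop :=
  exists r phi : R, 0 < r /\ theta0 < phi < theta0 + alpha /\
    z = Cmk (r * cos phi) (r * sin phi).

Definition Cseries_sum (u : nat -> Cx) (s : Cx) : Prop :=
  infinite_sum (fun n => fst (u n)) (fst s) /\
  infinite_sum (fun n => snd (u n)) (snd s).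

(* Main.v *)
(* Write [rho = 1 / gamma > 1]. Let [E z = sum a_n z^n] with [a_n] the Hankel integral
   of [exp (w ^ rho) / w ^ (n + 1)]; this is, up to a constant factor, the Mittag-Leffler function of
   order [rho]: moving the contour across the pole [w = z] shows that [E z - exp (z ^ rho)] is bounded
   and Lipschitz for [|arg z|] slightly beyond [PI / (2 rho)], and that [E] is bounded in the rest of
   the plane. For a large integer [k] the function [F z = E z + z ^ k + c] then has size [|z| ^ k] outside
   the angle [|arg z| < PI / (2 rho)]. At a large zero [exp (z ^ rho)] is about [- z ^ k], whence
   [|F' t|] is at least of order [|t| ^ (k - 1)] and the zeros are polynomially separated: they are
   polynomially many and [sum 1 / |F' t|] converges. A suitable small [c] avoids the finitely many small
   critical values, so all zeros are simple, and a translation moves the finitely many stray zeros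
   into the angle.

   For the expansion of [1 / F], divide out the zeros in a disc one at a time: the difference between [1 / F]
   and the partial sum is a quotient [W / U] of entire functions with [U] free of zeros there, and the maximum
   principle bounds it by its values on circles where [|F| >= |z| ^ k / 2]; these tend to 0. There are
   infinitely many zeros because otherwise [1 / F] would be rational, whereas it decays faster than any
   power on the positive axis. *)

Require Import Defs.
From Stdlib Require Import Reals Lra Lia ClassicalEpsilon FunctionalExtensionality List Arith.
From Coquelicot Require Import Coquelicot.
Open Scope R_scope.

(** Points off the origin are written [Cexp u], so [z ^ rho] becomes [Cexp (rho * u)] without a
    choice of branch; sectors turn into rectangles in [u], and contour integration is needed on
    rectangles only. The exponent [k] pays for two losses. The number of zeros of modulus up to [T]
    is bounded only by a constant times some power [T ^ p], and summability against
    [1 / (n + 1) ^ 2] costs that power twice. A chosen circle is only known to keep a distance of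
    order [|t| ^ (1 - rho)] from a zero [t], which costs a further power [r]. Hence
    [k = 2 p + r + 1]. The delicate places for the circles are the edges of the sector, where
    [exp (z ^ rho)] and [z ^ k] have comparable size and could cancel; the radii are tuned so that
    the two terms point in nearly the same direction at both edges. The bounds on the contour
    integral degenerate near the rays of the contour, so two contours of different opening, which
    define the same coefficients, serve the two regions of the plane. *)

Lemma Cmod_le_abs (z : C) : Cmod z <= Rabs (fst z) + Rabs (snd z).
Proof.
  destruct z as [x y]; unfold Cmod; cbn [fst snd].
  apply Rsqr_incr_0_var; [| generalize (Rabs_pos x) (Rabs_pos y); lra].
  rewrite Rsqr_sqrt by nra.
  unfold Rsqr. generalize (Rabs_pos x) (Rabs_pos y).
  rewrite <- (pow2_abs x), <- (pow2_abs y). nra.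
Qed.

Lemma Re_le_Cmod (z : C) : Rabs (fst z) <= Cmod z.
Proof. eapply Rle_trans; [apply Rmax_l | apply Rmax_Cmod]. Qed.

Lemma Im_le_Cmod (z : C) : Rabs (snd z) <= Cmod z.
Proof. eapply Rle_trans; [apply Rmax_r | apply Rmax_Cmod]. Qed.

Lemma Cmod_sqr (z : C) : Cmod z * Cmod z = fst z * fst z + snd z * snd z.
Proof. unfold Cmod. rewrite sqrt_sqrt; nra. Qed.

Lemma Cmod_minus_sym (z w : C) : Cmod (z - w) = Cmod (w - z).
Proof. rewrite <- Cmod_opp. f_equal. ring. Qed.

Lemma Cmod_triangle_inv (z w : C) : Cmod z - Cmod w <= Cmod (z - w).
Proof.
  generalize (Cmod_triangle (z - w) w).
  replace (z - w + w)%C with z by ring. lra.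
Qed.

Lemma Cmod_triangle_minus (z w : C) : Cmod (z - w) <= Cmod z + Cmod w.
Proof. unfold Cminus. rewrite <- (Cmod_opp w). apply Cmod_triangle. Qed.

Lemma Cmod_small_0 (z : C) : (forall eps, 0 < eps -> Cmod z <= eps) -> z = 0%C.
Proof.
  intros H. apply Cmod_eq_0. apply Rle_antisym; [| apply Cmod_ge_0].
  destruct (Rle_dec (Cmod z) 0) as [|n]; auto.
  assert (0 < Cmod z / 2) as h by lra. specialize (H _ h). lra.
Qed.

Lemma Cdist_pos (z w : C) : z <> w -> 0 < Cmod (z - w).
Proof. intros H. apply Cmod_gt_0. now apply Cminus_eq_contra. Qed.

(** * Continuity and complex derivatives *)

Definition Ccont (f : C -> C) (z : C) : Prop :=
  forall eps, 0 < eps -> exists d, 0 < d /\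
    forall w, Cmod (w - z) < d -> Cmod (f w - f z) < eps.

(** Without a quotient the point [w = z] needs no exception; putting [w = z + h] gives the
    derivative notion of the theorem. *)
Definition cderiv (f : C -> C) (z l : C) : Prop :=
  forall eps, 0 < eps -> exists d, 0 < d /\
    forall w, Cmod (w - z) < d -> Cmod (f w - f z - l * (w - z)) <= eps * Cmod (w - z).

Lemma Ccont_const (c z : C) : Ccont (fun _ => c) z.
Proof.
  intros e He. exists 1. split; [lra|]. intros w _.
  replace (c - c)%C with (RtoC 0) by ring. now rewrite Cmod_0.
Qed.

Lemma Ccont_id (z : C) : Ccont (fun w => w) z.
Proof. intros e He. exists e. split; auto. Qed.

Lemma Ccont_ext_loc (f g : C -> C) (z : C) (r : R) :
  0 < r -> (forall w, Cmod (w - z) < r -> f w = g w) -> Ccont f z -> Ccont g z.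
Proof.
  intros Hr He Hf e H. destruct (Hf e H) as (d & Hd & K).
  exists (Rmin r d). split; [now apply Rmin_glb_lt|]. intros w Hw.
  rewrite <- !He. apply K.
  - eapply Rlt_le_trans; [apply Hw | apply Rmin_r].
  - replace (z - z)%C with (RtoC 0) by ring. now rewrite Cmod_0.
  - eapply Rlt_le_trans; [apply Hw | apply Rmin_l].
Qed.

Lemma Ccont_plus (f g : C -> C) (z : C) : Ccont f z -> Ccont g z -> Ccont (fun w => f w + g w)%C z.
Proof.
  intros Hf Hg e He. destruct (Hf (e/2)) as (d1 & H1 & K1); [lra|].
  destruct (Hg (e/2)) as (d2 & H2 & K2); [lra|].
  exists (Rmin d1 d2). split; [now apply Rmin_glb_lt|]. intros w Hw.
  replace (f w + g w - (f z + g z))%C with ((f w - f z) + (g w - g z))%C by ring.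
  eapply Rle_lt_trans; [apply Cmod_triangle|].
  specialize (K1 w (Rlt_le_trans _ _ _ Hw (Rmin_l _ _))).
  specialize (K2 w (Rlt_le_trans _ _ _ Hw (Rmin_r _ _))). lra.
Qed.

Lemma Ccont_mult (f g : C -> C) (z : C) : Ccont f z -> Ccont g z -> Ccont (fun w => f w * g w)%C z.
Proof.
  intros Hf Hg e He.
  set (S := 1 + Cmod (f z) + Cmod (g z)).
  assert (HS : 0 < S) by (unfold S; generalize (Cmod_ge_0 (f z)) (Cmod_ge_0 (g z)); lra).
  set (h := Rmin 1 (e / S)).
  assert (Hh : 0 < h) by (apply Rmin_glb_lt; [lra| now apply Rdiv_lt_0_compat]).
  destruct (Hf h) as (d1 & H1 & K1); [lra|].
  destruct (Hg h) as (d2 & H2 & K2); [lra|].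
  exists (Rmin d1 d2). split; [now apply Rmin_glb_lt|]. intros w Hw.
  specialize (K1 w (Rlt_le_trans _ _ _ Hw (Rmin_l _ _))).
  specialize (K2 w (Rlt_le_trans _ _ _ Hw (Rmin_r _ _))).
  replace (f w * g w - f z * g z)%C
    with ((f w - f z) * (g w - g z) + (f w - f z) * g z + f z * (g w - g z))%C by ring.
  eapply Rle_lt_trans; [eapply Rle_trans; [apply Cmod_triangle|
    apply Rplus_le_compat_r; apply Cmod_triangle]|].
  rewrite !Cmod_mult.
  assert (h <= 1) by apply Rmin_l.
  assert (h * S <= e).
  { apply Rle_trans with (e / S * S); [apply Rmult_le_compat_r; [lra| apply Rmin_r]|].
    right; field; lra. }
  generalize (Cmod_ge_0 (f w - f z)) (Cmod_ge_0 (g w - g z)) (Cmod_ge_0 (f z)) (Cmod_ge_0 (g z)).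
  intros. unfold S in *.
  assert (Cmod (f w - f z) * Cmod (g w - g z) < h * 1) by (apply Rmult_le_0_lt_compat; lra).
  assert (Cmod (f w - f z) * Cmod (g z) <= h * Cmod (g z)) by (apply Rmult_le_compat_r; lra).
  assert (Cmod (f z) * Cmod (g w - g z) <= Cmod (f z) * h) by (apply Rmult_le_compat_l; lra).
  nra.
Qed.

Lemma Ccont_opp (f : C -> C) (z : C) : Ccont f z -> Ccont (fun w => - f w)%C z.
Proof.
  intros H. apply (Ccont_ext_loc (fun w => (-(1)) * f w)%C _ z 1); [lra| |].
  - intros; ring.
  - apply Ccont_mult; [apply Ccont_const|exact H].
Qed.

Lemma Ccont_minus (f g : C -> C) (z : C) : Ccont f z -> Ccont g z -> Ccont (fun w => f w - g w)%C z.
Proof. intros; apply Ccont_plus; auto using Ccont_opp. Qed.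

Lemma Ccont_nz (f : C -> C) z : Ccont f z -> f z <> 0%C ->
  exists d, 0 < d /\ forall w, Cmod (w - z) < d -> Cmod (f z) / 2 < Cmod (f w).
Proof.
  intros Hf Hz. assert (P : 0 < Cmod (f z)) by now apply Cmod_gt_0.
  destruct (Hf (Cmod (f z) / 2)) as (d & Hd & K); [lra|].
  exists d; split; auto. intros w Hw. specialize (K w Hw).
  generalize (Cmod_triangle_inv (f z) (f w)). rewrite Cmod_minus_sym. lra.
Qed.

Lemma Ccont_inv (f : C -> C) (z : C) : Ccont f z -> f z <> 0%C -> Ccont (fun w => / f w)%C z.
Proof.
  intros Hf Hz e He. assert (P : 0 < Cmod (f z)) by now apply Cmod_gt_0.
  destruct (Ccont_nz f z Hf Hz) as (d1 & H1 & K1).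
  destruct (Hf (e * (Cmod (f z) * Cmod (f z) / 2))) as (d2 & H2 & K2).
  { apply Rmult_lt_0_compat; nra. }
  exists (Rmin d1 d2). split; [now apply Rmin_glb_lt|]. intros w Hw.
  specialize (K1 w (Rlt_le_trans _ _ _ Hw (Rmin_l _ _))).
  specialize (K2 w (Rlt_le_trans _ _ _ Hw (Rmin_r _ _))).
  assert (Pw : 0 < Cmod (f w)) by lra.
  assert (f w <> 0%C) by now apply Cmod_gt_0.
  replace (/ f w - / f z)%C with (- (f w - f z) / (f w * f z))%C by (field; auto).
  rewrite Cmod_div, Cmod_opp, Cmod_mult by now apply Cmult_neq_0.
  apply Rlt_div_l; [now apply Rmult_lt_0_compat|].
  eapply Rlt_le_trans; [apply K2|]. apply Rmult_le_compat_l; [lra|]. nra.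
Qed.

Lemma Ccont_comp (f g : C -> C) (z : C) : Ccont g z -> Ccont f (g z) -> Ccont (fun w => f (g w)) z.
Proof.
  intros Hg Hf e He. destruct (Hf e He) as (d & Hd & K).
  destruct (Hg d Hd) as (d' & Hd' & K'). exists d'; split; auto.
Qed.

(** Caratheodory's form of differentiability reduces the rules of calculus to the corresponding
    rules for continuity, with no division by [w - z]. *)
Lemma cderiv_caratheodory (f : C -> C) (z l : C) :
  cderiv f z l <->
  exists phi : C -> C, Ccont phi z /\ phi z = l /\
    forall w, (f w - f z = phi w * (w - z))%C.
Proof.
  split.
  - intros H. exists (fun w => if Ceq_dec w z then l else ((f w - f z) / (w - z))%C).
    assert (Hl : (if Ceq_dec z z then l else (f z - f z) / (z - z))%C = l).
    { destruct (Ceq_dec z z); auto; contradiction. }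
    split; [|split; auto].
    + intros e He. destruct (H (e/2)) as (d & Hd & K); [lra|].
      exists d; split; auto. intros w Hw. rewrite Hl.
      destruct (Ceq_dec w z) as [->|n].
      * replace (l - l)%C with (RtoC 0) by ring. now rewrite Cmod_0.
      * assert (P := Cdist_pos _ _ n). specialize (K w Hw).
        assert (w - z <> 0)%C by now apply Cmod_gt_0.
        replace ((f w - f z) / (w - z) - l)%C
          with ((f w - f z - l * (w - z)) / (w - z))%C by (field; auto).
        rewrite Cmod_div by auto. apply Rlt_div_l; auto. nra.
    + intros w. destruct (Ceq_dec w z) as [->|n]; [ring|].
      field. now apply Cminus_eq_contra.
  - intros (phi & Hc & <- & E) e He. destruct (Hc e He) as (d & Hd & K).
    exists d; split; auto. intros w Hw. rewrite E.
    replace (phi w * (w - z) - phi z * (w - z))%C with ((phi w - phi z) * (w - z))%C by ring.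
    rewrite Cmod_mult. apply Rmult_le_compat_r; [apply Cmod_ge_0|]. left; now apply K.
Qed.

Lemma cderiv_cont (f : C -> C) (z l : C) : cderiv f z l -> Ccont f z.
Proof.
  intros H. apply cderiv_caratheodory in H. destruct H as (phi & Hc & _ & E).
  apply (Ccont_ext_loc (fun w => f z + phi w * (w - z))%C _ z 1); [lra| |].
  - intros w _. rewrite <- E. ring.
  - apply Ccont_plus; [apply Ccont_const|]. apply Ccont_mult; auto.
    apply Ccont_minus; [apply Ccont_id|apply Ccont_const].
Qed.

Lemma cderiv_ext_loc (f g : C -> C) (z l : C) (r : R) :
  0 < r -> (forall w, Cmod (w - z) < r -> f w = g w) -> cderiv f z l -> cderiv g z l.
Proof.
  intros Hr He Hf e H. destruct (Hf e H) as (d & Hd & K).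
  exists (Rmin r d). split; [now apply Rmin_glb_lt|]. intros w Hw.
  rewrite <- !He. apply K.
  - eapply Rlt_le_trans; [apply Hw | apply Rmin_r].
  - replace (z - z)%C with (RtoC 0) by ring. now rewrite Cmod_0.
  - eapply Rlt_le_trans; [apply Hw | apply Rmin_l].
Qed.

Lemma cderiv_unique (f : C -> C) (z : C) (l l' : C) : cderiv f z l -> cderiv f z l' -> l = l'.
Proof.
  intros H H'. apply Ceq_minus. apply Cmod_small_0. intros e He.
  destruct (H (e/2)) as (d & Hd & K); [lra|].
  destruct (H' (e/2)) as (d' & Hd' & K'); [lra|].
  set (r := Rmin d d' / 2).
  assert (Hr : 0 < r) by (unfold r; generalize (Rmin_glb_lt _ _ _ Hd Hd'); lra).
  assert (E : (z + r - z = r)%C) by ring.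
  assert (M : Cmod (z + r - z)%C = r) by (rewrite E, Cmod_R, Rabs_pos_eq; lra).
  specialize (K (z + r)%C). specialize (K' (z + r)%C). rewrite M in *. rewrite E in *.
  assert (A1 : r < d) by (unfold r in *; generalize (Rmin_l d d'); lra).
  assert (A2 : r < d') by (unfold r in *; generalize (Rmin_r d d'); lra).
  specialize (K A1). specialize (K' A2).
  assert (B : Cmod ((l - l') * r)%C <= e * r).
  { replace ((l - l') * r)%C
      with ((f (z + r) - f z - l' * r) - (f (z + r) - f z - l * r))%C by ring.
    eapply Rle_trans; [apply Cmod_triangle_minus|]. lra. }
  rewrite Cmod_mult, Cmod_R, (Rabs_pos_eq r) in B by lra.
  now apply Rmult_le_reg_r in B.
Qed.

Lemma cderiv_const c z : cderiv (fun _ => c) z 0.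
Proof.
  apply cderiv_caratheodory. exists (fun _ => 0%C).
  split; [apply Ccont_const|]. split; auto. intros; ring.
Qed.

Lemma cderiv_id z : cderiv (fun w => w) z 1.
Proof.
  apply cderiv_caratheodory. exists (fun _ => 1%C).
  split; [apply Ccont_const|]. split; auto. intros; ring.
Qed.

Lemma cderiv_plus (f g : C -> C) (z : C) (l m : C) :
  cderiv f z l -> cderiv g z m -> cderiv (fun w => f w + g w)%C z (l + m).
Proof.
  rewrite !cderiv_caratheodory. intros (p & Hp & <- & E) (q & Hq & <- & E').
  exists (fun w => p w + q w)%C. split; [now apply Ccont_plus|]. split; auto.
  intros w. replace (f w + g w - (f z + g z))%C with ((f w - f z) + (g w - g z))%C by ring.
  rewrite E, E'. ring.
Qed.

Lemma cderiv_mult (f g : C -> C) (z : C) (l m : C) :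
  cderiv f z l -> cderiv g z m -> cderiv (fun w => f w * g w)%C z (l * g z + f z * m).
Proof.
  intros Hf Hg. assert (Cg := cderiv_cont _ _ _ Hg). revert Hf Hg.
  rewrite !cderiv_caratheodory. intros (p & Hp & <- & E) (q & Hq & <- & E').
  exists (fun w => p w * g w + f z * q w)%C.
  split; [|split; auto].
  - apply Ccont_plus; apply Ccont_mult; auto. apply Ccont_const.
  - intros w. replace (f w * g w - f z * g z)%C
      with ((f w - f z) * g w + f z * (g w - g z))%C by ring.
    rewrite E, E'. ring.
Qed.

Lemma cderiv_comp (f g : C -> C) (z : C) (l m : C) :
  cderiv g z m -> cderiv f (g z) l -> cderiv (fun w => f (g w)) z (l * m).
Proof.
  intros Hg Hf. assert (Cg := cderiv_cont _ _ _ Hg). revert Hf Hg.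
  rewrite !cderiv_caratheodory. intros (p & Hp & <- & E) (q & Hq & <- & E').
  exists (fun w => p (g w) * q w)%C.
  split; [|split; auto].
  - apply Ccont_mult; auto. now apply Ccont_comp.
  - intros w. rewrite E, E'. ring.
Qed.

Lemma cderiv_inv (f : C -> C) (z l : C) :
  f z <> 0%C -> cderiv f z l -> cderiv (fun w => / f w)%C z (- l / (f z * f z)).
Proof.
  intros Hz Hf. assert (Cf := cderiv_cont _ _ _ Hf).
  destruct (Ccont_nz f z Cf Hz) as (d & Hd & K).
  apply cderiv_caratheodory in Hf. destruct Hf as (p & Hp & <- & E).
  apply (cderiv_ext_loc (fun w => / f z + (- p w / (f w * f z)) * (w - z))%C _ _ _ d Hd).
  - intros w Hw. assert (f w <> 0)%C.
    { apply Cmod_gt_0. specialize (K w Hw). generalize (Cmod_ge_0 (f z)); lra. }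
    replace (- p w / (f w * f z) * (w - z))%C with (- (p w * (w - z)) / (f w * f z))%C
      by (field; auto).
    rewrite <- E. field; auto.
  - apply cderiv_caratheodory. exists (fun w => - p w / (f w * f z))%C.
    split; [|split; auto].
    + apply Ccont_mult; [now apply Ccont_opp|].
      apply (Ccont_inv (fun w => f w * f z)%C).
      * apply Ccont_mult; auto. apply Ccont_const.
      * now apply Cmult_neq_0.
    + intros w. ring.
Qed.

(** * The complex exponential *)

Definition Cexp (u : C) : C := (exp (fst u) * cos (snd u), exp (fst u) * sin (snd u)).

Lemma Cexp_plus u v : Cexp (u + v) = (Cexp u * Cexp v)%C.
Proof.
  destruct u as [a b], v as [c d]. unfold Cexp, Cplus, Cmult; cbn [fst snd].
  rewrite exp_plus, cos_plus, sin_plus. f_equal; ring.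
Qed.

Lemma Cexp_0 : Cexp 0 = 1%C.
Proof.
  unfold Cexp, RtoC; cbn [fst snd]. rewrite exp_0, cos_0, sin_0. f_equal; ring.
Qed.

Lemma Cmod_Cexp u : Cmod (Cexp u) = exp (fst u).
Proof.
  destruct u as [a b]. unfold Cexp, Cmod; cbn [fst snd].
  replace ((exp a * cos b) ^ 2 + (exp a * sin b) ^ 2)
    with ((exp a) ^ 2 * (Rsqr (sin b) + Rsqr (cos b))) by (unfold Rsqr; ring).
  rewrite sin2_cos2, Rmult_1_r. apply sqrt_pow2. left; apply exp_pos.
Qed.

Lemma Cexp_nz u : Cexp u <> 0%C.
Proof. apply Cmod_gt_0. rewrite Cmod_Cexp. apply exp_pos. Qed.

Lemma Cexp_opp u : Cexp (- u) = (/ Cexp u)%C.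
Proof.
  assert (H : (Cexp (-u) * Cexp u = 1)%C).
  { rewrite <- Cexp_plus. replace (- u + u)%C with (RtoC 0) by ring. apply Cexp_0. }
  replace (/ Cexp u)%C with (Cexp (- u) * Cexp u * / Cexp u)%C.
  - field. apply Cexp_nz.
  - rewrite H. ring.
Qed.

Lemma Cexp_minus u v : Cexp (u - v) = (Cexp u / Cexp v)%C.
Proof. unfold Cminus. now rewrite Cexp_plus, Cexp_opp. Qed.

Lemma Cexp_pow u n : (Cexp u ^ n)%C = Cexp (INR n * u).
Proof.
  induction n as [|n IH].
  - cbn [Cpow INR]. replace (0%R * u)%C with (RtoC 0) by ring. now rewrite Cexp_0.
  - rewrite Cpow_S, IH, <- Cexp_plus, S_INR, RtoC_plus. f_equal. ring.
Qed.

Lemma cos_mult_Rabs a v : cos (a * Rabs v) = cos (a * v).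
Proof. unfold Rabs. destruct (Rcase_abs v); auto. rewrite <- cos_neg. f_equal; ring. Qed.

Lemma cos_Rabs v : cos (Rabs v) = cos v.
Proof. generalize (cos_mult_Rabs 1 v). now rewrite !Rmult_1_l. Qed.

Lemma sin_Rabs_le v : sin (Rabs v) <= Rabs (sin v).
Proof. unfold Rabs at 1. destruct (Rcase_abs v); [rewrite sin_neg, <- Rabs_Ropp|]; apply Rle_abs. Qed.

(** Each of the three factors [exp (y / 3)] is at least [y / 3]. A cubic gain is enough below,
    against quadratic factors and inside double exponentials. *)
Lemma cube_le_exp y : 0 <= y -> (y / 3) ^ 3 <= exp y.
Proof.
  intros Hy. replace y with (y / 3 + y / 3 + y / 3) at 2 by field.
  set (x := y / 3). assert (Px : 0 <= x) by (unfold x; lra). rewrite !exp_plus.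
  assert (A : x <= exp x) by (generalize (exp_ineq1_le x); lra).
  replace (x ^ 3) with (x * x * x) by ring.
  apply Rmult_le_compat; [nra|lra| |lra]. apply Rmult_le_compat; lra.
Qed.

Lemma sin_abs_le t : Rabs (sin t) <= Rabs t.
Proof.
  destruct (MVT_gen sin 0 t cos) as (c & _ & E).
  - intros; apply is_derive_sin.
  - intros; apply continuity_sin.
  - rewrite sin_0, !Rminus_0_r in E. rewrite E, Rabs_mult.
    generalize (Rabs_pos t). assert (Rabs (cos c) <= 1) by (apply Rabs_le; generalize (COS_bound c); lra).
    intros. nra.
Qed.

Lemma one_minus_cos_le y : 0 <= 1 - cos y <= y * y / 2.
Proof.
  split; [generalize (COS_bound y); lra|].
  replace y with (2 * (y / 2)) at 1 by field. rewrite cos_2a_sin.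
  assert (H := sin_abs_le (y / 2)).
  assert (sin (y/2) * sin (y/2) <= (y/2) * (y/2)).
  { apply Rsqr_le_abs_1 in H. exact H. }
  nra.
Qed.

Lemma sin_minus_id_le y : Rabs (sin y - y) <= Rabs y * (y * y / 2).
Proof.
  destruct (MVT_gen (fun t => sin t - t) 0 y (fun t => cos t - 1)) as (c & Hc & E).
  - intros x _. auto_derive; auto. ring.
  - intros x _. apply continuity_pt_minus; [apply continuity_sin|apply continuity_pt_id].
  - rewrite sin_0, !Rminus_0_r in E. rewrite E, Rabs_mult, Rmult_comm.
    apply Rmult_le_compat_l; [apply Rabs_pos|].
    assert (K := one_minus_cos_le c).
    apply Rabs_le. assert (c * c <= y * y); [|lra].
    unfold Rmin, Rmax in Hc. destruct (Rle_dec 0 y); nra.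
Qed.

Lemma Rabs_mul_self x : Rabs x * Rabs x = x * x.
Proof. rewrite <- Rabs_mult. apply Rabs_pos_eq. apply Rle_0_sqr. Qed.

Lemma exp_taylor1 x : x <= 1/2 -> 0 <= exp x - 1 - x <= 2 * (x * x).
Proof.
  intros H. split; [generalize (exp_ineq1_le x); lra|].
  assert (E : 1 - x <= exp (- x)) by (generalize (exp_ineq1_le (- x)); lra).
  rewrite exp_Ropp in E. assert (P := exp_pos x).
  assert (exp x * (1 - x) <= 1).
  { apply Rmult_le_compat_l with (r := exp x) in E; [|lra]. rewrite Rinv_r in E; lra. }
  nra.
Qed.

Lemma Cexp_taylor1 h : Cmod h <= 1/2 -> Cmod (Cexp h - 1 - h) <= 3 * (Cmod h * Cmod h).
Proof.
  intros H. eapply Rle_trans; [apply Cmod_le_abs|].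
  assert (Hx := Re_le_Cmod h). assert (Hy := Im_le_Cmod h).
  rewrite Cmod_sqr. destruct h as [x y]. unfold Cexp, Cminus, Cplus, Copp, RtoC in *; cbn [fst snd] in *.
  assert (x <= 1/2) by (generalize (Rle_abs x); lra).
  destruct (exp_taylor1 x) as [E1 E2]; auto.
  destruct (one_minus_cos_le y) as [K1 K2].
  assert (S := sin_minus_id_le y).
  assert (P := exp_pos x). assert (Px : exp x <= 2).
  { assert (-(1/2) <= x) by (generalize (Rle_abs (-x)); rewrite Rabs_Ropp; lra). nra. }
  replace (exp x * cos y + - (1) + - x) with ((exp x - 1 - x) - exp x * (1 - cos y)) by ring.
  replace (exp x * sin y + - 0 + - y) with ((exp x - 1) * y + exp x * (sin y - y)) by ring.
  assert (A : Rabs (exp x - 1 - x - exp x * (1 - cos y)) <= 2 * (x * x) + y * y).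
  { apply Rabs_le; split; nra. }
  assert (B : Rabs ((exp x - 1) * y + exp x * (sin y - y)) <= 2 * (Rabs x * Rabs y) + 2 * (Rabs y * (y * y / 2))).
  { eapply Rle_trans; [apply Rabs_triang|]. rewrite !Rabs_mult, (Rabs_pos_eq (exp x)) by lra.
    assert (Rabs (exp x - 1) <= 2 * Rabs x).
    { replace (exp x - 1) with ((exp x - 1 - x) + x) by ring.
      eapply Rle_trans; [apply Rabs_triang|]. rewrite (Rabs_pos_eq (exp x - 1 - x)) by lra.
      assert (x * x = Rabs x * Rabs x) by (symmetry; apply Rabs_mul_self).
      generalize (Rabs_pos x); nra. }
    generalize (Rabs_pos y) (Rabs_pos (sin y - y)); intros.
    apply Rplus_le_compat.
    - rewrite <- Rmult_assoc. now apply Rmult_le_compat_r.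
    - apply Rmult_le_compat; lra. }
  assert (x * x = Rabs x * Rabs x) by (symmetry; apply Rabs_mul_self).
  assert (y * y = Rabs y * Rabs y) by (symmetry; apply Rabs_mul_self).
  generalize (Rabs_pos x) (Rabs_pos y); intros.
  assert (Rabs y <= 1/2) by lra.
  assert (0 <= y * y) by apply Rle_0_sqr.
  assert (Rabs y * (y * y) <= 1/2 * (y * y)) by (apply Rmult_le_compat_r; lra).
  assert (0 <= (Rabs x - Rabs y) * (Rabs x - Rabs y)) by apply Rle_0_sqr.
  lra.
Qed.

(** The threshold [1/6] makes the Taylor error [3 |h| ^ 2] at most [|h| / 2]. *)
Lemma Cexp_minus_1_bounds h : Cmod h <= 1/6 ->
  Cmod h / 2 <= Cmod (Cexp h - 1) <= 2 * Cmod h.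
Proof.
  intros H. assert (K : Cmod (Cexp h - 1 - h) <= 3 * (Cmod h * Cmod h)) by (apply Cexp_taylor1; lra).
  assert (P := Cmod_ge_0 h).
  assert (3 * (Cmod h * Cmod h) <= Cmod h / 2) by nra.
  split.
  - assert (T := Cmod_triangle_inv h (h - (Cexp h - 1))).
    replace (h - (h - (Cexp h - 1)))%C with (Cexp h - 1)%C in T by ring.
    rewrite (Cmod_minus_sym h) in T. lra.
  - replace (Cexp h - 1)%C with ((Cexp h - 1 - h) + h)%C by ring.
    eapply Rle_trans; [apply Cmod_triangle|]. lra.
Qed.

Lemma cderiv_Cexp z : cderiv Cexp z (Cexp z).
Proof.
  intros e He. assert (P : 0 < Cmod (Cexp z)) by (apply Cmod_gt_0, Cexp_nz).
  exists (Rmin (1/2) (e / (3 * Cmod (Cexp z)))). split.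
  { apply Rmin_glb_lt; [lra|]. apply Rdiv_lt_0_compat; lra. }
  intros w Hw.
  replace (Cexp w) with (Cexp z * Cexp (w - z))%C by (rewrite <- Cexp_plus; f_equal; ring).
  replace (Cexp z * Cexp (w - z) - Cexp z - Cexp z * (w - z))%C
    with (Cexp z * (Cexp (w - z) - 1 - (w - z)))%C by ring.
  rewrite Cmod_mult.
  assert (A : Cmod (w - z) < 1/2) by (eapply Rlt_le_trans; [apply Hw|apply Rmin_l]).
  assert (B : Cmod (w - z) < e / (3 * Cmod (Cexp z))) by (eapply Rlt_le_trans; [apply Hw|apply Rmin_r]).
  apply Rlt_div_r in B; [|lra].
  assert (K : Cmod (Cexp (w - z) - 1 - (w - z)) <= 3 * (Cmod (w - z) * Cmod (w - z)))
    by (apply Cexp_taylor1; lra).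
  generalize (Cmod_ge_0 (w - z)); intros.
  eapply Rle_trans; [apply Rmult_le_compat_l; [lra|apply K]|]. nra.
Qed.

(** The imaginary part is [acos (x / r)] with the sign of [y]. Both ends of the interval are
    allowed, so [u] need not be unique. *)
Lemma Cexp_polar_exists (z : C) : z <> 0%C -> exists u, Cexp u = z /\ - PI <= snd u <= PI.
Proof.
  intros Hz. assert (P : 0 < Cmod z) by now apply Cmod_gt_0.
  assert (S := Cmod_sqr z). destruct z as [x y]. cbn [fst snd] in S.
  set (r := Cmod (x, y)) in *.
  assert (B : -1 <= x / r <= 1).
  { split; [apply Rle_div_r|apply Rle_div_l]; nra. }
  assert (Q : Rsqr (sin (acos (x / r))) = (y / r) * (y / r)).
  { assert (T := sin2_cos2 (acos (x / r))). rewrite cos_acos in T by lra.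
    unfold Rsqr in *. replace (y / r * (y / r)) with (y * y / (r * r)) by (field; lra).
    replace (x / r * (x / r)) with (x * x / (r * r)) in T by (field; lra).
    replace (y * y) with (r * r - x * x) by lra.
    replace ((r * r - x * x) / (r * r)) with (1 - x * x / (r * r)) by (field; lra). lra. }
  assert (N : 0 <= sin (acos (x / r))) by (destruct (acos_bound (x / r)); apply sin_ge_0; lra).
  destruct (acos_bound (x / r)) as [A1 A2].
  assert (E : exp (ln r) = r) by now apply exp_ln.
  destruct (Rle_dec 0 y) as [Hy|Hy].
  - exists (ln r, acos (x / r)). cbn [fst snd]. split; [|lra].
    unfold Cexp; cbn [fst snd]. rewrite E, cos_acos by lra.
    replace (sin (acos (x / r))) with (y / r).
    + f_equal; field; lra.
    + symmetry; apply Rsqr_inj; auto. apply Rdiv_le_0_compat; lra.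
  - exists (ln r, - acos (x / r)). cbn [fst snd]. split; [|lra].
    unfold Cexp; cbn [fst snd]. rewrite cos_neg, sin_neg, E, cos_acos by lra.
    replace (sin (acos (x / r))) with (- (y / r)).
    + f_equal; field; lra.
    + symmetry; apply Rsqr_inj; auto.
      * rewrite <- Rdiv_opp_l. apply Rdiv_le_0_compat; lra.
      * rewrite Q. unfold Rsqr; ring.
Qed.

(** * Integrals along segments and the residue theorem on rectangles *)

(** Integrating the components separately costs a factor 2 in norm estimates, which is harmless
    since those constants are never optimised. *)
Definition CInt (f : R -> C) (a b : R) : C :=
  (RInt (fun x => fst (f x)) a b, RInt (fun x => snd (f x)) a b).

Definition contR (f : R -> C) (a b : R) : Prop :=
  forall x, a <= x <= b ->
    continuous (fun t => fst (f t)) x /\ continuous (fun t => snd (f t)) x.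

Lemma contR_ex f a b : a <= b -> contR f a b ->
  ex_RInt (fun x => fst (f x)) a b /\ ex_RInt (fun x => snd (f x)) a b.
Proof.
  intros H K. split; apply (@ex_RInt_continuous R_CompleteNormedModule); intros x Hx;
  rewrite Rmin_left, Rmax_right in Hx by lra; now apply K.
Qed.

Lemma contR_sub f a b a' b' : a <= a' -> b' <= b -> contR f a b -> contR f a' b'.
Proof. intros H H' K x Hx. apply K. lra. Qed.

Lemma contR_scal (c : C) f a b : contR f a b -> contR (fun x => c * f x)%C a b.
Proof.
  intros Hf x Hx. destruct (Hf x Hx).
  split; cbn [fst snd Cmult].
  - apply (continuous_minus (V := R_NormedModule)); now apply (continuous_scal_r (V := R_NormedModule)).
  - apply (continuous_plus (V := R_NormedModule)); now apply (continuous_scal_r (V := R_NormedModule)).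
Qed.

Lemma contR_minus f g a b : contR f a b -> contR g a b -> contR (fun x => f x - g x)%C a b.
Proof.
  intros Hf Hg x Hx. destruct (Hf x Hx), (Hg x Hx).
  split; cbn [fst snd Cplus Cminus Copp]; now apply (continuous_minus (V := R_NormedModule)).
Qed.

Lemma contR_of_Ccont (f : C -> C) (p : R -> C) a b :
  (forall s t, Cmod (p s - p t) <= Rabs (s - t)) ->
  (forall x, a <= x <= b -> Ccont f (p x)) -> contR (fun x => f (p x)) a b.
Proof.
  intros Hp Hf x Hx.
  split; apply filterlim_locally; intros e;
  destruct (Hf x Hx e (cond_pos e)) as (d & Hd & K);
  exists (mkposreal d Hd); intros y Hy; change (Rabs (y - x) < d) in Hy;
  specialize (K (p y) (Rle_lt_trans _ _ _ (Hp y x) Hy)).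
  - change (Rabs (fst (f (p y)) - fst (f (p x))) < e).
    eapply Rle_lt_trans; [|apply K]. apply (Re_le_Cmod (f (p y) - f (p x))%C).
  - change (Rabs (snd (f (p y)) - snd (f (p x))) < e).
    eapply Rle_lt_trans; [|apply K]. apply (Im_le_Cmod (f (p y) - f (p x))%C).
Qed.

Lemma contR_horizontal (f : C -> C) (y a b : R) :
  (forall x, a <= x <= b -> Ccont f (x, y)) -> contR (fun x => f (x, y)) a b.
Proof.
  apply (contR_of_Ccont f (fun x => (x, y))). intros s t.
  eapply Rle_trans; [apply Cmod_le_abs|]. cbn [fst snd Cminus Cplus Copp].
  replace (y + - y) with 0 by ring. rewrite Rabs_R0. unfold Rminus. lra.
Qed.

Lemma contR_vertical (f : C -> C) (x a b : R) :
  (forall y, a <= y <= b -> Ccont f (x, y)) -> contR (fun y => f (x, y)) a b.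
Proof.
  apply (contR_of_Ccont f (fun y => (x, y))). intros s t.
  eapply Rle_trans; [apply Cmod_le_abs|]. cbn [fst snd Cminus Cplus Copp].
  replace (x + - x) with 0 by ring. rewrite Rabs_R0. unfold Rminus. lra.
Qed.

Lemma CInt_ext f g a b : a <= b -> (forall x, a <= x <= b -> f x = g x) -> CInt f a b = CInt g a b.
Proof.
  intros H E. unfold CInt. f_equal; apply RInt_ext; intros x Hx;
  rewrite Rmin_left, Rmax_right in Hx by lra; rewrite E; auto; lra.
Qed.

Lemma CInt_plus f g a b : a <= b -> contR f a b -> contR g a b ->
  CInt (fun x => f x + g x)%C a b = (CInt f a b + CInt g a b)%C.
Proof.
  intros H Hf Hg. destruct (contR_ex f a b H Hf), (contR_ex g a b H Hg).
  unfold CInt, Cplus; cbn [fst snd].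
  f_equal; apply (RInt_plus (V := R_CompleteNormedModule)); auto.
Qed.

Lemma CInt_minus f g a b : a <= b -> contR f a b -> contR g a b ->
  CInt (fun x => f x - g x)%C a b = (CInt f a b - CInt g a b)%C.
Proof.
  intros H Hf Hg. destruct (contR_ex f a b H Hf), (contR_ex g a b H Hg).
  unfold CInt, Cminus, Cplus, Copp; cbn [fst snd].
  f_equal; apply (RInt_minus (V := R_CompleteNormedModule)); auto.
Qed.

Lemma CInt_scal (c : C) f a b : a <= b -> contR f a b ->
  CInt (fun x => c * f x)%C a b = (c * CInt f a b)%C.
Proof.
  intros H Hf. destruct (contR_ex f a b H Hf) as [E1 E2].
  unfold CInt, Cmult; cbn [fst snd]. f_equal.
  - rewrite <- (RInt_scal (V := R_CompleteNormedModule)), <- (RInt_scal (V := R_CompleteNormedModule)) by auto.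
    symmetry; rewrite <- (RInt_minus (V := R_CompleteNormedModule)); auto;
    now apply (ex_RInt_scal (V := R_NormedModule)).
  - rewrite <- (RInt_scal (V := R_CompleteNormedModule)), <- (RInt_scal (V := R_CompleteNormedModule)) by auto.
    symmetry; rewrite <- (RInt_plus (V := R_CompleteNormedModule)); auto;
    now apply (ex_RInt_scal (V := R_NormedModule)).
Qed.

Lemma CInt_const (c : C) a b : CInt (fun _ => c) a b = ((b - a)%R * c)%C.
Proof.
  unfold CInt, Cmult, RtoC; cbn [fst snd].
  rewrite !RInt_const. unfold scal; simpl; unfold mult; simpl. f_equal; ring.
Qed.

Lemma CInt_Chasles f a b c : a <= b <= c -> contR f a c ->
  CInt f a c = (CInt f a b + CInt f b c)%C.
Proof.
  intros H Hf.
  assert (H1 : contR f a b) by (eapply contR_sub; [| |apply Hf]; lra).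
  assert (H2 : contR f b c) by (eapply contR_sub; [| |apply Hf]; lra).
  destruct (contR_ex f a b (proj1 H) H1), (contR_ex f b c (proj2 H) H2).
  unfold CInt, Cplus; cbn [fst snd].
  f_equal; symmetry; apply (RInt_Chasles (V := R_CompleteNormedModule)); auto.
Qed.

Lemma CInt_bound f (g : R -> R) a b : a <= b -> contR f a b -> ex_RInt g a b ->
  (forall x, a <= x <= b -> Cmod (f x) <= g x) -> Cmod (CInt f a b) <= 2 * RInt g a b.
Proof.
  intros H Hf Hg K. destruct (contR_ex f a b H Hf) as [E1 E2].
  eapply Rle_trans; [apply Cmod_le_abs|]. unfold CInt; cbn [fst snd].
  assert (Rabs (RInt (fun x => fst (f x)) a b) <= RInt g a b).
  { eapply Rle_trans; [apply abs_RInt_le; auto|]. apply RInt_le; auto.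
    - now apply (ex_RInt_norm).
    - intros x Hx. eapply Rle_trans; [apply Re_le_Cmod|]. apply K; lra. }
  assert (Rabs (RInt (fun x => snd (f x)) a b) <= RInt g a b).
  { eapply Rle_trans; [apply abs_RInt_le; auto|]. apply RInt_le; auto.
    - now apply (ex_RInt_norm).
    - intros x Hx. eapply Rle_trans; [apply Im_le_Cmod|]. apply K; lra. }
  lra.
Qed.

Lemma CInt_bound_const f M a b : a <= b -> contR f a b ->
  (forall x, a <= x <= b -> Cmod (f x) <= M) -> Cmod (CInt f a b) <= 2 * M * (b - a).
Proof.
  intros H Hf K.
  eapply Rle_trans; [apply (CInt_bound f (fun _ => M)); auto; apply ex_RInt_const|].
  rewrite RInt_const. unfold scal; simpl; unfold mult; simpl. lra.
Qed.

(** The bound does not depend on [b], so it controls all truncations of a ray at once. *)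
Lemma CInt_bound_exp f K a b : 0 <= K -> a <= b -> contR f a b ->
  (forall x, a <= x <= b -> Cmod (f x) <= K * exp (- x)) ->
  Cmod (CInt f a b) <= 2 * K * exp (- a).
Proof.
  intros HK H Hf B.
  assert (I : is_RInt (fun x => K * exp (- x)) a b (- K * exp (- b) - - K * exp (- a))).
  { apply (is_RInt_derive (V := R_CompleteNormedModule) (fun x => - K * exp (- x))).
    - intros; auto_derive; auto. ring.
    - intros. apply (ex_derive_continuous (V := R_NormedModule)). auto_derive; auto. }
  eapply Rle_trans; [apply (CInt_bound f (fun x => K * exp (- x))); auto|].
  - eexists; apply I.
  - rewrite (is_RInt_unique _ _ _ _ I).
    assert (0 <= K * exp (- b)) by (generalize (exp_pos (- b)); nra). lra.
Qed.

(** * Integrals over the positively oriented boundary of a rectangle *)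

Definition rect_int (f : C -> C) (a b c d : R) : C :=
  (CInt (fun x => f (x, c) - f (x, d)) a b + Ci * CInt (fun y => f (b, y) - f (a, y)) c d)%C.

Definition cont_rect (f : C -> C) (a b c d : R) : Prop :=
  forall x y, a <= x <= b -> c <= y <= d -> Ccont f (x, y).

Lemma cont_rect_h f a b c d y : cont_rect f a b c d -> c <= y <= d ->
  contR (fun x => f (x, y)) a b.
Proof. intros H Hy. apply contR_horizontal. intros; now apply H. Qed.

Lemma cont_rect_v f a b c d x : cont_rect f a b c d -> a <= x <= b ->
  contR (fun y => f (x, y)) c d.
Proof. intros H Hy. apply contR_vertical. intros; now apply H. Qed.

Lemma cont_rect_sub f a b c d a' b' c' d' :
  a <= a' -> b' <= b -> c <= c' -> d' <= d -> cont_rect f a b c d -> cont_rect f a' b' c' d'.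
Proof. intros ? ? ? ? H x y ? ?. apply H; lra. Qed.

Lemma rect_int_split_h f a m b c d : a <= m <= b -> c <= d ->
  contR (fun x => f (x, c)) a b -> contR (fun x => f (x, d)) a b ->
  contR (fun y => f (a, y)) c d -> contR (fun y => f (m, y)) c d -> contR (fun y => f (b, y)) c d ->
  rect_int f a b c d = (rect_int f a m c d + rect_int f m b c d)%C.
Proof.
  intros Hm Hc H1 H2 H3 H4 H5. unfold rect_int.
  rewrite (CInt_Chasles _ a m b) by (auto using contR_minus).
  rewrite (CInt_ext (fun y => f (b, y) - f (a, y))%C
    (fun y => (f (b, y) - f (m, y)) + (f (m, y) - f (a, y)))%C c d) by (auto; intros; ring).
  rewrite (CInt_plus (fun y => (f (b, y) - f (m, y))%C)) by auto using contR_minus.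
  ring.
Qed.

Lemma rect_int_split_v f a b c m d : a <= b -> c <= m <= d ->
  contR (fun x => f (x, c)) a b -> contR (fun x => f (x, m)) a b -> contR (fun x => f (x, d)) a b ->
  contR (fun y => f (a, y)) c d -> contR (fun y => f (b, y)) c d ->
  rect_int f a b c d = (rect_int f a b c m + rect_int f a b m d)%C.
Proof.
  intros Hm Hc H1 H2 H3 H4 H5. unfold rect_int.
  rewrite (CInt_Chasles _ c m d) by (auto using contR_minus).
  rewrite (CInt_ext (fun y => f (y, c) - f (y, d))%C
    (fun y => (f (y, c) - f (y, m)) + (f (y, m) - f (y, d)))%C a b) by (auto; intros; ring).
  rewrite (CInt_plus (fun y => (f (y, c) - f (y, m))%C)) by auto using contR_minus.
  ring.
Qed.

(** Only the four sides matter, so that a pole inside the rectangle is allowed. *)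
Definition cont_bdry (f : C -> C) (a b c d : R) : Prop :=
  contR (fun x => f (x, c)) a b /\ contR (fun x => f (x, d)) a b /\
  contR (fun y => f (a, y)) c d /\ contR (fun y => f (b, y)) c d.

Lemma cont_rect_bdry f a b c d : a <= b -> c <= d -> cont_rect f a b c d -> cont_bdry f a b c d.
Proof.
  intros H H' K. unfold cont_bdry.
  repeat apply conj; first [apply (cont_rect_h _ _ _ c d); auto; lra | apply (cont_rect_v _ a b c d); auto; lra].
Qed.

Lemma rect_int_plus f g a b c d : a <= b -> c <= d ->
  cont_bdry f a b c d -> cont_bdry g a b c d ->
  rect_int (fun z => f z + g z)%C a b c d = (rect_int f a b c d + rect_int g a b c d)%C.
Proof.
  intros H H' (F1 & F2 & F3 & F4) (G1 & G2 & G3 & G4). unfold rect_int.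
  rewrite (CInt_ext _ (fun x => (f (x, c) - f (x, d)) + (g (x, c) - g (x, d)))%C a b) by (auto; intros; ring).
  rewrite (CInt_ext _ (fun y => (f (b, y) - f (a, y)) + (g (b, y) - g (a, y)))%C c d) by (auto; intros; ring).
  rewrite (CInt_plus (fun x => (f (x, c) - f (x, d))%C)), (CInt_plus (fun y => (f (b, y) - f (a, y))%C))
    by auto using contR_minus.
  ring.
Qed.

Lemma rect_int_scal q f a b c d : a <= b -> c <= d -> cont_bdry f a b c d ->
  rect_int (fun z => q * f z)%C a b c d = (q * rect_int f a b c d)%C.
Proof.
  intros H H' (F1 & F2 & F3 & F4). unfold rect_int.
  rewrite (CInt_ext _ (fun x => q * (f (x, c) - f (x, d)))%C a b) by (auto; intros; ring).
  rewrite (CInt_ext _ (fun y => q * (f (b, y) - f (a, y)))%C c d) by (auto; intros; ring).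
  rewrite !CInt_scal by auto using contR_minus. ring.
Qed.

Lemma rect_int_translate f (u : C) a b c d : a <= b -> c <= d ->
  cont_bdry f (a - fst u) (b - fst u) (c - snd u) (d - snd u) ->
  rect_int (fun z => f (z - u))%C a b c d = rect_int f (a - fst u) (b - fst u) (c - snd u) (d - snd u).
Proof.
  assert (K0 : forall (g : R -> R) v s t, ex_RInt g (s - v) (t - v) ->
     RInt (fun x => g (x - v)) s t = RInt g (s - v) (t - v)).
  { intros g v s t H.
    replace (s - v) with (1 * s + - v) in * by ring. replace (t - v) with (1 * t + - v) in * by ring.
    rewrite <- (RInt_comp_lin (V := R_CompleteNormedModule)) by auto.
    apply RInt_ext. intros x _. replace (1 * x + - v) with (x - v) by ring.
    unfold scal; simpl; unfold mult; simpl. ring. }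
  assert (K : forall (g : R -> C) v s t, s <= t -> contR g (s - v) (t - v) ->
     CInt (fun x => g (x - v)) s t = CInt g (s - v) (t - v)).
  { intros g v s t H Hg. destruct (contR_ex g (s - v) (t - v)) as [E1 E2]; auto; [lra|].
    unfold CInt. f_equal; [apply (K0 (fun x => fst (g x)))|apply (K0 (fun x => snd (g x)))]; auto. }
  intros H H' (F1 & F2 & F3 & F4). unfold rect_int.
  rewrite <- K, <- K by (auto using contR_minus). reflexivity.
Qed.

(** Affine functions have primitives. The Goursat argument removes the first order Taylor polynomial
    in this way. *)
Lemma rect_int_affine p q a b c d :
  rect_int (fun z => p + q * z)%C a b c d = 0%C.
Proof.
  unfold rect_int.
  replace (CInt _ a b) with (CInt (fun _ => q * (Ci * (c - d)%R)) a b)%C.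
  - replace (CInt _ c d) with (CInt (fun _ => q * (b - a)%R) c d)%C.
    + rewrite !CInt_const. rewrite !RtoC_minus. ring.
    + unfold CInt; f_equal; apply RInt_ext; intros; simpl; ring.
  - unfold CInt; f_equal; apply RInt_ext; intros; simpl; ring.
Qed.

Lemma rect_int_bound f M a b c d : a <= b -> c <= d -> 0 <= M ->
  cont_bdry f a b c d ->
  (forall x y, a <= x <= b -> c <= y <= d -> (x = a \/ x = b \/ y = c \/ y = d) -> Cmod (f (x, y)) <= M) ->
  Cmod (rect_int f a b c d) <= 4 * M * ((b - a) + (d - c)).
Proof.
  intros H H' HM (F1 & F2 & F3 & F4) B. unfold rect_int.
  eapply Rle_trans; [apply Cmod_triangle|]. rewrite Cmod_mult, Cmod_Ci, Rmult_1_l.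
  assert (Cmod (CInt (fun x => f (x, c) - f (x, d))%C a b) <= 2 * (2 * M) * (b - a)).
  { apply CInt_bound_const; auto.
    - now apply contR_minus.
    - intros x Hx. eapply Rle_trans; [apply Cmod_triangle_minus|].
      assert (Cmod (f (x, c)) <= M) by (apply B; lra).
      assert (Cmod (f (x, d)) <= M) by (apply B; lra). lra. }
  assert (Cmod (CInt (fun y => f (b, y) - f (a, y))%C c d) <= 2 * (2 * M) * (d - c)).
  { apply CInt_bound_const; auto.
    - now apply contR_minus.
    - intros x Hx. eapply Rle_trans; [apply Cmod_triangle_minus|].
      assert (Cmod (f (b, x)) <= M) by (apply B; lra).
      assert (Cmod (f (a, x)) <= M) by (apply B; lra). lra. }
  lra.
Qed.

(** * Goursat's theorem and the residue theorem *)

Definition holo_rect (f : C -> C) (a b c d : R) : Prop :=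
  forall x y, a <= x <= b -> c <= y <= d -> exists l, cderiv f (x, y) l.

Lemma holo_cont_rect f a b c d : holo_rect f a b c d -> cont_rect f a b c d.
Proof. intros H x y Hx Hy. destruct (H x y Hx Hy) as [l Hl]. now apply cderiv_cont in Hl. Qed.

Lemma rect_int_quarter f a b c d w h : 0 <= w -> 0 <= h -> b = a + 2 * w -> d = c + 2 * h ->
  cont_rect f a b c d ->
  exists a' c', a <= a' /\ a' + w <= b /\ c <= c' /\ c' + h <= d /\
    Cmod (rect_int f a b c d) <= 4 * Cmod (rect_int f a' (a' + w) c' (c' + h)).
Proof.
  intros Hw Hh -> -> H.
  assert (E : rect_int f a (a + 2 * w) c (c + 2 * h) =
    (rect_int f a (a + w) c (c + h) + rect_int f a (a + w) (c + h) (c + 2 * h)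
     + (rect_int f (a + w) (a + 2 * w) c (c + h) + rect_int f (a + w) (a + 2 * w) (c + h) (c + 2 * h)))%C).
  { rewrite (rect_int_split_h f a (a + w)); try lra;
      match goal with |- contR (fun x => f (x, _)) _ _ => apply (cont_rect_h _ _ _ c (c + 2 * h)); auto; lra
      | |- contR _ _ _ => apply (cont_rect_v _ a (a + 2 * w) c (c + 2 * h)); auto; lra | _ => idtac end.
    f_equal; apply rect_int_split_v; try lra;
      match goal with
      | |- contR (fun x => f (x, _)) _ _ =>
          apply (cont_rect_h _ _ _ c (c + 2 * h)); [eapply cont_rect_sub; [| | | |exact H]; lra|lra]
      | |- _ => apply (cont_rect_v _ a (a + 2 * w)); [eapply cont_rect_sub; [| | | |exact H]; lra|lra]
      end. }
  set (T := Cmod (rect_int f a (a + 2 * w) c (c + 2 * h))) in *.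
  destruct (Rle_dec T (4 * Cmod (rect_int f a (a + w) c (c + h)))) as [h1|h1].
  { exists a, c. repeat split; auto; lra. }
  destruct (Rle_dec T (4 * Cmod (rect_int f a (a + w) (c + h) (c + 2 * h)))) as [h2|h2].
  { exists a, (c + h). replace (c + h + h) with (c + 2 * h) by ring. repeat split; auto; lra. }
  destruct (Rle_dec T (4 * Cmod (rect_int f (a + w) (a + 2 * w) c (c + h)))) as [h3|h3].
  { exists (a + w), c. replace (a + w + w) with (a + 2 * w) by ring. repeat split; auto; lra. }
  exists (a + w), (c + h).
  replace (c + h + h) with (c + 2 * h) by ring. replace (a + w + w) with (a + 2 * w) by ring.
  repeat split; try lra.
  assert (B : T <= Cmod (rect_int f a (a + w) c (c + h)) + Cmod (rect_int f a (a + w) (c + h) (c + 2 * h))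
    + (Cmod (rect_int f (a + w) (a + 2 * w) c (c + h)) + Cmod (rect_int f (a + w) (a + 2 * w) (c + h) (c + 2 * h)))).
  { unfold T. rewrite E. eapply Rle_trans; [apply Cmod_triangle|].
    apply Rplus_le_compat; apply Cmod_triangle. }
  lra.
Qed.

(** Some quarter always carries at least a quarter of the integral. The nested quarters shrink to a
    point, and differentiability there makes the integral of the non-affine part small compared with
    the square of the diameter, which beats the factor [4 ^ n]. *)
Lemma goursat f a b c d : a <= b -> c <= d -> holo_rect f a b c d -> rect_int f a b c d = 0%C.
Proof.
  intros Hab Hcd Hf. set (w := b - a). set (h := d - c).
  assert (Hc := holo_cont_rect _ _ _ _ _ Hf).
  assert (Hw : 0 <= w) by (unfold w; lra). assert (Hh : 0 <= h) by (unfold h; lra).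
  set (sub := fun n (p : R * R) =>
    rect_int f (fst p) (fst p + w / 2 ^ n) (snd p) (snd p + h / 2 ^ n)).
  assert (P2 : forall n, 0 < 2 ^ n) by (intros; apply pow_lt; lra).
  assert (D0 : forall n t, 0 <= t -> 0 <= t / 2 ^ n).
  { intros; apply Rdiv_le_0_compat; auto. }
  assert (DS : forall n t, t / 2 ^ n = 2 * (t / 2 ^ S n)).
  { intros; simpl; field. generalize (P2 n); lra. }
  set (inb := fun n (p : R * R) => a <= fst p /\ fst p + w / 2 ^ n <= b /\ c <= snd p /\ snd p + h / 2 ^ n <= d).
  set (good := fun n (p q : R * R) => fst p <= fst q /\ fst q + w / 2 ^ S n <= fst p + w / 2 ^ n /\
     snd p <= snd q /\ snd q + h / 2 ^ S n <= snd p + h / 2 ^ n /\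
     Cmod (sub n p) <= 4 * Cmod (sub (S n) q)).
  assert (St : forall n p, inb n p -> exists q, good n p q).
  { intros n p (B1 & B2 & B3 & B4).
    destruct (rect_int_quarter f (fst p) (fst p + w / 2 ^ n) (snd p) (snd p + h / 2 ^ n) (w / 2 ^ S n) (h / 2 ^ S n))
      as (a' & c' & K); try (rewrite <- DS; ring); auto.
    - eapply cont_rect_sub; [| | | |apply Hc]; lra.
    - exists (a', c'). unfold good, sub; cbn [fst snd]. lra. }
  (* [epsilon] picks a good quarter at each level; such a quarter exists because [inb] is inherited
     along [good]. *)
  set (p := fix p (n : nat) : R * R := match n with O => (a, c)
    | S n => epsilon (inhabits (a, c)) (good n (p n)) end).
  assert (G : forall n, inb n (p n) /\ good n (p n) (p (S n))).
  { assert (I : forall n, inb n (p n) -> good n (p n) (p (S n))).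
    { intros n Hn. cbn [p]. apply epsilon_spec. now apply St. }
    intros n. cut (inb n (p n)); [intros; split; auto|].
    induction n as [|n IH].
    - unfold inb, p, w, h; cbn [fst snd pow]. lra.
    - generalize (I n IH). unfold inb, good in *. lra. }
  clear St. assert (Gi := fun n => proj1 (G n)). assert (Gg := fun n => proj2 (G n)). clear G.
  clearbody p.
  assert (Mono : forall n m, (n <= m)%nat -> fst (p n) <= fst (p m) /\ snd (p n) <= snd (p m) /\
     fst (p m) + w / 2 ^ m <= fst (p n) + w / 2 ^ n /\ snd (p m) + h / 2 ^ m <= snd (p n) + h / 2 ^ n).
  { intros n m L. induction L as [|m L IH]; [lra|]. destruct (Gg m) as (A1 & A2 & A3 & A4 & _). lra. }
  destruct (ex_finite_lim_seq_incr (fun n => fst (p n)) b) as [x Hx].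
  { intros n. apply (Mono n (S n)). lia. }
  { intros n. destruct (Gi n) as (A1 & A2 & _). generalize (D0 n w Hw); lra. }
  destruct (ex_finite_lim_seq_incr (fun n => snd (p n)) d) as [y Hy].
  { intros n. apply (Mono n (S n)). lia. }
  { intros n. destruct (Gi n) as (_ & _ & A1 & A2). generalize (D0 n h Hh); lra. }
  assert (Bx : forall n, fst (p n) <= x <= fst (p n) + w / 2 ^ n).
  { intros n. split.
    - apply (is_lim_seq_incr_compare _ _ Hx (fun n => proj1 (Mono n (S n) ltac:(lia)))).
    - apply (is_lim_seq_le_loc (fun n => fst (p n)) (fun _ => fst (p n) + w / 2 ^ n) x (fst (p n) + w / 2 ^ n));
        auto using is_lim_seq_const.
      exists n. intros m L. destruct (Mono n m L). generalize (D0 m w Hw). lra. }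
  assert (By : forall n, snd (p n) <= y <= snd (p n) + h / 2 ^ n).
  { intros n. split.
    - apply (is_lim_seq_incr_compare _ _ Hy (fun n => proj1 (proj2 (Mono n (S n) ltac:(lia))))).
    - apply (is_lim_seq_le_loc (fun n => snd (p n)) (fun _ => snd (p n) + h / 2 ^ n) y (snd (p n) + h / 2 ^ n));
        auto using is_lim_seq_const.
      exists n. intros m L. destruct (Mono n m L) as (_ & _ & _ & ?). generalize (D0 m h Hh). lra. }
  clear Hx Hy.
  assert (Low : forall n, Cmod (rect_int f a b c d) <= 4 ^ n * Cmod (sub n (p n))).
  { induction n as [|n IH].
    - destruct (Gi O) as (A1 & A2 & A3 & A4). cbn [pow] in *. unfold sub.
      replace (fst (p O)) with a by (unfold w in *; lra). replace (snd (p O)) with c by (unfold h in *; lra).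
      replace (a + w / 2 ^ 0) with b by (unfold w; simpl; field).
      replace (c + h / 2 ^ 0) with d by (unfold h; simpl; field). lra.
    - destruct (Gg n) as (_ & _ & _ & _ & K). simpl pow.
      assert (0 < 4 ^ n) by (apply pow_lt; lra). nra. }
  destruct (Hf x y) as [l Hl].
  { destruct (Gi O) as (A1 & A2 & _). generalize (Bx O). lra. }
  { destruct (Gi O) as (_ & _ & A1 & A2). generalize (By O). lra. }
  apply Cmod_small_0. intros e He.
  set (S := w + h + 1). assert (HS : 0 < S) by (unfold S; lra).
  (* With this tolerance the bound at level [n] is [4 ^ n * 4 * (e / (4 S S)) * (S / 2 ^ n) ^ 2 =
     e]. *)
  destruct (Hl (e / (4 * S * S))) as (dl & Hd & K).
  { apply Rdiv_lt_0_compat; nra. }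
  assert (exists n, S / 2 ^ n < dl) as [n Hn].
  { assert (Hq : 0 < dl / S) by now apply Rdiv_lt_0_compat.
    destruct (pow_lt_1_zero (/ 2) ltac:(rewrite Rabs_pos_eq; lra) (dl / S) Hq) as [N HN].
    exists N. specialize (HN N (le_n _)). rewrite Rabs_pos_eq in HN by (apply pow_le; lra).
    rewrite pow_inv in HN. unfold Rdiv at 1. apply Rlt_div_r in HN; lra. }
  eapply Rle_trans; [apply (Low n)|].
  assert (Ef : rect_int (fun z => (f z - f (x, y) - l * (z - (x, y))) + ((f (x, y) - l * (x, y)) + l * z))%C
    (fst (p n)) (fst (p n) + w / 2 ^ n) (snd (p n)) (snd (p n) + h / 2 ^ n) = sub n (p n)).
  { unfold sub. f_equal.
    apply functional_extensionality. intros z. ring. }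
  destruct (Gi n) as (A1 & A2 & A3 & A4).
  assert (W := D0 n w Hw). assert (Hn' := D0 n h Hh).
  assert (Cs : cont_rect f (fst (p n)) (fst (p n) + w / 2 ^ n) (snd (p n)) (snd (p n) + h / 2 ^ n)).
  { eapply cont_rect_sub; [| | | |exact Hc]; lra. }
  assert (Ce : cont_rect (fun z => f z - f (x, y) - l * (z - (x, y)))%C
     (fst (p n)) (fst (p n) + w / 2 ^ n) (snd (p n)) (snd (p n) + h / 2 ^ n)).
  { intros s t Hs Ht. apply Ccont_minus; [apply Ccont_minus; [now apply Cs|apply Ccont_const]|].
    apply Ccont_mult; [apply Ccont_const|]. apply Ccont_minus; [apply Ccont_id|apply Ccont_const]. }
  rewrite <- Ef, rect_int_plus; [|lra|lra|apply cont_rect_bdry; auto; lra|].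
  2:{ apply cont_rect_bdry; try lra. intros s t _ _. apply Ccont_plus; [apply Ccont_const|].
      apply Ccont_mult; [apply Ccont_const|apply Ccont_id]. }
  rewrite rect_int_affine, Cplus_0_r.
  assert (E2 : w / 2 ^ n + h / 2 ^ n <= S / 2 ^ n).
  { unfold S. assert (0 < / 2 ^ n) by now apply Rinv_0_lt_compat. unfold Rdiv. nra. }
  assert (B : Cmod (rect_int (fun z => f z - f (x, y) - l * (z - (x, y)))%C
     (fst (p n)) (fst (p n) + w / 2 ^ n) (snd (p n)) (snd (p n) + h / 2 ^ n)) <=
     4 * (e / (4 * S * S) * (S / 2 ^ n)) * (w / 2 ^ n + h / 2 ^ n)).
  { assert (0 < e / (4 * S * S)) by (apply Rdiv_lt_0_compat; nra).
    replace (w / 2 ^ n + h / 2 ^ n) with (fst (p n) + w / 2 ^ n - fst (p n) + (snd (p n) + h / 2 ^ n - snd (p n))) by ring.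
    apply rect_int_bound; try lra.
    - apply Rmult_le_pos; [lra|]. apply D0. lra.
    - apply cont_rect_bdry; auto; lra.
    - intros s t Hs Ht _.
      assert (M : Cmod ((s, t) - (x, y)) <= S / 2 ^ n).
      { eapply Rle_trans; [apply Cmod_le_abs|]. cbn [fst snd Cminus Cplus Copp].
        eapply Rle_trans; [|apply E2]. generalize (Bx n) (By n). intros.
        apply Rplus_le_compat; apply Rabs_le; lra. }
      eapply Rle_trans; [apply K; lra|]. apply Rmult_le_compat_l; lra. }
  assert (P4 : 4 ^ n = 2 ^ n * 2 ^ n) by (rewrite <- Rpow_mult_distr; f_equal; ring).
  apply Rle_trans with (4 ^ n * (4 * (e / (4 * S * S) * (S / 2 ^ n)) * (S / 2 ^ n))).
  - apply Rmult_le_compat_l; [apply pow_le; lra|]. eapply Rle_trans; [apply B|].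
    apply Rmult_le_compat_l; auto.
    assert (0 < e / (4 * S * S)) by (apply Rdiv_lt_0_compat; nra).
    assert (0 <= S / 2 ^ n) by (apply D0; lra).
    apply Rmult_le_pos; [lra|]. apply Rmult_le_pos; lra.
  - right. rewrite P4. field. generalize (P2 n); split; lra.
Qed.

(** The primitives are explicit: half logarithms of [x ^ 2 + y ^ 2] and arctangents of [x / y]. The
    logarithms cancel around the boundary, and each corner contributes
    [atan t + atan (1 / t) = PI / 2]. *)
Lemma rect_int_inv a b c d : a < 0 < b -> c < 0 < d ->
  rect_int (fun z => / z)%C a b c d = (2 * PI * Ci)%C.
Proof.
  intros Ha Hc.
  assert (nz : forall x y, x <> 0 \/ y <> 0 -> 0 < x * x + y * y).
  { intros x y [H|H]; apply Rsqr_pos_lt in H; unfold Rsqr in H;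
    generalize (Rle_0_sqr x) (Rle_0_sqr y); unfold Rsqr; lra. }
  assert (IH : forall y, y <> 0 -> forall s t, s <= t ->
     is_RInt (fun x => x / (x * x + y * y)) s t (ln (t * t + y * y) / 2 - ln (s * s + y * y) / 2)).
  { intros y Hy s t Hst.
    apply (is_RInt_derive (V := R_CompleteNormedModule) (fun x => ln (x * x + y * y) / 2)).
    - intros x _. assert (0 < x * x + y * y) by auto. auto_derive; auto. field. lra.
    - intros x _. assert (0 < x * x + y * y) by auto.
      apply (ex_derive_continuous (V := R_NormedModule)). auto_derive. lra. }
  assert (IA : forall y, y <> 0 -> forall s t, s <= t ->
     is_RInt (fun x => y / (x * x + y * y)) s t (atan (t / y) - atan (s / y))).
  { intros y Hy s t Hst.
    apply (is_RInt_derive (V := R_CompleteNormedModule) (fun x => atan (x / y))).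
    - intros x _. assert (0 < x * x + y * y) by auto. auto_derive; auto. field.
      repeat split; auto; lra.
    - intros x _. assert (0 < x * x + y * y) by auto.
      apply (ex_derive_continuous (V := R_NormedModule)). auto_derive. lra. }
  assert (AI : forall x, 0 < x -> atan x + atan (/ x) = PI / 2).
  { intros x Hx. rewrite atan_inv by auto. ring. }
  assert (Dm : forall (f g : R -> R) s t lf lg, is_RInt f s t lf -> is_RInt g s t lg ->
     RInt (fun x => f x - g x) s t = lf - lg).
  { intros f g s t lf lg Hf Hg. apply is_RInt_unique.
    apply (is_RInt_minus (V := R_NormedModule)); auto. }
  unfold rect_int, CInt.
  rewrite (RInt_ext (fun x => fst (/ (x, c) - / (x, d))%C) (fun x => x / (x * x + c * c) - x / (x * x + d * d))).
  2:{ intros; cbn. field. split; apply Rgt_not_eq, nz; lra. }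
  rewrite (RInt_ext (fun x => snd (/ (x, c) - / (x, d))%C) (fun x => d / (x * x + d * d) - c / (x * x + c * c))).
  2:{ intros; cbn. field. split; apply Rgt_not_eq, nz; lra. }
  rewrite (RInt_ext (fun y => fst (/ (b, y) - / (a, y))%C) (fun y => b / (y * y + b * b) - a / (y * y + a * a))).
  2:{ intros; cbn. field. split; apply Rgt_not_eq, nz; lra. }
  rewrite (RInt_ext (fun y => snd (/ (b, y) - / (a, y))%C) (fun y => y / (y * y + a * a) - y / (y * y + b * b))).
  2:{ intros; cbn. field. split; apply Rgt_not_eq, nz; lra. }
  rewrite (Dm _ _ _ _ _ _ (IH c ltac:(lra) a b ltac:(lra)) (IH d ltac:(lra) a b ltac:(lra))).
  rewrite (Dm _ _ _ _ _ _ (IA d ltac:(lra) a b ltac:(lra)) (IA c ltac:(lra) a b ltac:(lra))).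
  rewrite (Dm _ _ _ _ _ _ (IA b ltac:(lra) c d ltac:(lra)) (IA a ltac:(lra) c d ltac:(lra))).
  rewrite (Dm _ _ _ _ _ _ (IH a ltac:(lra) c d ltac:(lra)) (IH b ltac:(lra) c d ltac:(lra))).
  unfold Cplus, Cmult, Ci, RtoC; cbn [fst snd].
  assert (Q : forall x y, 0 < x -> 0 < y -> atan (x / y) + atan (y / x) = PI / 2).
  { intros x y Hx Hy. replace (y / x) with (/ (x / y)) by (field; lra). apply AI. now apply Rdiv_lt_0_compat. }
  assert (Q1 := Q b d ltac:(lra) ltac:(lra)).
  assert (Q2 := Q (-a) d ltac:(lra) ltac:(lra)).
  assert (Q3 := Q b (-c) ltac:(lra) ltac:(lra)).
  assert (Q4 := Q (-a) (-c) ltac:(lra) ltac:(lra)).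
  replace (- a / d) with (- (a / d)) in Q2 by (field; lra).
  replace (d / - a) with (- (d / a)) in Q2 by (field; lra).
  replace (b / - c) with (- (b / c)) in Q3 by (field; lra).
  replace (- c / b) with (- (c / b)) in Q3 by (field; lra).
  replace (- a / - c) with (a / c) in Q4 by (field; lra).
  replace (- c / - a) with (c / a) in Q4 by (field; lra).
  rewrite !atan_opp in *.
  rewrite (Rplus_comm (a * a)), (Rplus_comm (b * b) (c * c)), (Rplus_comm (b * b) (d * d)), ?(Rplus_comm (a * a)).
  f_equal; lra.
Qed.

(** Boundedness of [g = f - r / (w - u)] near [u] replaces a Laurent expansion: Goursat shrinks the
    contour of [g] to a small square around [u], whose integral tends to 0 with its side. What
    remains is the integral of [1 / z]. *)
Lemma residue_rect f a b c d (u r : C) M dl :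
  a < fst u < b -> c < snd u < d ->
  (forall x y, a <= x <= b -> c <= y <= d -> (x, y) <> u -> exists l, cderiv f (x, y) l) ->
  0 < dl -> (forall w, w <> u -> Cmod (w - u) < dl -> Cmod (f w - r / (w - u)) <= M) ->
  rect_int f a b c d = (2 * PI * Ci * r)%C.
Proof.
  destruct u as [p q]; cbn [fst snd]. intros Hp Hq Hf Hd HM.
  set (g := fun w => (f w - r * / (w - (p, q)))%C).
  assert (Hg : forall x y, a <= x <= b -> c <= y <= d -> x <> p \/ y <> q -> exists l, cderiv g (x, y) l).
  { intros x y Hx Hy Hne. assert (N : (x, y) <> (p, q)) by (intros E; inversion E; lra).
    destruct (Hf x y Hx Hy N) as [l Hl]. eexists. unfold g.
    apply cderiv_plus; [apply Hl|].
    apply (cderiv_ext_loc (fun w => - r * / (w - (p, q)))%C _ _ _ 1); [lra|intros; ring|].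
    apply cderiv_mult; [apply cderiv_const|].
    apply cderiv_inv; [now apply Cminus_eq_contra|].
    apply cderiv_plus; [apply cderiv_id|apply cderiv_const]. }
  assert (Eg : f = (fun z => g z + r * / (z - (p, q)))%C).
  { apply functional_extensionality; intros; unfold g; ring. }
  assert (HMg : forall w, w <> (p, q) -> Cmod (w - (p, q)) < dl -> Cmod (g w) <= M) by exact HM.
  clearbody g. clear HM Hf. subst f.
  assert (Cg : forall x y, a <= x <= b -> c <= y <= d -> x <> p \/ y <> q -> Ccont g (x, y)).
  { intros x y Hx Hy Hne. destruct (Hg x y Hx Hy Hne) as [l Hl]. now apply cderiv_cont in Hl. }
  assert (Gh : forall y s t, c <= y <= d -> y <> q -> a <= s -> t <= b -> contR (fun x => g (x, y)) s t).
  { intros y s t Hy Hne Hs Ht. apply contR_horizontal. intros x Hx. apply Cg; auto; lra. }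
  assert (Gv : forall x s t, a <= x <= b -> x <> p -> c <= s -> t <= d -> contR (fun y => g (x, y)) s t).
  { intros x s t Hy Hne Hs Ht. apply contR_vertical. intros y Hx. apply Cg; auto; lra. }
  assert (Small : forall e, 0 < e -> a < p - e -> p + e < b -> c < q - e -> q + e < d ->
     rect_int g a b c d = rect_int g (p - e) (p + e) (q - e) (q + e)).
  { intros e He H1 H2 H3 H4.
    rewrite (rect_int_split_h g a (p - e) b), (rect_int_split_h g (p - e) (p + e) b),
      (rect_int_split_v g (p - e) (p + e) c (q - e) d), (rect_int_split_v g (p - e) (p + e) (q - e) (q + e) d);
      match goal with |- contR (fun x => g (x, _)) _ _ => apply Gh; lra | |- contR _ _ _ => apply Gv; lra | |- _ <= _ => lra | |- _ /\ _ => lra | _ => idtac end.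
    rewrite (goursat g a (p - e)), (goursat g (p + e) b), (goursat g (p - e) (p + e) c (q - e)),
      (goursat g (p - e) (p + e) (q + e) d); try lra;
      try (intros x y Hx Hy; apply Hg; lra). ring. }
  assert (Z : rect_int g a b c d = 0%C).
  { apply Cmod_small_0. intros e He.
    set (M' := Rmax M 0 + 1).
    set (m := Rmin (Rmin (p - a) (b - p)) (Rmin (q - c) (d - q))).
    (* The square of side [2 k] must fit into the rectangle, lie where the bound [M] holds, and
       contribute at most [16 M' k <= e]. *)
    set (k := Rmin (Rmin (m / 2) (dl / 3)) (e / (16 * M'))).
    assert (HM' : 0 < M') by (unfold M'; generalize (Rmax_r M 0); lra).
    assert (Hm : 0 < m) by (unfold m; repeat apply Rmin_glb_lt; lra).
    assert (Hk : 0 < k).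
    { unfold k; repeat apply Rmin_glb_lt; try lra. apply Rdiv_lt_0_compat; lra. }
    assert (k1 : k <= m / 2) by (unfold k; eapply Rle_trans; [apply Rmin_l|apply Rmin_l]).
    assert (k2 : k <= dl / 3) by (unfold k; eapply Rle_trans; [apply Rmin_l|apply Rmin_r]).
    assert (k3 : k <= e / (16 * M')) by apply Rmin_r.
    assert (m1 : m <= p - a) by (unfold m; eapply Rle_trans; [apply Rmin_l|apply Rmin_l]).
    assert (m2 : m <= b - p) by (unfold m; eapply Rle_trans; [apply Rmin_l|apply Rmin_r]).
    assert (m3 : m <= q - c) by (unfold m; eapply Rle_trans; [apply Rmin_r|apply Rmin_l]).
    assert (m4 : m <= d - q) by (unfold m; eapply Rle_trans; [apply Rmin_r|apply Rmin_r]).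
    rewrite (Small k) by lra.
    apply Rle_trans with (4 * M' * ((p + k - (p - k)) + (q + k - (q - k)))).
    - apply rect_int_bound; try lra.
      + unfold cont_bdry; repeat apply conj; [apply Gh; lra | apply Gh; lra | apply Gv; lra | apply Gv; lra].
      + intros x y Hx Hy Hb.
        assert (N : (x, y) <> (p, q)) by (intros E; inversion E; lra).
        apply Rle_trans with M; [|unfold M'; generalize (Rmax_l M 0); lra].
        apply HMg; auto. eapply Rle_lt_trans; [apply Cmod_le_abs|]. cbn [fst snd Cminus Cplus Copp].
        assert (Rabs (x + - p) <= k) by (apply Rabs_le; lra).
        assert (Rabs (y + - q) <= k) by (apply Rabs_le; lra). lra.
    - apply Rle_div_r in k3; lra. }
  assert (Cb : cont_bdry (fun z => / z)%C (a - p) (b - p) (c - q) (d - q)).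
  { assert (I : forall x y, x <> 0 \/ y <> 0 -> Ccont (fun z => / z)%C (x, y)).
    { intros x y N. apply (Ccont_inv (fun z => z)); [apply Ccont_id|]. intros E; inversion E; lra. }
    unfold cont_bdry; repeat apply conj; [apply (contR_horizontal (fun z => / z)%C); intros; apply I; lra | apply (contR_horizontal (fun z => / z)%C); intros; apply I; lra | apply (contR_vertical (fun z => / z)%C); intros; apply I; lra | apply (contR_vertical (fun z => / z)%C); intros; apply I; lra]. }
  assert (Cb' : cont_bdry (fun z => / (z - (p, q)))%C a b c d).
  { assert (I : forall x y, x <> p \/ y <> q -> Ccont (fun z => / (z - (p, q)))%C (x, y)).
    { intros x y N. apply (Ccont_inv (fun z => z - (p, q))%C).
      - apply Ccont_minus; [apply Ccont_id|apply Ccont_const].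
      - apply Cminus_eq_contra. intros E; inversion E; lra. }
    unfold cont_bdry; repeat apply conj; [apply (contR_horizontal (fun z => / (z - (p, q)))%C); intros; apply I; lra | apply (contR_horizontal (fun z => / (z - (p, q)))%C); intros; apply I; lra | apply (contR_vertical (fun z => / (z - (p, q)))%C); intros; apply I; lra | apply (contR_vertical (fun z => / (z - (p, q)))%C); intros; apply I; lra]. }
  rewrite rect_int_plus; try lra.
  - rewrite Z, rect_int_scal by (auto; lra).
    rewrite (rect_int_translate (fun z => / z)%C (p, q)) by (cbn [fst snd]; auto; lra).
    cbn [fst snd]. rewrite rect_int_inv by lra. ring.
  - unfold cont_bdry; repeat apply conj; [apply Gh; lra | apply Gh; lra | apply Gv; lra | apply Gv; lra].
  - destruct Cb' as (B1 & B2 & B3 & B4). unfold cont_bdry; repeat apply conj;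
    first [apply (contR_scal r _ _ _ B1) | apply (contR_scal r _ _ _ B2) | apply (contR_scal r _ _ _ B3)| apply (contR_scal r _ _ _ B4)]; auto.
Qed.

(** * Entire power series *)

Definition Clim (u : nat -> C) (l : C) : Prop :=
  forall eps, 0 < eps -> exists N, forall n, (N <= n)%nat -> Cmod (u n - l) < eps.

Lemma Clim_const c : Clim (fun _ => c) c.
Proof.
  intros e He. exists O. intros n _. replace (c - c)%C with (RtoC 0) by ring. now rewrite Cmod_0.
Qed.

Lemma Clim_plus u v l m : Clim u l -> Clim v m -> Clim (fun n => u n + v n)%C (l + m).
Proof.
  intros Hu Hv e He. destruct (Hu (e/2)) as [N HN]; [lra|]. destruct (Hv (e/2)) as [N' HN']; [lra|].
  exists (max N N'). intros n Hn. specialize (HN n ltac:(lia)). specialize (HN' n ltac:(lia)).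
  replace (u n + v n - (l + m))%C with ((u n - l) + (v n - m))%C by ring.
  eapply Rle_lt_trans; [apply Cmod_triangle|]. lra.
Qed.

Lemma Clim_scal c u l : Clim u l -> Clim (fun n => c * u n)%C (c * l).
Proof.
  intros Hu e He. assert (P := Cmod_ge_0 c). destruct (Hu (e / (Cmod c + 1))) as [N HN].
  { apply Rdiv_lt_0_compat; lra. }
  exists N. intros n Hn. specialize (HN n Hn). apply Rlt_div_r in HN; [|lra].
  replace (c * u n - c * l)%C with (c * (u n - l))%C by ring. rewrite Cmod_mult.
  generalize (Cmod_ge_0 (u n - l)). nra.
Qed.

Lemma Clim_unique u l m : Clim u l -> Clim u m -> l = m.
Proof.
  intros H H'. apply Ceq_minus, Cmod_small_0. intros e He.
  destruct (H (e/2)) as [N HN]; [lra|]. destruct (H' (e/2)) as [N' HN']; [lra|].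
  specialize (HN (max N N') ltac:(lia)). specialize (HN' (max N N') ltac:(lia)).
  replace (l - m)%C with ((u (max N N') - m) - (u (max N N') - l))%C by ring.
  eapply Rle_trans; [apply Cmod_triangle_minus|]. lra.
Qed.

Lemma Clim_le u l c M : Clim u l -> (exists N, forall n, (N <= n)%nat -> Cmod (u n - c) <= M) ->
  Cmod (l - c) <= M.
Proof.
  intros H [N HN]. apply le_epsilon. intros e He. destruct (H e He) as [N' HN'].
  specialize (HN (max N N') ltac:(lia)). specialize (HN' (max N N') ltac:(lia)).
  replace (l - c)%C with ((u (max N N') - c) - (u (max N N') - l))%C by ring.
  eapply Rle_trans; [apply Cmod_triangle_minus|]. lra.
Qed.

Lemma Clim_shift u l : Clim (fun n => u (S n)) l -> Clim u l.
Proof.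
  intros H e He. destruct (H e He) as [N HN]. exists (S N). intros [|n] Hn; [lia|].
  apply HN. lia.
Qed.

Lemma Clim_S u l : Clim u l -> Clim (fun n => u (S n)) l.
Proof. intros H e He. destruct (H e He) as [N HN]. exists N. intros n Hn. apply HN. lia. Qed.

Lemma Clim_ext u v l : (forall n, u n = v n) -> Clim u l -> Clim v l.
Proof. intros E H e He. destruct (H e He) as [N HN]. exists N. intros n Hn. rewrite <- E. auto. Qed.

Lemma Clim_squeeze (u : nat -> C) l (v : nat -> R) :
  (forall n, Cmod (u n - l) <= v n) -> is_lim_seq v 0 -> Clim u l.
Proof.
  intros H Hv e He. apply is_lim_seq_spec in Hv. destruct (Hv (mkposreal e He)) as [N HN].
  exists N. intros n Hn. specialize (HN n Hn). simpl in HN. rewrite Rminus_0_r in HN.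
  eapply Rle_lt_trans; [apply H|]. eapply Rle_lt_trans; [apply Rle_abs|apply HN].
Qed.

Lemma Ccauchy_lim (u : nat -> C) (v : nat -> R) : is_lim_seq v 0 ->
  (forall n m, (n <= m)%nat -> Cmod (u m - u n) <= v n) -> exists l, Clim u l.
Proof.
  intros Hv H. apply is_lim_seq_spec in Hv.
  assert (K : forall p : C -> R, (forall z w, p (z - w)%C = p z - p w) -> (forall z, Rabs (p z) <= Cmod z) ->
     ex_finite_lim_seq (fun n => p (u n))).
  { intros p Hp Hp'. apply ex_lim_seq_cauchy_corr. intros e.
    assert (He2 : 0 < e / 2) by (generalize (cond_pos e); lra).
    destruct (Hv (mkposreal _ He2)) as [N HN]. exists N.
    assert (A : forall n, (N <= n)%nat -> Rabs (p (u n) - p (u N)) < e / 2).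
    { intros n Hn. rewrite <- Hp. eapply Rle_lt_trans; [apply Hp'|].
      eapply Rle_lt_trans; [apply (H N n Hn)|]. specialize (HN N (le_n _)). simpl in HN.
      rewrite Rminus_0_r in HN. eapply Rle_lt_trans; [apply Rle_abs|exact HN]. }
    intros n m Hn Hm. specialize (A n Hn) as A1. specialize (A m Hm) as A2.
    replace (p (u n) - p (u m)) with ((p (u n) - p (u N)) - (p (u m) - p (u N))) by ring.
    eapply Rle_lt_trans; [apply Rabs_triang|]. rewrite Rabs_Ropp. lra. }
  destruct (K (fun z => fst z)) as [x Hx]; [reflexivity|apply Re_le_Cmod|].
  destruct (K (fun z => snd z)) as [y Hy]; [reflexivity|apply Im_le_Cmod|].
  exists (x, y). intros e He. apply is_lim_seq_spec in Hx. apply is_lim_seq_spec in Hy.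
  assert (He2 : 0 < e / 2) by lra.
  destruct (Hx (mkposreal _ He2)) as [N HN]. destruct (Hy (mkposreal _ He2)) as [N' HN'].
  exists (max N N'). intros n Hn. specialize (HN n ltac:(lia)). specialize (HN' n ltac:(lia)).
  eapply Rle_lt_trans; [apply Cmod_le_abs|]. simpl in *. unfold Rminus in *. lra.
Qed.

(** The index [n] itself is excluded, unlike in [sum_f_R0], so the sequence starts from the empty
    sum. *)
Fixpoint psum (a : nat -> C) (z : C) (n : nat) : C :=
  match n with O => RtoC 0 | S n => (psum a z n + a n * z ^ n)%C end.

Lemma psum_tail a z M q : 0 <= q < 1 -> (forall n, Cmod (a n) * Cmod z ^ n <= M * q ^ n) ->
  forall n m, (n <= m)%nat -> Cmod (psum a z m - psum a z n) <= M * q ^ n / (1 - q).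
Proof.
  intros Hq H n m L.
  assert (HM : 0 <= M).
  { specialize (H O). simpl in H. generalize (Cmod_ge_0 (a O)). lra. }
  assert (K : forall k, Cmod (psum a z (n + k) - psum a z n) <= M * q ^ n * ((1 - q ^ k) / (1 - q))).
  { induction k as [|k IH].
    - rewrite Nat.add_0_r. replace (psum a z n - psum a z n)%C with (RtoC 0) by ring.
      rewrite Cmod_0. simpl. right; field. lra.
    - rewrite Nat.add_succ_r. cbn [psum].
      replace (psum a z (n + k) + a (n + k)%nat * z ^ (n + k) - psum a z n)%C
        with ((psum a z (n + k) - psum a z n) + a (n + k)%nat * z ^ (n + k))%C by ring.
      eapply Rle_trans; [apply Cmod_triangle|]. rewrite Cmod_mult, Cmod_pow.
      specialize (H (n + k)%nat).
      apply Rle_trans with (M * q ^ n * ((1 - q ^ k) / (1 - q)) + M * q ^ (n + k)).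
      + lra.
      + right. rewrite pow_add. simpl. field. lra. }
  replace m with (n + (m - n))%nat by lia. eapply Rle_trans; [apply K|].
  unfold Rdiv.
  assert (0 <= q ^ n) by (apply pow_le; lra). assert (0 <= q ^ (m - n)) by (apply pow_le; lra).
  assert (0 < / (1 - q)) by (apply Rinv_0_lt_compat; lra).
  apply Rmult_le_compat_l; [nra|]. nra.
Qed.

Lemma is_lim_seq_geom_scal M q : 0 <= q < 1 -> is_lim_seq (fun n => M * q ^ n / (1 - q)) 0.
Proof.
  intros Hq. apply (is_lim_seq_ext (fun n => (M / (1 - q)) * q ^ n)).
  - intros; unfold Rdiv; ring.
  - replace (Finite 0) with (Rbar_mult (M / (1 - q)) 0) by (simpl; f_equal; ring).
    apply is_lim_seq_scal_l. apply is_lim_seq_geom. rewrite Rabs_pos_eq; lra.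
Qed.

Lemma psum_lim a z M q : 0 <= q < 1 -> (forall n, Cmod (a n) * Cmod z ^ n <= M * q ^ n) ->
  exists l, Clim (psum a z) l.
Proof.
  intros Hq H. apply (Ccauchy_lim _ (fun n => M * q ^ n / (1 - q))).
  - now apply is_lim_seq_geom_scal.
  - now apply psum_tail.
Qed.

Lemma psum_lim_tail a z M q l : 0 <= q < 1 -> (forall n, Cmod (a n) * Cmod z ^ n <= M * q ^ n) ->
  Clim (psum a z) l -> forall n, Cmod (l - psum a z n) <= M * q ^ n / (1 - q).
Proof.
  intros Hq H Hl n. apply (Clim_le (psum a z)); auto. exists n. intros m Hm. now apply psum_tail.
Qed.

Definition coef_bound (a : nat -> C) (r M : R) : Prop := forall n, Cmod (a n) * r ^ n <= M.

(** Infinite radius of convergence, stated by one bound per radius: such bounds pass to sums,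
    quotients and derivatives without any [limsup]. *)
Definition entire_coef (a : nat -> C) : Prop := forall r, 0 < r -> exists M, coef_bound a r M.

Definition ent (f : C -> C) (a : nat -> C) : Prop :=
  entire_coef a /\ forall z, Clim (psum a z) (f z).

Lemma coef_bound_geom a r M (z : C) : 0 < r -> coef_bound a r M ->
  forall n, Cmod (a n) * Cmod z ^ n <= M * (Cmod z / r) ^ n.
Proof.
  intros Hr H n. unfold Rdiv. rewrite Rpow_mult_distr, pow_inv.
  assert (0 < r ^ n) by now apply pow_lt.
  assert (0 <= Cmod z ^ n) by (apply pow_le, Cmod_ge_0).
  replace (Cmod (a n) * Cmod z ^ n) with ((Cmod (a n) * r ^ n) * (Cmod z ^ n * / r ^ n)) by (field; lra).
  apply Rmult_le_compat_r; [|apply H].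
  apply Rmult_le_pos; auto. left; now apply Rinv_0_lt_compat.
Qed.

Lemma div_lt_1 x r : 0 <= x < r -> 0 <= x / r < 1.
Proof. intros H. split; [apply Rdiv_le_0_compat; lra|]. apply Rlt_div_l; lra. Qed.

Lemma ent_exists a : entire_coef a -> exists f, ent f a.
Proof.
  intros Ha.
  assert (H : forall z, exists l, Clim (psum a z) l).
  { intros z. assert (P := Cmod_ge_0 z). destruct (Ha (Cmod z + 1)) as [M HM]; [lra|].
    apply (psum_lim a z M (Cmod z / (Cmod z + 1))).
    - apply div_lt_1; lra.
    - apply coef_bound_geom; auto; lra. }
  exists (fun z => epsilon (inhabits (RtoC 0)) (fun l => Clim (psum a z) l)).
  split; auto. intros z. now apply epsilon_spec.
Qed.

Lemma ent_bound f a r M (z : C) : ent f a -> coef_bound a r M -> Cmod z < r ->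
  Cmod (f z) <= M / (1 - Cmod z / r).
Proof.
  intros [_ Hf] HM Hz. assert (P := Cmod_ge_0 z).
  assert (T := psum_lim_tail a z M (Cmod z / r) (f z) (div_lt_1 (Cmod z) r ltac:(lra))
    (coef_bound_geom a r M z ltac:(lra) HM) (Hf z) O).
  simpl in T. replace (f z - 0)%C with (f z) in T by ring. now rewrite Rmult_1_r in T.
Qed.

(** The quotient has coefficients [b_n = sum_j a_(n + 1 + j) t ^ j], obtained from the Horner
    recursion [c_n = a_n + t c_(n + 1)]. The explicit bound serves repeated division. The last
    clause is Abel summation: it compares the termwise derivative at [t] with the series of
    [U t]. *)
Lemma ent_div f a t : ent f a -> exists U b, ent U b /\
  (forall w, f w - f t = (w - t) * U w)%C /\
  (forall r M, Cmod t < r -> coef_bound a r M -> coef_bound b r (M / (r - Cmod t))) /\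
  exists c, Clim (psum b t) c /\ c = U t /\
    (forall N, psum (fun n => (INR (S n) * a (S n))%C) t N + INR (S N) * b N * t ^ N = psum b t (S N))%C.
Proof.
  intros [Ha Hf]. assert (Pt := Cmod_ge_0 t).
  assert (Hc : forall n, exists l, Clim (psum (fun k => a (n + k)%nat) t) l).
  { intros n. destruct (Ha (Cmod t + 1)) as [M HM]; [lra|].
    apply (psum_lim _ t (M / (Cmod t + 1) ^ n) (Cmod t / (Cmod t + 1))).
    - apply div_lt_1; lra.
    - apply coef_bound_geom; [lra|]. intros k. specialize (HM (n + k)%nat). rewrite pow_add in HM.
      assert (0 < (Cmod t + 1) ^ n) by (apply pow_lt; lra).
      apply -> Rle_div_r; auto. apply Rle_trans with (2 := HM); right; ring. }
  set (c := fun n => epsilon (inhabits (RtoC 0)) (fun l => Clim (psum (fun k => a (n + k)%nat) t) l)).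
  assert (Cc : forall n, Clim (psum (fun k => a (n + k)%nat) t) (c n)).
  { intros n. apply (epsilon_spec (inhabits (RtoC 0)) _ (Hc n)). }
  clearbody c. clear Hc.
  assert (Rec : forall n, c n = (a n + t * c (S n))%C).
  { intros n. apply (Clim_unique _ _ _ (Clim_S _ _ (Cc n))).
    apply (Clim_ext (fun N => a n + t * psum (fun k => a (S n + k)%nat) t N)%C).
    - intros N. induction N as [|N IH].
      + cbn [psum Cpow]. rewrite Nat.add_0_r. ring.
      + cbn [psum] in *. rewrite <- IH. rewrite Nat.add_succ_r. cbn [Cpow Nat.add]. ring.
    - apply Clim_plus; [apply Clim_const|]. apply Clim_scal, Cc. }
  assert (C0 : c O = f t).
  { apply (Clim_unique _ _ _ (Cc O)). apply Hf. }
  set (b := fun n => c (S n)).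
  assert (Bb : forall r M, Cmod t < r -> coef_bound a r M -> coef_bound b r (M / (r - Cmod t))).
  { intros r M Hr HM n. unfold b.
    assert (0 < r ^ n) by (apply pow_lt; lra).
    assert (K : coef_bound (fun k => a (S n + k)%nat) r (M / r ^ S n)).
    { intros k. specialize (HM (S n + k)%nat). rewrite pow_add in HM.
      apply -> Rle_div_r; [|apply pow_lt; lra]. apply Rle_trans with (2 := HM); right; ring. }
    assert (T := psum_lim_tail _ t _ _ _ (div_lt_1 (Cmod t) r ltac:(lra))
       (coef_bound_geom _ r _ t ltac:(lra) K) (Cc (S n)) O).
    simpl psum in T. replace (c (S n) - 0)%C with (c (S n)) in T by ring.
    apply Rle_trans with (M / r ^ S n * (Cmod t / r) ^ 0 / (1 - Cmod t / r) * r ^ n).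
    - apply Rmult_le_compat_r; lra.
    - right. simpl. field. repeat split; lra. }
  assert (Eb : entire_coef b).
  { intros r Hr. destruct (Ha (r + Cmod t)) as [M HM]; [lra|].
    assert (Hb := Bb (r + Cmod t) M ltac:(lra) HM). eexists. intros n.
    eapply Rle_trans; [|apply (Hb n)]. apply Rmult_le_compat_l; [apply Cmod_ge_0|].
    apply pow_incr. lra. }
  destruct (ent_exists b Eb) as [U HU].
  assert (Vb : forall w, Clim (fun n => b n * w ^ n)%C 0).
  { intros w. assert (Pw := Cmod_ge_0 w). destruct (Eb (Cmod w + 1)) as [M HM]; [lra|].
    apply (Clim_squeeze _ _ (fun n => M * (Cmod w / (Cmod w + 1)) ^ n)).
    - intros n. replace (b n * w ^ n - 0)%C with (b n * w ^ n)%C by ring.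
      rewrite Cmod_mult, Cmod_pow. apply coef_bound_geom; auto; lra.
    - replace (Finite 0) with (Rbar_mult M 0) by (simpl; f_equal; ring).
      apply is_lim_seq_scal_l. apply is_lim_seq_geom.
      destruct (div_lt_1 (Cmod w) (Cmod w + 1)); [lra|]. rewrite Rabs_pos_eq; lra. }
  exists U, b. split; auto. split; [|split; auto].
  - intros w.
    assert (I : forall N, ((w - t) * psum b w (S N) = w * (b N * w ^ N) + psum a w (S N) - f t)%C).
    { induction N as [|N IH].
      - cbn [psum Cpow]. rewrite <- C0, (Rec O). unfold b. ring.
      - cbn [psum] in *. rewrite Cmult_plus_distr_l, IH. cbn [Cpow]. unfold b.
        rewrite (Rec (S N)). ring. }
    apply (Clim_unique (fun N => (w - t) * psum b w (S N)))%C.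
    + apply (Clim_ext (fun N => w * (b N * w ^ N) + (psum a w (S N) + - f t))%C).
      { intros N. rewrite I. ring. }
      replace (f w - f t)%C with (w * 0 + (f w + - f t))%C by ring.
      apply Clim_plus; [apply Clim_scal, Vb|]. apply Clim_plus; [|apply Clim_const].
      apply Clim_S, Hf.
    + apply Clim_scal. apply (Clim_S _ _ (proj2 HU w)).
  - exists (U t). split; [apply (proj2 HU)|]. split; auto.
    induction N as [|N IH].
    + cbn [psum Cpow INR]. ring.
    + change (psum b t (S (S N))) with (psum b t (S N) + b (S N) * t ^ (S N))%C.
      rewrite <- IH. cbn [psum Cpow]. unfold b. rewrite (Rec (S N)), !S_INR, !RtoC_plus. ring.
Qed.

Lemma INR_geom_bound n : INR n <= 2 ^ n.
Proof.
  induction n as [|n IH]; [simpl; lra|]. rewrite S_INR. simpl.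
  assert (1 <= 2 ^ n) by (apply pow_R1_Rle; lra). lra.
Qed.

Lemma deriv_coef_entire a : entire_coef a -> entire_coef (fun n => (INR (S n) * a (S n))%C).
Proof.
  intros Ha r Hr. destruct (Ha (2 * r)) as [M HM]; [lra|].
  exists (M / r). intros n. apply -> Rle_div_r; auto. rewrite Cmod_mult, Cmod_R, Rabs_pos_eq by apply pos_INR.
  specialize (HM (S n)). rewrite Rpow_mult_distr in HM.
  assert (K := INR_geom_bound (S n)). assert (0 < r ^ n) by now apply pow_lt.
  replace (INR (S n) * Cmod (a (S n)) * r ^ n * r) with (INR (S n) * (Cmod (a (S n)) * r ^ S n)) by (simpl; ring).
  eapply Rle_trans; [|apply HM].
  replace (Cmod (a (S n)) * (2 ^ S n * r ^ S n)) with (2 ^ S n * (Cmod (a (S n)) * r ^ S n)) by ring.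
  apply Rmult_le_compat_r; auto. apply Rmult_le_pos; [apply Cmod_ge_0|apply pow_le; lra].
Qed.

Lemma ent_bounded f a R : ent f a -> exists M, 0 < M /\ forall z, Cmod z <= R -> Cmod (f z) <= M.
Proof.
  intros Hf. destruct (Rle_dec 0 R) as [HR|HR].
  - destruct (proj1 Hf (2 * R + 2)) as [M HM]; [lra|].
    exists (2 * Rabs M + 1). assert (A := Rabs_pos M). split; [lra|]. intros z Hz.
    assert (P := Cmod_ge_0 z). eapply Rle_trans; [apply (ent_bound f a (2 * R + 2) M); auto; lra|].
    assert (Q : Cmod z / (2 * R + 2) <= 1/2) by (apply Rle_div_l; lra).
    apply Rle_div_l; [lra|]. generalize (Rle_abs M). nra.
  - exists 1. split; [lra|]. intros z Hz. generalize (Cmod_ge_0 z). lra.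
Qed.

Lemma ent_cont f a z : ent f a -> Ccont f z.
Proof.
  intros Hf. destruct (ent_div f a z Hf) as (U & b & HU & E & _).
  destruct (ent_bounded U b (Cmod z + 1) HU) as (M & HM & B).
  intros e He. exists (Rmin 1 (e / M)). split; [apply Rmin_glb_lt; [lra|now apply Rdiv_lt_0_compat]|].
  intros w Hw. rewrite E, Cmod_mult.
  assert (H1 : Cmod (w - z) < 1) by (eapply Rlt_le_trans; [apply Hw|apply Rmin_l]).
  assert (H2 : Cmod (w - z) < e / M) by (eapply Rlt_le_trans; [apply Hw|apply Rmin_r]).
  apply Rlt_div_r in H2; auto.
  assert (Cmod (U w) <= M). { apply B. generalize (Cmod_triangle_inv w z). lra. }
  generalize (Cmod_ge_0 (w - z)). nra.
Qed.

(** The quotient [U] of [ent_div] is the Caratheodory factor at [t], so it only remains to identify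
    [U t] with the sum of the termwise derivative. *)
Lemma ent_deriv f a : ent f a -> exists f' d, ent f' d /\ forall z, cderiv f z (f' z).
Proof.
  intros Hf. destruct (ent_exists _ (deriv_coef_entire a (proj1 Hf))) as [f' Hf'].
  exists f', (fun n => (INR (S n) * a (S n))%C). split; auto. intros t.
  destruct (ent_div f a t Hf) as (U & b & HU & E & _ & c & Hc & _ & K).
  apply cderiv_caratheodory. exists U. split; [apply (ent_cont U b t HU)|]. split; [|intros w; rewrite E; ring].
  apply (Clim_unique (psum b t)); [apply (proj2 HU)|]. apply Clim_shift.
  apply (Clim_ext (fun N => psum (fun n => INR (S n) * a (S n)) t N + INR (S N) * b N * t ^ N)%C); auto.
  replace (f' t) with (f' t + 0)%C by ring. apply Clim_plus; [apply (proj2 Hf')|].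
  assert (Pt := Cmod_ge_0 t).
  (* A radius beyond [2 |t|] absorbs the factor [n + 1 <= 2 ^ (n + 1)]. *)
  destruct (proj1 HU (2 * Cmod t + 2)) as [M HM]; [lra|].
  set (q := (2 * Cmod t) / (2 * Cmod t + 2)).
  assert (Hq : 0 <= q < 1) by (apply div_lt_1; lra).
  assert (HM0 : 0 <= M) by (eapply Rle_trans; [|apply (HM O)]; simpl; generalize (Cmod_ge_0 (b O)); lra).
  apply (Clim_squeeze _ _ (fun n => (2 * M) * q ^ n)).
  - intros n. replace (INR (S n) * b n * t ^ n - 0)%C with (INR (S n) * b n * t ^ n)%C by ring.
    rewrite !Cmod_mult, Cmod_pow, Cmod_R, Rabs_pos_eq by apply pos_INR.
    assert (T := coef_bound_geom b (2 * Cmod t + 2) M (2 * t)%C ltac:(lra) HM n).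
    rewrite Cmod_mult, Cmod_R, (Rabs_pos_eq 2), Rpow_mult_distr in T by lra. fold q in T.
    assert (L := INR_geom_bound (S n)). simpl pow in L.
    assert (0 <= Cmod (b n) * Cmod t ^ n) by (apply Rmult_le_pos; [apply Cmod_ge_0|now apply pow_le]).
    apply Rle_trans with (2 * 2 ^ n * (Cmod (b n) * Cmod t ^ n)); [|lra].
    rewrite Rmult_assoc. apply Rmult_le_compat_r; auto.
  - replace (Finite 0) with (Rbar_mult (2 * M) 0) by (simpl; f_equal; ring).
    apply is_lim_seq_scal_l. apply is_lim_seq_geom. rewrite Rabs_pos_eq; lra.
Qed.

(** * Operations on entire functions and their zeros *)

Definition entire (f : C -> C) : Prop := exists a, ent f a.

Lemma psum_plus a b z n : psum (fun k => a k + b k)%C z n = (psum a z n + psum b z n)%C.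
Proof. induction n as [|n IH]; cbn [psum]; [ring|]. rewrite IH. ring. Qed.

Lemma psum_scal c a z n : psum (fun k => c * a k)%C z n = (c * psum a z n)%C.
Proof. induction n as [|n IH]; cbn [psum]; [ring|]. rewrite IH. ring. Qed.

Lemma entire_plus f g : entire f -> entire g -> entire (fun z => f z + g z)%C.
Proof.
  intros (a & Ha & Ea) (b & Hb & Eb). exists (fun k => a k + b k)%C. split.
  - intros r Hr. destruct (Ha r Hr) as [M HM]. destruct (Hb r Hr) as [M' HM'].
    exists (M + M'). intros n. specialize (HM n). specialize (HM' n).
    assert (0 < r ^ n) by now apply pow_lt.
    apply Rle_trans with ((Cmod (a n) + Cmod (b n)) * r ^ n); [|lra].
    apply Rmult_le_compat_r; [lra|apply Cmod_triangle].
  - intros z. apply (Clim_ext (fun n => psum a z n + psum b z n)%C).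
    + intros n. now rewrite psum_plus.
    + now apply Clim_plus.
Qed.

Lemma entire_scal c f : entire f -> entire (fun z => c * f z)%C.
Proof.
  intros (a & Ha & Ea). exists (fun k => c * a k)%C. split.
  - intros r Hr. destruct (Ha r Hr) as [M HM].
    exists (Cmod c * M). intros n. specialize (HM n). rewrite Cmod_mult, Rmult_assoc.
    apply Rmult_le_compat_l; [apply Cmod_ge_0|auto].
  - intros z. apply (Clim_ext (fun n => c * psum a z n)%C).
    + intros n. now rewrite psum_scal.
    + now apply Clim_scal.
Qed.

Lemma entire_monomial k : entire (fun z => z ^ k)%C.
Proof.
  exists (fun n => if Nat.eq_dec n k then RtoC 1 else RtoC 0). split.
  - intros r Hr. exists (r ^ k). intros n. assert (0 < r ^ k) by now apply pow_lt.
    destruct (Nat.eq_dec n k) as [->|]; [rewrite Cmod_1|rewrite Cmod_0]; lra.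
  - intros z.
    assert (E : forall n, psum (fun n => if Nat.eq_dec n k then RtoC 1 else RtoC 0) z n
       = if le_lt_dec n k then RtoC 0 else (z ^ k)%C).
    { induction n as [|n IH]; [reflexivity|]. cbn [psum]. rewrite IH.
      destruct (le_lt_dec n k), (Nat.eq_dec n k), (le_lt_dec (S n) k); try lia; subst; ring. }
    intros e He. exists (S k). intros n Hn. rewrite E.
    destruct (le_lt_dec n k); [lia|]. replace (z ^ k - z ^ k)%C with (RtoC 0) by ring. now rewrite Cmod_0.
Qed.

Lemma entire_const c : entire (fun _ => c).
Proof.
  replace (fun _ : C => c) with (fun z : C => c * z ^ 0)%C
    by (apply functional_extensionality; intros; cbn [Cpow]; ring).
  apply entire_scal, entire_monomial.
Qed.

Lemma entire_minus f g : entire f -> entire g -> entire (fun z => f z - g z)%C.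
Proof.
  intros Hf Hg. replace (fun z : C => f z - g z)%C with (fun z : C => f z + (-(1)) * g z)%C
    by (apply functional_extensionality; intros; ring).
  apply entire_plus; auto. now apply entire_scal.
Qed.

Lemma entire_cont f z : entire f -> Ccont f z.
Proof. intros [a Ha]. eapply ent_cont, Ha. Qed.

Lemma entire_deriv f : entire f -> exists f', entire f' /\ forall z, cderiv f z (f' z).
Proof. intros [a Ha]. destruct (ent_deriv f a Ha) as (f' & d & H & K). exists f'. split; [now exists d|auto]. Qed.

Lemma entire_div f t : entire f -> exists U, entire U /\ forall w, (f w = f t + (w - t) * U w)%C.
Proof.
  intros [a Ha]. destruct (ent_div f a t Ha) as (U & b & H & E & _). exists U. split; [now exists b|].
  intros w. rewrite <- E. ring.
Qed.

(** If division by [w - t] never stops, [m] divisions reduce the coefficient bound by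
    [(r - |t|) ^ m], and for large [r] this beats [|z - t| ^ m] by a factor [2 ^ m]. Hence
    [f z = 0]. *)
Lemma entire_order_of_vanishing f t : entire f ->
  (forall z, f z = 0%C) \/
  exists m U, entire U /\ U t <> 0%C /\ forall w, (f w = (w - t) ^ m * U w)%C.
Proof.
  intros [a Ha].
  destruct (excluded_middle_informative (exists m U, entire U /\ U t <> 0%C /\ forall w, (f w = (w - t) ^ m * U w)%C))
    as [H|H]; [now right|left].
  assert (Pt := Cmod_ge_0 t).
  assert (K : forall m, exists U b, ent U b /\ (forall w, f w = (w - t) ^ m * U w)%C /\
     forall r M, Cmod t < r -> coef_bound a r M -> coef_bound b r (M / (r - Cmod t) ^ m)).
  { induction m as [|m (U & b & HU & E & B)].
    - exists f, a. split; auto. split; [intros; cbn [Cpow]; ring|].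
      intros r M Hr HM. simpl. now replace (M / 1) with M by field.
    - destruct (ent_div U b t HU) as (V & d & HV & EV & BV & _).
      assert (Ut : U t = 0%C).
      { destruct (Ceq_dec (U t) 0) as [|n]; auto. exfalso. apply H. exists m, U. split; [now exists b|auto]. }
      exists V, d. split; auto. split.
      + intros w. rewrite E. cbn [Cpow].
        replace (U w) with ((w - t) * V w)%C by (rewrite <- EV, Ut; ring). ring.
      + intros r M Hr HM. simpl.
        replace (M / ((r - Cmod t) * (r - Cmod t) ^ m)) with (M / (r - Cmod t) ^ m / (r - Cmod t)).
        * apply BV; auto.
        * field. assert (0 < (r - Cmod t) ^ m) by (apply pow_lt; lra). lra. }
  intros z. apply Cmod_small_0. intros e He.
  set (D := Cmod (z - t)). assert (HD : 0 <= D) by apply Cmod_ge_0.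
  assert (Pz := Cmod_ge_0 z).
  (* Ensures [|z - t| <= (r - |t|) / 2] and [|z| <= r / 2]. *)
  set (r := Cmod t + 2 * D + 2 * Cmod z + 1).
  destruct (proj1 Ha r) as [M HM]; [unfold r; lra|].
  assert (HM0 : 0 <= M).
  { specialize (HM O). simpl in HM. generalize (Cmod_ge_0 (a O)). lra. }
  assert (L : is_lim_seq (fun m => 2 * M * (1/2) ^ m) 0).
  { replace (Finite 0) with (Rbar_mult (2 * M) 0) by (simpl; f_equal; ring).
    apply is_lim_seq_scal_l. apply is_lim_seq_geom. rewrite Rabs_pos_eq; lra. }
  apply is_lim_seq_spec in L. destruct (L (mkposreal e He)) as [m Hm]. specialize (Hm m (le_n _)).
  simpl in Hm. rewrite Rminus_0_r in Hm.
  destruct (K m) as (U & b & HU & E & B).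
  rewrite E, Cmod_mult, Cmod_pow. fold D.
  assert (Br := B r M ltac:(unfold r; lra) HM).
  assert (T := ent_bound U b r _ z HU Br ltac:(unfold r; lra)).
  assert (Q : Cmod z / r <= 1/2) by (apply Rle_div_l; unfold r; lra).
  set (s := r - Cmod t) in *. assert (Hs : 0 < s) by (unfold s, r; lra).
  assert (Hsm : 0 < s ^ m) by now apply pow_lt.
  assert (HDm : 0 <= D ^ m) by now apply pow_le.
  assert (Ds : D ^ m / s ^ m <= (1/2) ^ m).
  { replace (D ^ m / s ^ m) with ((D / s) ^ m).
    - apply pow_incr. split; [apply Rdiv_le_0_compat; lra|]. apply Rle_div_l; unfold s, r; lra.
    - unfold Rdiv. now rewrite Rpow_mult_distr, pow_inv. }
  assert (HMs : 0 <= M / s ^ m) by now apply Rdiv_le_0_compat.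
  apply Rle_trans with (D ^ m * (2 * (M / s ^ m))).
  - apply Rmult_le_compat_l; auto. eapply Rle_trans; [apply T|]. apply Rle_div_l; [lra|]. nra.
  - apply Rle_trans with (2 * M * (1/2) ^ m); [|generalize (Rle_abs (2 * M * (1/2) ^ m)); lra].
    replace (D ^ m * (2 * (M / s ^ m))) with (2 * M * (D ^ m / s ^ m)) by (field; lra).
    apply Rmult_le_compat_l; lra.
Qed.

Lemma entire_isolated_zeros f t : entire f -> (exists z, f z <> 0%C) ->
  exists d, 0 < d /\ forall w, w <> t -> Cmod (w - t) < d -> f w <> 0%C.
Proof.
  intros Hf [z Hz]. destruct (entire_order_of_vanishing f t Hf) as [H|(m & U & HU & Ut & E)].
  - now elim Hz.
  - destruct (Ccont_nz U t (entire_cont U t HU) Ut) as (d & Hd & K).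
    exists d. split; auto. intros w Hw Hd'. rewrite E. apply Cmult_neq_0.
    + apply Cpow_nz. now apply Cminus_eq_contra.
    + apply Cmod_gt_0. specialize (K w Hd'). generalize (Cmod_ge_0 (U t)). lra.
Qed.

(** Halving [d] passes from the coordinatewise distance in the compactness lemma to [Cmod]; that
    lemma yields a doubly negated existence, which [NNPP] removes. *)
Lemma finite_cover (d : C -> R) (R : R) : (forall z, 0 < d z) ->
  exists l : list C, forall z, Cmod z <= R -> exists t, In t l /\ Cmod (z - t) < d t.
Proof.
  intros Hd.
  set (delta := fun p : Compactness.Tn 2 Rdefinitions.R => mkposreal (d (fst p, fst (snd p)) / 2) ltac:(generalize (Hd (fst p, fst (snd p))); lra)).
  destruct (NNPP _ (compactness_list 2 (-R, (-R, tt)) (R, (R, tt)) delta)) as [l Hl].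
  exists (map (fun p : Compactness.Tn 2 Rdefinitions.R => (fst p, fst (snd p))) l).
  intros [x y] Hz.
  assert (Hx := Re_le_Cmod (x, y)). assert (Hy := Im_le_Cmod (x, y)). cbn [fst snd] in *.
  assert (Bx := Rabs_le_between x R). assert (By := Rabs_le_between y R).
  destruct (Hl (x, (y, tt))) as ((u & (v & [])) & I & _ & C1 & C2 & _).
  { simpl. repeat split; try apply Bx; try apply By; lra. }
  exists (u, v). split.
  - apply in_map_iff. exists (u, (v, tt)). split; auto.
  - simpl in C1, C2. eapply Rle_lt_trans; [apply Cmod_le_abs|]. cbn [fst snd Cminus Cplus Copp].
    unfold Rminus in *. lra.
Qed.

Lemma entire_finite_zeros f R : entire f -> (exists z, f z <> 0%C) ->
  exists l : list C, NoDup l /\ forall z, In z l <-> (Cmod z <= R /\ f z = 0%C).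
Proof.
  intros Hf Hz.
  set (P := fun t d => 0 < d /\ forall w, w <> t -> Cmod (w - t) < d -> f w <> 0%C).
  set (d := fun t => epsilon (inhabits 1) (P t)).
  assert (Hd : forall t, P t (d t)).
  { intros t. apply epsilon_spec. now apply entire_isolated_zeros. }
  destruct (finite_cover d R) as [l Hl]; [intros; apply Hd|].
  set (q := fun z : C => if excluded_middle_informative (Cmod z <= R /\ f z = 0%C) then true else false).
  exists (nodup Ceq_dec (filter q l)). split; [apply NoDup_nodup|].
  intros z. rewrite nodup_In, filter_In. unfold q.
  destruct (excluded_middle_informative (Cmod z <= R /\ f z = 0%C)) as [H|H]; [|intuition discriminate].
  split; [auto|]. intros _. split; auto.
  destruct (Hl z (proj1 H)) as (t & It & Ht).
  destruct (Ceq_dec z t) as [->|n]; auto.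
  elim (proj2 (Hd t) z n Ht). apply H.
Qed.

(** * The maximum principle and partial fractions *)

Lemma list_argmax {A : Type} (g : A -> R) (l : list A) : l <> nil ->
  exists x, In x l /\ forall y, In y l -> g y <= g x.
Proof.
  induction l as [|a l IH]; [easy|]. intros _. destruct l as [|b l].
  - exists a. split; [now left|]. intros y [->|[]]. lra.
  - destruct IH as (x & Ix & Mx); [easy|]. destruct (Rle_dec (g a) (g x)).
    + exists x. split; [now right|]. intros y [->|Iy]; auto.
    + exists a. split; [now left|]. intros y [->|Iy]; [lra|]. specialize (Mx y Iy). lra.
Qed.

(** Upper semicontinuity suffices. Without a maximum, every point has a neighbourhood where [phi]
    stays below its value at some better point. Finitely many neighbourhoods cover the disc, and the
    best of these finitely many values would be exceeded by another of them. *)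
Lemma disc_max (phi : C -> R) (R : R) : 0 <= R ->
  (forall z, Cmod z <= R -> forall e, 0 < e -> exists d, 0 < d /\ forall w, Cmod w <= R -> Cmod (w - z) < d -> phi w < phi z + e) ->
  exists p, Cmod p <= R /\ forall w, Cmod w <= R -> phi w <= phi p.
Proof.
  intros HR Hphi.
  destruct (excluded_middle_informative (exists p, Cmod p <= R /\ forall w, Cmod w <= R -> phi w <= phi p)) as [|N]; auto.
  exfalso.
  set (P := fun z (qd : C * Rdefinitions.R) => 0 < snd qd /\ (Cmod z <= R -> Cmod (fst qd) <= R /\
     forall w, Cmod w <= R -> Cmod (w - z) < snd qd -> phi w < phi (fst qd))).
  assert (H : forall z, exists qd, P z qd).
  { intros z. destruct (Rle_dec (Cmod z) R) as [Hz|Hz].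
    - assert (exists q, Cmod q <= R /\ phi z < phi q) as (q & Hq & L).
      { apply NNPP. intros K. apply N. exists z. split; auto. intros w Hw.
        apply Rnot_lt_le. intros L. apply K. exists w. auto. }
      destruct (Hphi z Hz (phi q - phi z)) as (d & Hd & K); [lra|].
      exists (q, d). split; auto. intros _. split; auto. cbn [fst snd]. intros w Hw Hwz.
      specialize (K w Hw Hwz). lra.
    - exists (z, 1). split; [cbn; lra|]. intros; contradiction. }
  set (c := fun z => epsilon (inhabits (RtoC 0, 1)) (P z)).
  assert (Hc : forall z, P z (c z)) by (intros z; apply epsilon_spec, H).
  (* Around a centre outside the disc the radius [|z| - R] misses the disc, so only centres inside
     do any covering. *)
  destruct (finite_cover (fun z => Rmin (snd (c z)) (if Rle_dec (Cmod z) R then 1 else Cmod z - R)) R) as [l Hl].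
  { intros z. apply Rmin_glb_lt; [apply Hc|]. destruct (Rle_dec (Cmod z) R); lra. }
  set (q := fun z : C => if Rle_dec (Cmod z) R then true else false).
  assert (Hq : forall z, Cmod z <= R -> exists t, In t (filter q l) /\ Cmod t <= R /\ Cmod (z - t) < snd (c t)).
  { intros z Hz. destruct (Hl z Hz) as (t & It & Ht). exists t.
    assert (Ht1 := Rlt_le_trans _ _ _ Ht (Rmin_l _ _)). assert (Ht2 := Rlt_le_trans _ _ _ Ht (Rmin_r _ _)).
    assert (Cmod t <= R).
    { destruct (Rle_dec (Cmod t) R); auto. generalize (Cmod_triangle_inv t z). rewrite Cmod_minus_sym. lra. }
    split; auto. apply filter_In. split; auto. unfold q. destruct (Rle_dec (Cmod t) R); auto; contradiction. }
  assert (Hq' : forall t, In t (filter q l) -> Cmod t <= R).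
  { intros t Ht. apply filter_In in Ht. unfold q in Ht. destruct (Rle_dec (Cmod t) R); auto. destruct Ht; discriminate. }
  destruct (list_argmax (fun t => phi (fst (c t))) (filter q l)) as (t & It & Mt).
  { destruct (Hq 0%C) as (t & It & _); [rewrite Cmod_0; auto|]. intros E. rewrite E in It. destruct It. }
  assert (Ht := Hq' t It).
  destruct (Hq (fst (c t))) as (s & Is & Hs & Hcs); [now apply (Hc t)|].
  specialize (Mt s Is).
  assert (phi (fst (c t)) < phi (fst (c s))); [|lra].
  apply (Hc s); auto. now apply (Hc t).
Qed.

Lemma Cmod_axis (t : R) : 0 <= t ->
  Cmod (t, 0) = t /\ Cmod (-t, 0) = t /\ Cmod (0, t) = t /\ Cmod (0, -t) = t.
Proof.
  intros Ht. unfold Cmod; cbn [fst snd]. repeat split; rewrite <- (sqrt_pow2 t) at 2 by auto; f_equal; ring.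
Qed.

(** Over [h = t, -t, i t, -i t] the sums of [h], of [h ^ 2] and of [h ^ 2] times the conjugate of
    [h] vanish, so all cross terms of [|g0 + h g1 + h ^ 2 g2| ^ 2] cancel. Each remainder costs at
    most [2 V m t ^ 2]. *)
Lemma second_difference (g0 g1 g2 e1 e2 e3 e4 : C) (t m : R) :
  0 < t <= 1 -> Cmod e1 <= m -> Cmod e2 <= m -> Cmod e3 <= m -> Cmod e4 <= m ->
  let V := Cmod g0 + Cmod g1 + Cmod g2 in
  let v h e := (g0 + h * (g1 + h * (g2 + e)))%C in
  4 * (Cmod g0 * Cmod g0) - 8 * (V * m * (t * t)) <=
  Cmod (v (t, 0) e1) * Cmod (v (t, 0) e1) + Cmod (v (-t, 0) e2) * Cmod (v (-t, 0) e2)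
  + Cmod (v (0, t) e3) * Cmod (v (0, t) e3) + Cmod (v (0, -t) e4) * Cmod (v (0, -t) e4).
Proof.
  intros Ht H1 H2 H3 H4 V v.
  set (w := fun h => (g0 + h * (g1 + h * g2))%C).
  assert (K : forall h e, Cmod h = t -> Cmod e <= m ->
     Cmod (w h) * Cmod (w h) - 2 * (V * m * (t * t)) <= Cmod (v h e) * Cmod (v h e)).
  { intros h e Hh He.
    assert (A : Cmod (w h) <= V).
    { unfold w, V. eapply Rle_trans; [apply Cmod_triangle|]. rewrite Cmod_mult, Hh.
      assert (Cmod (g1 + h * g2) <= Cmod g1 + Cmod g2).
      { eapply Rle_trans; [apply Cmod_triangle|]. rewrite Cmod_mult, Hh. generalize (Cmod_ge_0 g2). nra. }
      generalize (Cmod_ge_0 (g1 + h * g2)). nra. }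
    assert (B : Cmod (w h) - Cmod (v h e) <= m * (t * t)).
    { eapply Rle_trans; [apply Cmod_triangle_inv|]. unfold w, v.
      replace (g0 + h * (g1 + h * g2) - (g0 + h * (g1 + h * (g2 + e))))%C with (- (e * (h * h)))%C by ring.
      rewrite Cmod_opp, !Cmod_mult, Hh. apply Rmult_le_compat_r; [nra|auto]. }
    assert (P1 := Cmod_ge_0 (w h)). assert (P2 := Cmod_ge_0 (v h e)). assert (P3 := Cmod_ge_0 e).
    set (x := Cmod (w h)) in *. set (y := Cmod (v h e)) in *.
    assert (Hx : x * (x - y) <= V * (m * (t * t))).
    { destruct (Rle_dec 0 (x - y)).
      - apply Rmult_le_compat; lra.
      - assert (0 <= m * (t * t)) by (apply Rmult_le_pos; nra). nra. }
    assert (0 <= V * (m * (t * t))).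
    { apply Rmult_le_pos; [lra|]. apply Rmult_le_pos; nra. }
    replace (V * m * (t * t)) with (V * (m * (t * t))) by ring.
    destruct (Rle_dec x y); [assert (x * x <= y * y) by (apply Rmult_le_compat; lra); lra|].
    assert ((x - y) * (x + y) <= (x - y) * (2 * x)) by (apply Rmult_le_compat_l; lra). lra. }
  destruct (Cmod_axis t) as (T1 & T2 & T3 & T4); [lra|].
  assert (S : 4 * (Cmod g0 * Cmod g0) <= Cmod (w (t, 0)) * Cmod (w (t, 0)) + Cmod (w (-t, 0)) * Cmod (w (-t, 0))
     + Cmod (w (0, t)) * Cmod (w (0, t)) + Cmod (w (0, -t)) * Cmod (w (0, -t))).
  { rewrite !Cmod_sqr. unfold w. destruct g0 as [a b], g1 as [c d], g2 as [e f]. cbn [fst snd Cplus Cmult].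
    match goal with |- ?L <= ?R => replace R with (L + 4 * (c * c + d * d) * (t * t) + 4 * (e * e + f * f) * (t * t * t * t)) by ring end.
    generalize (Rle_0_sqr c) (Rle_0_sqr d) (Rle_0_sqr e) (Rle_0_sqr f) (Rle_0_sqr t) (Rle_0_sqr (t * t)). unfold Rsqr. intros.
    assert (0 <= 4 * (c * c + d * d) * (t * t)) by (apply Rmult_le_pos; lra).
    assert (0 <= 4 * (e * e + f * f) * (t * t * t * t)) by (apply Rmult_le_pos; lra). lra. }
  generalize (K _ _ T1 H1) (K _ _ T2 H2) (K _ _ T3 H3) (K _ _ T4 H4). lra.
Qed.

(* For [g = W / U] the function [|g|^2 + e |z|^2] has no interior maximum: the average of its
   second order Taylor expansion over [p + t], [p - t], [p + i t], [p - i t] exceeds its value at [p]. *)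
Lemma quotient_max_principle W U (R M : R) : entire W -> entire U -> 0 <= M ->
  (forall z, Cmod z <= R -> U z <> 0%C) ->
  (forall z, Cmod z = R -> Cmod (W z / U z) <= M) ->
  forall z, Cmod z <= R -> Cmod (W z / U z) <= M.
Proof.
  intros HW HU HM HUz HB z0 Hz0.
  assert (HR : 0 <= R) by (generalize (Cmod_ge_0 z0); lra).
  set (g := fun z => (W z / U z)%C).
  assert (Cg : forall z, Cmod z <= R -> Ccont g z).
  { intros z Hz. apply Ccont_mult; [now apply entire_cont|]. apply Ccont_inv; auto. now apply entire_cont. }
  (* Dividing twice by [w - p] gives a second order expansion of [W / U] with continuous remainder,
     without differentiating a quotient. *)
  assert (Tg : forall p, Cmod p < R -> exists g1 G, Ccont G p /\
     forall w, Cmod w <= R -> (g w = g p + (w - p) * (g1 + (w - p) * G w))%C).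
  { intros p Hp. assert (Up := HUz p ltac:(lra)).
    destruct (entire_div (fun w => W w - g p * U w)%C p) as (A & HA & EA).
    { apply entire_minus; auto. now apply entire_scal. }
    destruct (entire_div (fun w => A w - (A p / U p) * U w)%C p) as (B & HB' & EB).
    { apply entire_minus; auto. now apply entire_scal. }
    exists (A p / U p)%C, (fun w => B w / U w)%C. split.
    - apply Ccont_mult; [now apply entire_cont|]. apply Ccont_inv; auto. now apply entire_cont.
    - intros w Hw. assert (Uw := HUz w Hw). specialize (EA w). specialize (EB w).
      assert (E1 : (W p - g p * U p)%C = 0%C) by (unfold g; field; auto).
      assert (E2 : (A p - A p / U p * U p)%C = 0%C) by (field; auto).
      rewrite E1 in EA. rewrite E2 in EB.
      assert (F1 : W w = (g p * U w + (w - p) * A w)%C).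
      { replace (W w) with ((W w - g p * U w) + g p * U w)%C by ring. rewrite EA. ring. }
      assert (F2 : A w = (A p / U p * U w + (w - p) * B w)%C).
      { replace (A w) with ((A w - A p / U p * U w) + A p / U p * U w)%C by ring. rewrite EB. ring. }
      unfold g at 1. rewrite F1, F2 at 1. field. auto. }
  assert (Key : forall e, 0 < e -> Cmod (g z0) * Cmod (g z0) <= M * M + e * (R * R)).
  { intros e He.
    set (phi := fun z => Cmod (g z) * Cmod (g z) + e * (Cmod z * Cmod z)).
    destruct (disc_max phi R HR) as (p & Hp & Mp).
    { intros z Hz h Hh.
      set (B := 2 * Cmod (g z) + 1 + e * (2 * R + 1)).
      assert (HB0 : 0 < B) by (unfold B; generalize (Cmod_ge_0 (g z)); nra).
      set (k := Rmin 1 (h / B)).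
      assert (Hk : 0 < k) by (apply Rmin_glb_lt; [lra|now apply Rdiv_lt_0_compat]).
      destruct (Cg z Hz k Hk) as (d & Hd & K).
      exists (Rmin d k). split; [now apply Rmin_glb_lt|]. intros w Hw Hwz.
      specialize (K w (Rlt_le_trans _ _ _ Hwz (Rmin_l _ _))).
      assert (Hwz2 := Rlt_le_trans _ _ _ Hwz (Rmin_r _ _)).
      assert (A1 := Cmod_triangle_inv (g w) (g z)). assert (A2 := Cmod_triangle_inv w z).
      assert (k <= 1) by apply Rmin_l.
      assert (kB : k * B <= h).
      { apply Rle_trans with (h / B * B); [apply Rmult_le_compat_r; [lra|apply Rmin_r]|right; field; lra]. }
      assert (P1 := Cmod_ge_0 (g w)). assert (P2 := Cmod_ge_0 (g z)). assert (P3 := Cmod_ge_0 w). assert (P4 := Cmod_ge_0 z).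
      unfold phi.
      assert (Q1 : Cmod (g w) * Cmod (g w) < Cmod (g z) * Cmod (g z) + k * (2 * Cmod (g z) + 1)).
      { apply Rlt_le_trans with ((Cmod (g z) + k) * (Cmod (g z) + k)); [|nra].
        apply Rmult_le_0_lt_compat; lra. }
      assert (Q2 : Cmod w * Cmod w <= Cmod z * Cmod z + k * (2 * R + 1)).
      { apply Rle_trans with ((Cmod z + k) * (Cmod z + k)); [|nra].
        apply Rmult_le_compat; lra. }
      assert (e * (Cmod w * Cmod w) <= e * (Cmod z * Cmod z + k * (2 * R + 1))) by (apply Rmult_le_compat_l; lra).
      unfold B in kB. nra. }
    apply Rle_trans with (phi p).
    { eapply Rle_trans; [|apply (Mp z0 Hz0)]. unfold phi. generalize (Cmod_ge_0 z0). nra. }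
    destruct (Rle_lt_or_eq_dec _ _ Hp) as [Hlt|Heq].
    2:{ unfold phi. rewrite Heq. specialize (HB p Heq). fold (g p) in HB.
        generalize (Cmod_ge_0 (g p)). nra. }
    exfalso. destruct (Tg p Hlt) as (g1 & G & HG & EG).
    set (V := Cmod (g p) + Cmod g1 + Cmod (G p)).
    assert (HV : 0 <= V) by (unfold V; generalize (Cmod_ge_0 (g p)) (Cmod_ge_0 g1) (Cmod_ge_0 (G p)); lra).
    (* The four remainders then sum to at most [2 e t ^ 2], less than the gain [4 e t ^ 2] coming
       from [e |z| ^ 2]. *)
    set (m := e / (4 * (V + 1))).
    assert (Hm : 0 < m) by (apply Rdiv_lt_0_compat; lra).
    destruct (HG m Hm) as (d & Hd & K).
    set (t := Rmin (d / 2) (Rmin ((R - Cmod p) / 2) 1)).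
    assert (Ht : 0 < t) by (repeat apply Rmin_glb_lt; lra).
    assert (t1 : t <= d / 2) by apply Rmin_l.
    assert (t2 : t <= (R - Cmod p) / 2) by (eapply Rle_trans; [apply Rmin_r|apply Rmin_l]).
    assert (t3 : t <= 1) by (eapply Rle_trans; [apply Rmin_r|apply Rmin_r]).
    assert (T : forall h, Cmod h = t -> Cmod (p + h) <= R /\ Cmod (G (p + h)%C - G p) <= m /\
       g (p + h)%C = (g p + h * (g1 + h * (G p + (G (p + h) - G p))))%C).
    { intros h Hh.
      assert (Cmod (p + h) <= R) by (eapply Rle_trans; [apply Cmod_triangle|]; lra).
      split; auto. split.
      - left. apply K. replace (p + h - p)%C with h by ring. lra.
      - rewrite EG at 1 by auto. replace (p + h - p)%C with h by ring. f_equal. f_equal. f_equal. f_equal. ring. }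
    destruct (Cmod_axis t) as (T1 & T2 & T3 & T4); [lra|].
    destruct (T _ T1) as (A1 & B1 & C1). destruct (T _ T2) as (A2 & B2 & C2).
    destruct (T _ T3) as (A3 & B3 & C3). destruct (T _ T4) as (A4 & B4 & C4).
    assert (SD := second_difference (g p) g1 (G p) _ _ _ _ t m (conj Ht t3) B1 B2 B3 B4).
    cbv beta zeta in SD. rewrite <- C1, <- C2, <- C3, <- C4 in SD. fold V in SD.
    assert (M1 := Mp _ A1). assert (M2 := Mp _ A2). assert (M3 := Mp _ A3). assert (M4 := Mp _ A4).
    unfold phi in M1, M2, M3, M4.
    assert (Sq : Cmod (p + (t, 0)) * Cmod (p + (t, 0)) + Cmod (p + (-t, 0)) * Cmod (p + (-t, 0))
      + Cmod (p + (0, t)) * Cmod (p + (0, t)) + Cmod (p + (0, -t)) * Cmod (p + (0, -t)) = 4 * (Cmod p * Cmod p) + 4 * (t * t)).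
    { rewrite !Cmod_sqr. destruct p as [a b]. cbn [fst snd Cplus]. ring. }
    assert (Hm4 : V * m <= e / 4).
    { unfold m. replace (V * (e / (4 * (V + 1)))) with ((V / (V + 1)) * (e / 4)) by (field; lra).
      assert (V / (V + 1) <= 1) by (apply Rle_div_l; lra). nra. }
    assert (tt : 0 < t * t) by nra.
    assert (V * m * (t * t) <= e / 4 * (t * t)) by (apply Rmult_le_compat_r; lra).
    assert (0 < e * (t * t)) by now apply Rmult_lt_0_compat.
    assert (E4 : e * (Cmod (p + (t, 0)) * Cmod (p + (t, 0))) + e * (Cmod (p + (-t, 0)) * Cmod (p + (-t, 0)))
      + e * (Cmod (p + (0, t)) * Cmod (p + (0, t))) + e * (Cmod (p + (0, -t)) * Cmod (p + (0, -t))) = 4 * (e * (Cmod p * Cmod p)) + 4 * (e * (t * t))).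
    { rewrite <- !Rmult_plus_distr_l, Sq. ring. }
    lra. }
  fold (g z0). apply Rsqr_incr_0_var; auto. unfold Rsqr.
  apply le_epsilon. intros e He.
  eapply Rle_trans; [apply (Key (e / (R * R + 1)))|].
  - apply Rdiv_lt_0_compat; nra.
  - apply Rplus_le_compat_l. replace (e / (R * R + 1) * (R * R)) with (R * R / (R * R + 1) * e) by (field; nra).
    assert (R * R / (R * R + 1) <= 1) by (apply Rle_div_l; nra). nra.
Qed.

(** * Finite partial fractions and their error term *)

Definition pfrac (F' : C -> C) (l : list C) (z : C) : C :=
  fold_right (fun t s => / (F' t * (z - t)) + s)%C (RtoC 0) l.

Definition lin_prod (l : list C) (z : C) : C :=
  fold_right (fun t s => (z - t) * s)%C (RtoC 1) l.

Lemma lin_prod_nz l z : ~ In z l -> lin_prod l z <> 0%C.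
Proof.
  induction l as [|t l IH]; intros H; cbn.
  - apply C1_nz.
  - apply Cmult_neq_0; [apply Cminus_eq_contra; intros ->; apply H; now left|].
    apply IH. intros K; apply H; now right.
Qed.

Lemma Ccont_lin_prod l z : Ccont (lin_prod l) z.
Proof.
  induction l as [|t l IH]; [apply Ccont_const|].
  apply (Ccont_mult (fun z => z - t)%C (lin_prod l)); auto.
  apply Ccont_minus; [apply Ccont_id|apply Ccont_const].
Qed.

(** The identity, cleared of denominators, says [1 / F - pfrac = W / U]. At a new zero [t] it gives
    [W t * lin_prod l t = 1], and simplicity gives [F' t = lin_prod l t * U1 t] with [U1 t] nonzero.
    So [W - U1 / F' t] vanishes at [t] and can be divided by [z - t]. *)
Lemma partial_fractions_split F F' l : entire F -> (forall z, cderiv F z (F' z)) ->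
  NoDup l -> (forall t, In t l -> F t = 0%C /\ F' t <> 0%C) ->
  exists W U, entire W /\ entire U /\ (forall z, F z = lin_prod l z * U z)%C /\
    (forall t, In t l -> U t <> 0%C) /\
    (forall z, ~ In z l -> RtoC 1 = pfrac F' l z * F z + W z * lin_prod l z)%C.
Proof.
  intros HF HF'. induction l as [|t l IH]; intros HN Hl.
  - exists (fun _ => RtoC 1), F. split; [apply entire_const|]. split; auto. repeat split.
    + intros z; cbn; ring.
    + intros t [].
    + intros z _; cbn; ring.
  - inversion HN as [|x y Nt HN' [E1 E2]]; subst x y. clear HN.
    destruct IH as (W & U & HW & HU & EP & NU & EI); auto.
    { intros s Hs. apply Hl. now right. }
    destruct (Hl t) as [Ft F't]; [now left|].
    assert (Pt := lin_prod_nz l t Nt).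
    assert (Ut : U t = 0%C).
    { destruct (Ceq_dec (U t) 0) as [|n]; auto. elim (Cmult_neq_0 _ _ Pt n). now rewrite <- EP. }
    destruct (entire_div U t HU) as (U1 & HU1 & EU). rewrite Ut in EU.
    assert (D : F' t = (lin_prod l t * U1 t)%C).
    { apply (cderiv_unique F t); auto. apply cderiv_caratheodory.
      exists (fun w => lin_prod l w * U1 w)%C. split; [|split; auto].
      - apply Ccont_mult; [apply Ccont_lin_prod|now apply entire_cont].
      - intros w. rewrite Ft, EP, EU. ring. }
    assert (U1t : U1 t <> 0%C). { intros E. apply F't. rewrite D, E. ring. }
    assert (EW : (W t * lin_prod l t = 1)%C).
    { rewrite (EI t Nt), Ft. ring. }
    destruct (entire_div (fun z => W z - / F' t * U1 z)%C t) as (W1 & HW1 & EW1).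
    { apply entire_minus; auto. now apply entire_scal. }
    assert (Z : (W t - / F' t * U1 t = 0)%C).
    { rewrite D. replace (W t) with ((W t * lin_prod l t) / lin_prod l t)%C by (field; auto).
      rewrite EW. field. auto. }
    cbv beta in EW1. rewrite Z in EW1.
    exists W1, U1. split; auto. split; auto. split; [|split].
    + intros z. cbn. rewrite EP, EU. fold (lin_prod l z). ring.
    + intros s [<-|Hs]; auto. intros E. apply (NU s Hs). rewrite EU, E. ring.
    + intros z Hz. cbn. fold (pfrac F' l z). fold (lin_prod l z).
      assert (Nz : ~ In z l) by (intros K; apply Hz; now right).
      assert (zt : (z - t)%C <> 0%C). { apply Cminus_eq_contra. intros ->. apply Hz. now left. }
      rewrite (EI z Nz) at 1.
      assert (G : W z = ((z - t) * W1 z + / F' t * U1 z)%C).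
      { replace (W z) with ((W z - / F' t * U1 z) + / F' t * U1 z)%C by ring. rewrite EW1. ring. }
      rewrite G.
      replace ((/ (F' t * (z - t)) + pfrac F' l z) * F z)%C with (pfrac F' l z * F z + / (F' t * (z - t)) * F z)%C by ring.
      rewrite (EP z) at 3. rewrite EU. field. auto.
Qed.

Lemma partial_fractions_disc F F' l (R M : R) : entire F -> (forall z, cderiv F z (F' z)) -> 0 <= M ->
  NoDup l -> (forall z, In z l <-> Cmod z <= R /\ F z = 0%C) -> (forall t, In t l -> F' t <> 0%C) ->
  (forall z, Cmod z = R -> F z <> 0%C /\ Cmod (/ F z - pfrac F' l z) <= M) ->
  forall z, Cmod z <= R -> F z <> 0%C -> Cmod (/ F z - pfrac F' l z) <= M.
Proof.
  intros HF HF' HM HN Hl Hs HB z Hz Fz.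
  destruct (partial_fractions_split F F' l HF HF' HN) as (W & U & HW & HU & EP & NU & EI).
  { intros t Ht. split; [now apply Hl|auto]. }
  assert (K : forall w, F w <> 0%C -> (/ F w - pfrac F' l w = W w / U w)%C).
  { intros w Fw.
    assert (Nw : ~ In w l). { intros I. apply Fw. now apply Hl. }
    assert (Pw := lin_prod_nz l w Nw).
    assert (Uw : U w <> 0%C). { intros E. apply Fw. rewrite EP, E. ring. }
    assert (I := EI w Nw).
    replace (/ F w)%C with ((pfrac F' l w * F w + W w * lin_prod l w) / F w)%C by (rewrite <- I; field; auto).
    rewrite EP at 2. rewrite (EP w) in Fw |- *. field. auto. }
  rewrite (K z Fz). apply (quotient_max_principle W U R M); auto.
  - intros w Hw E. destruct (in_dec Ceq_dec w l) as [I|I].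
    + now apply (NU w I).
    + apply I. apply Hl. split; auto. rewrite EP, E. ring.
  - intros w Hw. destruct (HB w Hw) as [Fw B]. now rewrite <- (K w Fw).
Qed.

Lemma exp_mono x y : x <= y -> exp x <= exp y.
Proof. intros [H| ->]; [left; now apply exp_increasing|right; reflexivity]. Qed.

(** * The Mittag-Leffler function of order [rho] *)

(** This is [exp (w ^ rho)] for [w = Cexp u]. *)
Definition expexp (rho : R) (u : C) : C := Cexp (Cexp (rho * u)).

(* With [z = Cexp u0], the kernel is [e^(w^rho) / (1 - z / w)] in the logarithmic coordinate [w = e^u]. *)
Definition ml_kernel (rho : R) (z u : C) : C := (expexp rho u / (1 - z * Cexp (- u)))%C.

(** Hankel's integrand: one factor [1 / w] of [1 / w ^ (n + 1)] is absorbed by [dw = w du]. *)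
Definition ml_coef (rho : R) (n : nat) (u : C) : C := (expexp rho u * Cexp (- u) ^ n)%C.

Lemma Cmod_expexp rho x v : Cmod (expexp rho (x, v)) = exp (exp (rho * x) * cos (rho * v)).
Proof.
  unfold expexp. rewrite Cmod_Cexp. unfold Cexp; cbn [fst snd Cmult RtoC].
  do 2 f_equal; f_equal; ring.
Qed.

Lemma cderiv_expexp rho u : exists l, cderiv (expexp rho) u l.
Proof.
  eexists. apply (cderiv_comp Cexp (fun u => Cexp (rho * u)) u).
  - apply (cderiv_comp Cexp (fun u => rho * u)%C u).
    + apply cderiv_mult; [apply cderiv_const|apply cderiv_id].
    + apply cderiv_Cexp.
  - apply cderiv_Cexp.
Qed.

Lemma cderiv_Cexp_opp u : cderiv (fun w => Cexp (- w)) u (- Cexp (- u)).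
Proof.
  replace (- Cexp (- u))%C with (Cexp (- u) * (0 * u + - (1) * 1))%C by ring.
  apply (cderiv_comp Cexp (fun w => - w)%C u).
  - apply (cderiv_ext_loc (fun w => - (1) * w)%C _ _ _ 1); [lra|intros; ring|].
    apply (cderiv_mult (fun _ => - (1))%C (fun w => w)); [apply cderiv_const|apply cderiv_id].
  - apply cderiv_Cexp.
Qed.

Lemma cderiv_ml_coef rho n u : exists l, cderiv (ml_coef rho n) u l.
Proof.
  unfold ml_coef. assert (H : exists l, cderiv (fun u => Cexp (- u) ^ n)%C u l).
  { induction n as [|n [l IH]].
    - exists 0%C. apply (cderiv_const (RtoC 1)).
    - eexists. apply (cderiv_mult (fun u => Cexp (- u)) (fun u => Cexp (- u) ^ n)%C); [apply cderiv_Cexp_opp|apply IH]. }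
  destruct H as [l Hl]. destruct (cderiv_expexp rho u) as [m Hm].
  eexists. apply (cderiv_mult (expexp rho) (fun u => Cexp (- u) ^ n)%C); eauto.
Qed.

Lemma cderiv_ml_kernel rho z u : (1 - z * Cexp (- u))%C <> 0%C -> exists l, cderiv (ml_kernel rho z) u l.
Proof.
  intros H. destruct (cderiv_expexp rho u) as [m Hm].
  eexists. apply (cderiv_mult (expexp rho) (fun u => / (1 - z * Cexp (- u)))%C); eauto.
  apply (cderiv_inv (fun u => 1 - z * Cexp (- u))%C); auto.
  apply (cderiv_ext_loc (fun u => 1 + (- z) * Cexp (- u))%C _ _ _ 1); [lra|intros; ring|].
  apply cderiv_plus; [apply cderiv_const|]. apply cderiv_mult; [apply cderiv_const|apply cderiv_Cexp_opp].
Qed.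

(** Under [w = Cexp u] this runs over the arc [|w| = e ^ X], [|arg w| <= al], and [horiz_int] over
    the two rays that bound the sector. *)
Definition vert_int (k : C -> C) (al X : R) : C := CInt (fun v => k (X, v)) (- al) al.

Definition horiz_int (k : C -> C) (al X Y : R) : C := CInt (fun x => k (x, al) - k (x, (- al)%R))%C X Y.

Lemma rect_int_vert_horiz k al X Y : 0 <= al -> X <= Y ->
  contR (fun v => k (X, v)) (-al) al -> contR (fun v => k (Y, v)) (-al) al ->
  contR (fun x => k (x, al)) X Y -> contR (fun x => k (x, - al)) X Y ->
  rect_int k X Y (- al) al = (Ci * (vert_int k al Y - vert_int k al X) - horiz_int k al X Y)%C.
Proof.
  intros Ha HX H1 H2 H3 H4. unfold rect_int, vert_int, horiz_int.
  rewrite (CInt_minus (fun y => k (Y, y)) (fun y => k (X, y))) by (auto; lra).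
  rewrite !(CInt_minus (fun x => k (x, _)) (fun x => k (x, _))) by auto.
  ring.
Qed.

(** The third power of [exp (- x)] is enough: one factor is lost to the denominators of the kernel,
    and one makes the integrals along the rays converge. *)
Lemma exp_exp_decay kap : 0 < kap -> exists K, 0 < K /\
  forall rho x, 1 <= rho -> 0 <= x -> exp (- kap * exp (rho * x)) <= K * exp (- x) ^ 3.
Proof.
  intros Hk. exists (27 / kap ^ 3). assert (0 < kap ^ 3) by now apply pow_lt.
  split; [apply Rdiv_lt_0_compat; lra|]. intros rho x Hr Hx.
  assert (Hs : exp x <= exp (rho * x)) by (apply exp_mono; nra).
  assert (Ps := exp_pos x). set (s := exp x) in *.
  apply Rle_trans with (exp (- (kap * s))).
  { apply exp_mono. nra. }
  rewrite !exp_Ropp. fold s.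
  replace (27 / kap ^ 3 * (/ s) ^ 3) with (/ ((kap * s / 3) ^ 3)) by (field; split; lra).
  apply Rinv_le_contravar.
  - apply pow_lt. apply Rdiv_lt_0_compat; nra.
  - apply cube_le_exp. nra.
Qed.

(** [cos] decreases on [[0, PI]], so the worst case is the edge [|v| = al], where [cos (rho * al)]
    is already negative. *)
Lemma expexp_sector rho al : 1 <= rho -> PI / 2 < rho * al < PI ->
  exists K, 0 < K /\ forall x v, 0 <= x -> al <= Rabs v -> rho * Rabs v <= PI ->
    Cmod (expexp rho (x, v)) <= K * exp (- x) ^ 3.
Proof.
  intros Hr Ha. assert (Hc : cos (rho * al) < 0) by (apply cos_lt_0; lra).
  destruct (exp_exp_decay (- cos (rho * al))) as (K & HK & B); [lra|].
  exists K. split; auto. intros x v Hx Hv Hv'. rewrite Cmod_expexp.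
  eapply Rle_trans; [|apply (B rho x Hr Hx)]. apply exp_mono.
  replace (- - cos (rho * al) * exp (rho * x)) with (exp (rho * x) * cos (rho * al)) by ring.
  apply Rmult_le_compat_l; [left; apply exp_pos|].
  rewrite <- (cos_mult_Rabs rho v). apply cos_decr_1; try lra; nra.
Qed.

Lemma expexp_horizontal rho al : 1 <= rho -> PI / 2 < rho * al < PI ->
  exists K, 0 < K /\ forall x v, 0 <= x -> v = al \/ v = - al ->
    Cmod (expexp rho (x, v)) <= K * exp (- x) ^ 3.
Proof.
  intros Hr Ha. destruct (expexp_sector rho al Hr Ha) as (K & HK & B).
  assert (0 < al) by (generalize PI_RGT_0; nra).
  exists K. split; auto. intros x v Hx Hv. apply B; auto.
  - destruct Hv as [->| ->]; rewrite ?Rabs_Ropp, Rabs_pos_eq; lra.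
  - destruct Hv as [->| ->]; rewrite ?Rabs_Ropp, Rabs_pos_eq; lra.
Qed.

Lemma ml_coef_cont rho n u : Ccont (ml_coef rho n) u.
Proof. destruct (cderiv_ml_coef rho n u) as [l Hl]. eapply cderiv_cont, Hl. Qed.

Lemma Cmod_Cexp_opp x v : Cmod (Cexp (- (x, v))) = exp (- x).
Proof. rewrite Cmod_Cexp. reflexivity. Qed.

Lemma CInt_bound_const_sym f M al : 0 <= al -> contR f (- al) al ->
  (forall v, - al <= v <= al -> Cmod (f v) <= M) -> Cmod (CInt f (- al) al) <= 4 * M * al.
Proof.
  intros Ha Hf B. eapply Rle_trans; [apply (CInt_bound_const f M); auto; lra|]. right; ring.
Qed.

Section MittagLeffler.

Variables (rho : R) (Hrho : 1 < rho).

(** Goursat on the rectangle between the two arcs leaves only the rays. Keeping the factor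
    [exp (- X) ^ n], with a constant uniform in [n], is what permits summation against [z ^ n]
    later. *)
Lemma ml_coef_shift al K n X Y : 0 < al ->
  (forall x v, 0 <= x -> v = al \/ v = - al -> Cmod (expexp rho (x, v)) <= K * exp (- x) ^ 3) ->
  0 <= X <= Y ->
  Cmod (vert_int (ml_coef rho n) al Y - vert_int (ml_coef rho n) al X) <= 4 * K * exp (- X) * exp (- X) ^ n.
Proof.
  intros Hal HK HX.
  assert (C : forall u, Ccont (ml_coef rho n) u) by apply ml_coef_cont.
  assert (E := goursat (ml_coef rho n) X Y (- al) al ltac:(lra) ltac:(lra)
    ltac:(intros x y _ _; apply cderiv_ml_coef)).
  rewrite rect_int_vert_horiz in E by (first [lra | apply contR_horizontal; auto | apply contR_vertical; auto]).
  assert (HK0 : 0 <= K).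
  { specialize (HK 0 al (Rle_refl 0) (or_introl eq_refl)). rewrite Ropp_0, exp_0, pow1 in HK.
    generalize (Cmod_ge_0 (expexp rho (0, al))). lra. }
  assert (E' : Cmod (vert_int (ml_coef rho n) al Y - vert_int (ml_coef rho n) al X)
     = Cmod (horiz_int (ml_coef rho n) al X Y)).
  { rewrite <- (Rmult_1_l (Cmod (_ - _))), <- Cmod_Ci, <- Cmod_mult. f_equal.
    replace (horiz_int (ml_coef rho n) al X Y) with (0 + horiz_int (ml_coef rho n) al X Y)%C by ring.
    rewrite <- E. ring. }
  rewrite E'. clear E E'.
  assert (Pn : 0 < exp (- X) ^ n) by (apply pow_lt, exp_pos).
  replace (4 * K * exp (- X) * exp (- X) ^ n) with (2 * (2 * K * exp (- X) ^ n) * exp (- X)) by ring.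
  apply CInt_bound_exp; [nra|lra| |].
  { apply contR_minus; apply contR_horizontal; auto. }
  intros x Hx.
  assert (B : forall v, v = al \/ v = - al -> Cmod (ml_coef rho n (x, v)) <= K * exp (- X) ^ n * exp (- x)).
  { intros v Hv. unfold ml_coef. rewrite Cmod_mult, Cmod_pow, Cmod_Cexp_opp.
    specialize (HK x v ltac:(lra) Hv).
    assert (P := exp_pos (- x)).
    assert (Q : exp (- x) ^ 3 <= exp (- x)).
    { assert (exp (- x) <= 1) by (rewrite <- exp_0; apply exp_mono; lra).
      replace (exp (- x) ^ 3) with (exp (- x) * (exp (- x) * exp (- x))) by ring. nra. }
    assert (L : exp (- x) ^ n <= exp (- X) ^ n) by (apply pow_incr; split; [lra|apply exp_mono; lra]).
    replace (K * exp (- X) ^ n * exp (- x)) with ((K * exp (- x)) * exp (- X) ^ n) by ring.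
    apply Rmult_le_compat; auto using Cmod_ge_0.
    - apply pow_le; lra.
    - eapply Rle_trans; [apply HK|]. apply Rmult_le_compat_l; auto. }
  eapply Rle_trans; [apply Cmod_triangle_minus|].
  generalize (B al (or_introl eq_refl)) (B (- al) (or_intror eq_refl)). lra.
Qed.

Lemma exp_pow_nat x n : exp x ^ n = exp (INR n * x).
Proof.
  induction n as [|n IH]; [simpl; now rewrite Rmult_0_l, exp_0|].
  rewrite S_INR. simpl. rewrite IH, <- exp_plus. f_equal. ring.
Qed.

Lemma exists_INR_ge x : exists m : nat, x <= INR m.
Proof. destruct (INR_unbounded x) as [m Hm]. exists m. lra. Qed.

Lemma is_lim_seq_exp_opp : is_lim_seq (fun m => exp (- INR m)) 0.
Proof.
  apply (is_lim_seq_ext (fun m => exp (-(1)) ^ m)).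
  - intros m. rewrite exp_pow_nat. f_equal. ring.
  - apply is_lim_seq_geom. rewrite Rabs_pos_eq by (left; apply exp_pos).
    apply Rlt_le_trans with (exp 0); [apply exp_increasing; lra|rewrite exp_0; lra].
Qed.

(** The Hankel integral is taken as the limit of arc integrals of radius [e ^ m], which avoids
    improper integrals. For a given [r], the arc with [e ^ m >= r] bounds [a n * r ^ n], so the
    coefficients are entire. *)
Lemma ml_coef_limit al : PI / 2 < rho * al < PI ->
  exists a : nat -> C, entire_coef a /\ exists K, 0 < K /\
    forall n (m : nat), Cmod (a n - vert_int (ml_coef rho n) al (INR m)) <= K * exp (- INR m) * exp (- INR m) ^ n.
Proof.
  intros Ha. assert (Hal : 0 < al) by (generalize PI_RGT_0; nra).
  destruct (expexp_horizontal rho al ltac:(lra) Ha) as (K & HK & B).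
  assert (S : forall n (m m' : nat), (m <= m')%nat ->
     Cmod (vert_int (ml_coef rho n) al (INR m') - vert_int (ml_coef rho n) al (INR m)) <= 4 * K * exp (- INR m) * exp (- INR m) ^ n).
  { intros n m m' L. apply ml_coef_shift; auto. split; [apply pos_INR|now apply le_INR]. }
  assert (L : forall n, exists l, Clim (fun m => vert_int (ml_coef rho n) al (INR m)) l).
  { intros n. apply (Ccauchy_lim _ (fun m => 4 * K * exp (- INR m))).
    - replace (Finite 0) with (Rbar_mult (4 * K) 0) by (simpl; f_equal; ring).
      apply is_lim_seq_scal_l, is_lim_seq_exp_opp.
    - intros m m' Hm. eapply Rle_trans; [apply S; auto|].
      assert (exp (- INR m) ^ n <= 1).
      { rewrite <- (pow1 n). apply pow_incr. split; [left; apply exp_pos|].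
        rewrite <- exp_0. apply exp_mono. generalize (pos_INR m). lra. }
      assert (0 < 4 * K * exp (- INR m)) by (generalize (exp_pos (- INR m)); nra). nra. }
  set (a := fun n => epsilon (inhabits (RtoC 0)) (fun l => Clim (fun m => vert_int (ml_coef rho n) al (INR m)) l)).
  assert (La : forall n, Clim (fun m => vert_int (ml_coef rho n) al (INR m)) (a n)).
  { intros n. apply (epsilon_spec (inhabits (RtoC 0)) _ (L n)). }
  clearbody a.
  assert (Bd : forall n (m : nat), Cmod (a n - vert_int (ml_coef rho n) al (INR m)) <= 4 * K * exp (- INR m) * exp (- INR m) ^ n).
  { intros n m. apply (Clim_le _ _ _ _ (La n)). exists m. intros m' Hm. now apply S. }
  exists a. split; [|exists (4 * K); split; [lra|auto]].
  intros r Hr. destruct (exists_INR_ge (ln r)) as [m Hm].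
  set (M := exp (exp (rho * INR m))).
  exists (4 * M * al + 4 * K). intros n.
  assert (Hq : exp (- INR m) * r <= 1).
  { rewrite exp_Ropp. apply Rmult_le_reg_l with (exp (INR m)); [apply exp_pos|].
    rewrite <- Rmult_assoc, Rinv_r, Rmult_1_l, Rmult_1_r by (generalize (exp_pos (INR m)); lra).
    rewrite <- (exp_ln r Hr) at 1. now apply exp_mono. }
  assert (Pq := exp_pos (- INR m)).
  assert (Pqn : 0 < exp (- INR m) ^ n) by (now apply pow_lt).
  assert (Prn : 0 < r ^ n) by (now apply pow_lt).
  assert (Hqn : exp (- INR m) ^ n * r ^ n <= 1).
  { rewrite <- Rpow_mult_distr, <- (pow1 n). apply pow_incr. split; [apply Rmult_le_pos; lra|lra]. }
  assert (HV : Cmod (vert_int (ml_coef rho n) al (INR m)) <= 4 * (M * exp (- INR m) ^ n) * al).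
  { apply CInt_bound_const_sym; [lra| |].
    - apply contR_vertical. intros; apply ml_coef_cont.
    - intros v Hv. unfold ml_coef. rewrite Cmod_mult, Cmod_pow, Cmod_Cexp_opp, Cmod_expexp.
      apply Rmult_le_compat_r; [lra|]. apply exp_mono.
      generalize (COS_bound (rho * v)) (exp_pos (rho * INR m)). nra. }
  assert (T : Cmod (a n) <= 4 * (M * exp (- INR m) ^ n) * al + 4 * K * exp (- INR m) ^ n).
  { replace (a n) with ((a n - vert_int (ml_coef rho n) al (INR m)) + vert_int (ml_coef rho n) al (INR m))%C by ring.
    eapply Rle_trans; [apply Cmod_triangle|]. specialize (Bd n m).
    assert (exp (- INR m) <= 1).
    { rewrite <- exp_0. apply exp_mono. generalize (pos_INR m). lra. }
    assert (0 < K * exp (- INR m) ^ n) by nra. nra. }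
  assert (PM : 0 < M) by apply exp_pos.
  apply Rle_trans with ((4 * M * al + 4 * K) * (exp (- INR m) ^ n * r ^ n)).
  - replace ((4 * M * al + 4 * K) * (exp (- INR m) ^ n * r ^ n))
      with ((4 * (M * exp (- INR m) ^ n) * al + 4 * K * exp (- INR m) ^ n) * r ^ n) by ring.
    apply Rmult_le_compat_r; lra.
  - assert (0 < 4 * M * al + 4 * K) by nra. nra.
Qed.

Lemma ml_kernel_den z X v : Cmod z * exp (- X) <= 1/2 -> 1/2 <= Cmod (1 - z * Cexp (- (X, v))).
Proof.
  intros H. generalize (Cmod_triangle_inv 1 (z * Cexp (- (X, v)))).
  rewrite Cmod_1, Cmod_mult, Cmod_Cexp_opp. lra.
Qed.

Lemma ml_kernel_cont z u : (1 - z * Cexp (- u))%C <> 0%C -> Ccont (ml_kernel rho z) u.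
Proof. intros H. destruct (cderiv_ml_kernel rho z u H) as [l Hl]. eapply cderiv_cont, Hl. Qed.

(** On this arc [|z / w| <= 1/2], so the kernel expands in a geometric series, with remainder [R N].
    Replacing the arc integrals by their limits [a n] costs a geometric sum of total
    [2 K exp (- m)]. *)
Lemma ml_series_arc al K a f z (m : nat) : 0 < al -> 0 < K -> ent f a ->
  (forall n (m : nat), Cmod (a n - vert_int (ml_coef rho n) al (INR m)) <= K * exp (- INR m) * exp (- INR m) ^ n) ->
  Cmod z * exp (- INR m) <= 1/2 ->
  Cmod (f z - vert_int (ml_kernel rho z) al (INR m)) <= 2 * K * exp (- INR m).
Proof.
  intros Hal HK Hf Ha Hz. set (X := INR m) in *.
  assert (Den : forall v, (1 - z * Cexp (- (X, v)))%C <> 0%C).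
  { intros v. apply Cmod_gt_0. generalize (ml_kernel_den z X v Hz). lra. }
  set (R := fun N => CInt (fun v => ml_kernel rho z (X, v) * (z * Cexp (- (X, v))) ^ N)%C (- al) al).
  assert (Cq : forall N v, Ccont (fun u => (z * Cexp (- u)) ^ N)%C (X, v)).
  { intros N v. induction N as [|N IH]; [apply (Ccont_const (RtoC 1))|].
    apply (Ccont_mult (fun u => z * Cexp (- u))%C); auto.
    apply Ccont_mult; [apply Ccont_const|]. eapply cderiv_cont, cderiv_Cexp_opp. }
  assert (Ck : forall N, contR (fun v => ml_kernel rho z (X, v) * (z * Cexp (- (X, v))) ^ N)%C (- al) al).
  { intros N. apply (contR_vertical (fun u => ml_kernel rho z u * (z * Cexp (- u)) ^ N)%C).
    intros v _. apply Ccont_mult; auto. now apply ml_kernel_cont. }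
  assert (Cc : forall N, contR (fun v => ml_coef rho N (X, v)) (- al) al).
  { intros N. apply contR_vertical. intros; apply ml_coef_cont. }
  assert (I : forall N, vert_int (ml_kernel rho z) al X =
     (psum (fun n => vert_int (ml_coef rho n) al X) z N + R N)%C).
  { induction N as [|N IH].
    - cbn [psum]. unfold R, vert_int. rewrite Cplus_0_l. apply CInt_ext; [lra|]. intros v _. cbn [Cpow]. ring.
    - rewrite IH. cbn [psum]. rewrite <- Cplus_assoc. f_equal.
      unfold R, vert_int. rewrite Cmult_comm, <- CInt_scal by (auto; lra).
      rewrite <- CInt_plus by (auto using contR_scal; lra).
      apply CInt_ext; [lra|]. intros v _. unfold ml_kernel, ml_coef. cbn [Cpow].
      rewrite !Cpow_mult_l. field. apply Den. }
  set (M := exp (exp (rho * X))).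
  assert (BR : forall N, Cmod (R N) <= 8 * M * al * (1/2) ^ N).
  { intros N. replace (8 * M * al * (1 / 2) ^ N) with (4 * (2 * M * (1/2) ^ N) * al) by ring.
    apply CInt_bound_const_sym; [lra|apply Ck|]. intros v _.
    rewrite Cmod_mult, Cmod_pow, Cmod_mult, Cmod_Cexp_opp.
    apply Rmult_le_compat; [apply Cmod_ge_0| | |].
    - apply pow_le. apply Rmult_le_pos; [apply Cmod_ge_0|left; apply exp_pos].
    - unfold ml_kernel. rewrite Cmod_div by auto. rewrite Cmod_expexp.
      assert (D := ml_kernel_den z X v Hz). apply Rle_div_l; [lra|].
      assert (exp (exp (rho * X) * cos (rho * v)) <= M).
      { apply exp_mono. generalize (COS_bound (rho * v)) (exp_pos (rho * X)). nra. }
      assert (0 < M) by apply exp_pos. nra.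
    - apply pow_incr. split; auto. apply Rmult_le_pos; [apply Cmod_ge_0|left; apply exp_pos]. }
  assert (T : forall N, Cmod (psum a z N - psum (fun n => vert_int (ml_coef rho n) al X) z N) <= 2 * K * exp (- X)).
  { intros N.
    assert (E : (psum a z N - psum (fun n => vert_int (ml_coef rho n) al X) z N)%C
       = (psum (fun n => a n + - (1) * vert_int (ml_coef rho n) al X) z N - psum (fun n => a n + - (1) * vert_int (ml_coef rho n) al X) z 0)%C).
    { rewrite !psum_plus, !psum_scal. cbn [psum]. ring. }
    rewrite E. eapply Rle_trans; [apply (psum_tail _ z (K * exp (- X)) (1/2) ltac:(lra))|]; [|lia|right; simpl; field].
    intros n. specialize (Ha n m). fold X in Ha.
    replace (a n + - (1) * vert_int (ml_coef rho n) al X)%C with (a n - vert_int (ml_coef rho n) al X)%C by ring.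
    assert (Pz : 0 <= Cmod z ^ n) by (apply pow_le, Cmod_ge_0).
    apply Rle_trans with (K * exp (- X) * exp (- X) ^ n * Cmod z ^ n).
    - apply Rmult_le_compat_r; auto.
    - rewrite Rmult_assoc, <- Rpow_mult_distr. apply Rmult_le_compat_l.
      + left. apply Rmult_lt_0_compat; auto. apply exp_pos.
      + apply pow_incr. split; [apply Rmult_le_pos; [left; apply exp_pos|apply Cmod_ge_0]|lra]. }
  apply le_epsilon. intros e He.
  assert (L : is_lim_seq (fun N => 8 * M * al * (1/2) ^ N) 0).
  { replace (Finite 0) with (Rbar_mult (8 * M * al) 0) by (simpl; f_equal; ring).
    apply is_lim_seq_scal_l. apply is_lim_seq_geom. rewrite Rabs_pos_eq; lra. }
  apply is_lim_seq_spec in L. destruct (L (mkposreal e He)) as [N0 HN0]. cbn in HN0.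
  apply (Clim_le (psum a z)); [apply Hf|]. exists N0. intros N HN.
  rewrite (I N).
  replace (psum a z N - (psum (fun n => vert_int (ml_coef rho n) al X) z N + R N))%C
    with ((psum a z N - psum (fun n => vert_int (ml_coef rho n) al X) z N) - R N)%C by ring.
  eapply Rle_trans; [apply Cmod_triangle_minus|].
  specialize (T N). specialize (BR N). specialize (HN0 N HN).
  rewrite Rminus_0_r in HN0. assert (Q := Rle_abs (8 * M * al * (1 / 2) ^ N)). lra.
Qed.

End MittagLeffler.

(** With [r = exp x], the squared distance is at least [1 - 2 r c0 + r ^ 2 = (1 - r c0) ^ 2 + r ^ 2
    (1 - c0 ^ 2)]. *)
Lemma one_minus_Cexp_lower c0 s x y : 0 < s -> s * s <= 1 - c0 * c0 -> cos y <= c0 ->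
  s * exp x <= Cmod (1 - Cexp (x, y)).
Proof.
  intros Hs Hc Hy. assert (P := exp_pos x).
  apply Rsqr_incr_0_var; [|apply Cmod_ge_0]. unfold Rsqr. rewrite Cmod_sqr.
  unfold Cexp, Cminus, Cplus, Copp, RtoC; cbn [fst snd].
  assert (T := sin2_cos2 y). unfold Rsqr in T. set (r := exp x) in *.
  replace ((1 + - (r * cos y)) * (1 + - (r * cos y)) + (0 + - (r * sin y)) * (0 + - (r * sin y)))
    with (1 - 2 * r * cos y + r * r * (sin y * sin y + cos y * cos y)) by ring.
  rewrite T.
  assert (r * cos y <= r * c0) by (apply Rmult_le_compat_l; lra).
  assert (0 <= (1 - r * c0) * (1 - r * c0)) by apply Rle_0_sqr.
  assert ((r * r) * (s * s) <= (r * r) * (1 - c0 * c0)) by (apply Rmult_le_compat_l; nra).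
  nra.
Qed.

Lemma Cexp_eq_1 t : Cexp t = 1%C -> Rabs (snd t) < 2 * PI -> t = 0%C.
Proof.
  destruct t as [x y]. intros H Hy. cbn [snd] in Hy.
  assert (Hx : x = 0).
  { assert (E : Cmod (Cexp (x, y)) = 1) by (rewrite H; apply Cmod_1).
    rewrite Cmod_Cexp in E. cbn [fst] in E. rewrite <- exp_0 in E. now apply exp_inv. }
  subst x. unfold Cexp in H; cbn [fst snd] in H. rewrite exp_0 in H.
  assert (Hc : cos y = 1) by (inversion H; lra).
  assert (S : sin (y / 2) = 0).
  { replace y with (2 * (y / 2)) in Hc by field. rewrite cos_2a_sin in Hc. nra. }
  apply Rabs_def2 in Hy. unfold RtoC. f_equal.
  destruct (Rtotal_order y 0) as [L|[E|L]]; auto; exfalso.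
  - assert (0 < sin (- (y / 2))) by (apply sin_gt_0; lra). rewrite sin_neg in *. lra.
  - assert (0 < sin (y / 2)) by (apply sin_gt_0; lra). lra.
Qed.

(** The integral over the truncated Hankel contour (a ray, the unit arc, a ray), divided by [i]. It
    is normalised so that Goursat turns it into the arc integral at [m] when no pole is enclosed. *)
Definition ml_path (k : C -> C) (al m : R) : C := (vert_int k al 0 - Ci * horiz_int k al 0 m)%C.

Definition path_cont (k : C -> C) (al m : R) : Prop :=
  (forall v, - al <= v <= al -> Ccont k (0, v)) /\
  (forall x v, 0 <= x <= m -> v = al \/ v = - al -> Ccont k (x, v)).

Lemma ml_path_bound k al m B : 0 < al -> 0 <= m -> 0 <= B -> path_cont k al m ->
  (forall v, - al <= v <= al -> Cmod (k (0, v)) <= B) ->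
  (forall x v, 0 <= x <= m -> v = al \/ v = - al -> Cmod (k (x, v)) <= B * exp (- x)) ->
  Cmod (ml_path k al m) <= 4 * B * (al + 1).
Proof.
  intros Hal Hm HB [C1 C2] B1 B2. unfold ml_path.
  eapply Rle_trans; [apply Cmod_triangle_minus|]. rewrite Cmod_mult, Cmod_Ci, Rmult_1_l.
  assert (A1 : Cmod (vert_int k al 0) <= 4 * B * al).
  { apply CInt_bound_const_sym; auto; [lra|]. now apply contR_vertical. }
  assert (A2 : Cmod (horiz_int k al 0 m) <= 2 * (2 * B) * exp (- 0)).
  { apply CInt_bound_exp; auto; [lra| |].
    - apply contR_minus; apply contR_horizontal; intros; apply C2; auto.
    - intros x Hx. eapply Rle_trans; [apply Cmod_triangle_minus|].
      generalize (B2 x al Hx (or_introl eq_refl)) (B2 x (- al) Hx (or_intror eq_refl)). lra. }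
  rewrite Ropp_0, exp_0 in A2. lra.
Qed.

Lemma ml_path_minus k k' al m : 0 < al -> 0 <= m -> path_cont k al m -> path_cont k' al m ->
  ml_path (fun u => k u - k' u)%C al m = (ml_path k al m - ml_path k' al m)%C.
Proof.
  intros Hal Hm [C1 C2] [D1 D2]. unfold ml_path, vert_int, horiz_int.
  rewrite (CInt_minus (fun v => k (0, v)) (fun v => k' (0, v))) by
    (first [lra | now apply contR_vertical]).
  rewrite (CInt_ext _ (fun x => (k (x, al) - k (x, (- al)%R)) - (k' (x, al) - k' (x, (- al)%R)))%C 0 m)
    by (auto; intros; ring).
  rewrite (CInt_minus (fun x => k (x, al) - k (x, (- al)%R))%C (fun x => k' (x, al) - k' (x, (- al)%R))%C);
    auto.
  - ring.
  - apply contR_minus; apply contR_horizontal; intros; apply C2; auto.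
  - apply contR_minus; apply contR_horizontal; intros; apply D2; auto.
Qed.

Lemma al_pos rho al : 1 < rho -> PI / 2 < rho * al < PI -> 0 < al.
Proof. generalize PI_RGT_0; nra. Qed.

(** * The kernel integral on either side of the contour *)

Section Asymptotics.

Variables (rho al c0 s : R).
Hypothesis Hrho : 1 < rho.
Hypothesis Hal : PI / 2 < rho * al < PI.
Hypothesis Hs : 0 < s <= 1/2.
Hypothesis Hsc : s * s <= 1 - c0 * c0.

(** A bound on [cos] keeps [Cexp u] at an angular distance from both rays modulo [2 PI], and
    [1 <= fst u] keeps it off the unit arc. *)
Definition off_path (u : C) : Prop :=
  1 <= fst u /\ forall v, v = al \/ v = - al -> cos (snd u - v) <= c0.

Lemma off_path_den u0 x v : off_path u0 -> (x = 0 \/ (0 <= x /\ (v = al \/ v = - al))) ->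
  s * exp (fst u0 - x) <= Cmod (1 - Cexp (u0 - (x, v))).
Proof.
  intros [H1 H2] [->|[Hx Hv]].
  - rewrite Rminus_0_r. eapply Rle_trans; [|rewrite Cmod_minus_sym; apply Cmod_triangle_inv].
    rewrite Cmod_Cexp, Cmod_1. cbn [fst Cminus Cplus Copp].
    replace (fst u0 + - 0) with (fst u0) by ring.
    assert (2 <= exp (fst u0)).
    { apply Rle_trans with (1 + fst u0); [lra|apply exp_ineq1_le]. }
    nra.
  - destruct u0 as [x0 v0]. cbn [fst snd Cminus Cplus Copp] in *.
    apply (one_minus_Cexp_lower c0 s); auto; [lra|]. now apply H2.
Qed.

Lemma ml_kernel_Cexp u0 u : ml_kernel rho (Cexp u0) u = (expexp rho u / (1 - Cexp (u0 - u)))%C.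
Proof. unfold ml_kernel. now rewrite <- Cexp_plus. Qed.

Lemma off_path_den_nz u0 x v : off_path u0 -> (x = 0 \/ (0 <= x /\ (v = al \/ v = - al))) ->
  (1 - Cexp (u0 - (x, v)))%C <> 0%C.
Proof.
  intros H H'. apply Cmod_gt_0. generalize (off_path_den u0 x v H H') (exp_pos (fst u0 - x)). nra.
Qed.

Lemma off_path_cont u0 m : off_path u0 -> path_cont (ml_kernel rho (Cexp u0)) al m.
Proof.
  intros H. split.
  - intros v Hv. apply ml_kernel_cont. rewrite <- Cexp_plus.
    apply (off_path_den_nz u0); auto.
  - intros x v Hx Hv. apply ml_kernel_cont. rewrite <- Cexp_plus.
    apply (off_path_den_nz u0); auto. right. split; auto. lra.
Qed.

(** Each denominator costs a factor [exp x / s], which [exp (- x) ^ 3] absorbs. The difference of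
    two kernels has two denominators but also carries the factor [(z0 - z1) / w], so its net loss is
    again a single [exp x]. *)
Lemma ml_path_estimates : exists C, 0 < C /\
  (forall u0 m, off_path u0 -> 0 <= m -> Cmod (ml_path (ml_kernel rho (Cexp u0)) al m) <= C) /\
  (forall u0 u1 m, off_path u0 -> off_path u1 -> 0 <= m ->
     Cmod (ml_path (ml_kernel rho (Cexp u0)) al m - ml_path (ml_kernel rho (Cexp u1)) al m)
       <= C * Cmod (Cexp u0 - Cexp u1)).
Proof.
  destruct (expexp_horizontal rho al ltac:(lra) Hal) as (K & HK & BK).
  assert (Ha := al_pos rho al Hrho Hal). assert (He := exp_pos 1).
  assert (B0 : forall v, Cmod (expexp rho (0, v)) <= exp 1).
  { intros v. rewrite Cmod_expexp. apply exp_mono. rewrite Rmult_0_r, exp_0. generalize (COS_bound (rho * v)). lra. }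
  set (C1 := (exp 1 + K) / s).
  assert (HC1 : 0 < C1) by (apply Rdiv_lt_0_compat; lra).
  set (C2 := (exp 1 + K) / (s * s)).
  assert (HC2 : 0 < C2) by (apply Rdiv_lt_0_compat; nra).
  assert (ID : forall u0 x v, off_path u0 -> (x = 0 \/ (0 <= x /\ (v = al \/ v = - al))) ->
     / Cmod (1 - Cexp (u0 - (x, v))) <= exp x / s).
  { intros u0 x v H H'. assert (D := off_path_den u0 x v H H').
    replace (exp x / s) with (/ (s * exp (- x))) by (rewrite exp_Ropp; field; generalize (exp_pos x); split; lra).
    apply Rinv_le_contravar; [generalize (exp_pos (- x)); nra|].
    eapply Rle_trans; [|apply D]. apply Rmult_le_compat_l; [lra|]. apply exp_mono. destruct H. lra. }
  assert (E3 : forall x, exp (- x) ^ 3 * exp x = exp (- x) * exp (- x)).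
  { intros x. rewrite exp_Ropp. field. generalize (exp_pos x); lra. }
  exists (4 * (C1 + C2) * (al + 1)). split; [repeat apply Rmult_lt_0_compat; lra|]. split.
  - intros u0 m H Hm.
    apply Rle_trans with (4 * C1 * (al + 1)); [|nra].
    apply ml_path_bound; auto; [lra|now apply off_path_cont| |].
    + intros v Hv. rewrite ml_kernel_Cexp, Cmod_div by (apply off_path_den_nz; auto).
      apply Rle_trans with (exp 1 * (exp 0 / s)).
      * apply Rmult_le_compat; auto using Cmod_ge_0.
        left. apply Rinv_0_lt_compat, Cmod_gt_0, off_path_den_nz; auto.
      * rewrite exp_0. unfold C1, Rdiv. assert (0 < / s) by (apply Rinv_0_lt_compat; lra). nra.
    + intros x v Hx Hv. assert (Q : x = 0 \/ (0 <= x /\ (v = al \/ v = - al))) by (right; split; auto; lra).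
      rewrite ml_kernel_Cexp, Cmod_div by (apply off_path_den_nz; auto).
      apply Rle_trans with (K * exp (- x) ^ 3 * (exp x / s)).
      * apply Rmult_le_compat; auto using Cmod_ge_0.
        -- left. apply Rinv_0_lt_compat, Cmod_gt_0, off_path_den_nz; auto.
        -- apply BK; auto; lra.
      * replace (K * exp (- x) ^ 3 * (exp x / s)) with (K / s * (exp (- x) ^ 3 * exp x)) by (field; lra).
        rewrite E3. unfold C1.
        assert (X1 : exp (- x) <= 1) by (rewrite <- exp_0; apply exp_mono; lra). assert (X2 := exp_pos (- x)).
        assert (0 < / s) by (apply Rinv_0_lt_compat; lra). unfold Rdiv.
        apply Rle_trans with (K * / s * exp (- x)).
        -- apply Rmult_le_compat_l; [apply Rmult_le_pos; lra|nra].
        -- apply Rmult_le_compat_r; [lra|]. apply Rmult_le_compat_r; lra.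
  - intros u0 u1 m H H' Hm.
    rewrite <- ml_path_minus by auto using off_path_cont.
    set (D := Cmod (Cexp u0 - Cexp u1)). assert (HD : 0 <= D) by apply Cmod_ge_0.
    apply Rle_trans with (4 * (C2 * D) * (al + 1)).
    2:{ replace (4 * (C2 * D) * (al + 1)) with (4 * C2 * (al + 1) * D) by ring. apply Rmult_le_compat_r; nra. }
    assert (F : forall x v, (x = 0 \/ (0 <= x /\ (v = al \/ v = - al))) ->
       Cmod (ml_kernel rho (Cexp u0) (x, v) - ml_kernel rho (Cexp u1) (x, v)) <=
       Cmod (expexp rho (x, v)) * (D * (exp x / (s * s)))).
    { intros x v Q. assert (N0 := off_path_den_nz u0 x v H Q). assert (N1 := off_path_den_nz u1 x v H' Q).
      rewrite !ml_kernel_Cexp.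
      replace (expexp rho (x, v) / (1 - Cexp (u0 - (x, v))) - expexp rho (x, v) / (1 - Cexp (u1 - (x, v))))%C
        with (expexp rho (x, v) * ((Cexp u0 - Cexp u1) * (Cexp (- (x, v)) * (/ (1 - Cexp (u0 - (x, v))) * / (1 - Cexp (u1 - (x, v)))))))%C.
      - rewrite !Cmod_mult, Cmod_Cexp_opp, !Cmod_inv by auto.
        apply Rmult_le_compat_l; [apply Cmod_ge_0|]. apply Rmult_le_compat_l; auto.
        replace (exp x / (s * s)) with (exp (- x) * (exp x / s * (exp x / s))).
        + apply Rmult_le_compat_l; [left; apply exp_pos|].
          apply Rmult_le_compat; auto; left; apply Rinv_0_lt_compat, Cmod_gt_0; auto.
        + rewrite exp_Ropp. field. generalize (exp_pos x); split; lra.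
      - assert (T0 : Cexp (u0 - (x, v)) = (Cexp u0 * Cexp (- (x, v)))%C) by apply Cexp_plus.
        assert (T1 : Cexp (u1 - (x, v)) = (Cexp u1 * Cexp (- (x, v)))%C) by apply Cexp_plus.
        rewrite T0 in *. rewrite T1 in *. field. auto. }
    apply ml_path_bound; auto.
    + apply Rmult_le_pos; lra.
    + destruct (off_path_cont u0 m H) as [P1 P2]. destruct (off_path_cont u1 m H') as [Q1 Q2].
      split; intros; apply Ccont_minus; auto.
    + intros v Hv. eapply Rle_trans; [apply F; auto|]. rewrite exp_0.
      replace (C2 * D) with ((exp 1 + K) * (D * (1 / (s * s)))) by (unfold C2; field; lra).
      apply Rmult_le_compat_r; [|specialize (B0 v); lra].
      apply Rmult_le_pos; auto. left; apply Rdiv_lt_0_compat; nra.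
    + intros x v Hx Hv. eapply Rle_trans; [apply F; right; split; auto; lra|].
      apply Rle_trans with (K * exp (- x) ^ 3 * (D * (exp x / (s * s)))).
      * apply Rmult_le_compat_r; [|apply BK; auto; lra].
        apply Rmult_le_pos; auto. left; apply Rdiv_lt_0_compat; [apply exp_pos|nra].
      * replace (K * exp (- x) ^ 3 * (D * (exp x / (s * s)))) with (K / (s * s) * D * (exp (- x) ^ 3 * exp x)) by (field; lra).
        rewrite E3. unfold C2.
        assert (X1 : exp (- x) <= 1) by (rewrite <- exp_0; apply exp_mono; lra). assert (X2 := exp_pos (- x)).
        assert (0 < / (s * s)) by (apply Rinv_0_lt_compat; nra). unfold Rdiv.
        assert (0 <= K * / (s * s) * D) by (repeat apply Rmult_le_pos; lra).
        apply Rle_trans with (K * / (s * s) * D * exp (- x)).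
        -- apply Rmult_le_compat_l; [auto|nra].
        -- apply Rmult_le_compat_r; [lra|]. apply Rmult_le_compat_r; [auto|]. apply Rmult_le_compat_r; lra.
Qed.

(** The poles of the kernel are [u0 + 2 PI i n]. When [al < |Im u0| <= PI], none of them lies in the
    strip [|Im u| <= al]. *)
Lemma arc_outside u0 m : off_path u0 -> al < Rabs (snd u0) <= PI -> 0 <= m ->
  vert_int (ml_kernel rho (Cexp u0)) al m = ml_path (ml_kernel rho (Cexp u0)) al m.
Proof.
  intros H Hv Hm. assert (Ha := al_pos rho al Hrho Hal). set (k := ml_kernel rho (Cexp u0)).
  assert (HP : al < PI) by (generalize PI_RGT_0; nra).
  assert (Hd : holo_rect k 0 m (- al) al).
  { intros x y Hx Hy. apply cderiv_ml_kernel. rewrite <- Cexp_plus. intros E.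
    assert (E' : Cexp (u0 - (x, y)) = 1%C).
    { symmetry. now apply Ceq_minus. }
    destruct u0 as [x0 v0]. cbn [snd] in Hv.
    assert (Rabs (v0 - y) < 2 * PI).
    { unfold Rminus. eapply Rle_lt_trans; [apply Rabs_triang|]. rewrite Rabs_Ropp.
      assert (Rabs y <= al) by (apply Rabs_le; lra). lra. }
    apply Cexp_eq_1 in E'; auto. inversion E' as [[E1 E2]].
    assert (v0 = y) by lra. subst. assert (Rabs y <= al) by (apply Rabs_le; lra). lra. }
  assert (Hc := holo_cont_rect _ _ _ _ _ Hd).
  assert (G := goursat k 0 m (- al) al Hm ltac:(lra) Hd).
  rewrite rect_int_vert_horiz in G; try lra;
    try (apply contR_vertical; intros; apply Hc; lra); try (apply contR_horizontal; intros; apply Hc; lra).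
  unfold ml_path.
  assert (W : (Ci * (vert_int k al m - vert_int k al 0) = horiz_int k al 0 m)%C) by (apply Ceq_minus; exact G).
  rewrite <- W. replace (Ci * (Ci * (vert_int k al m - vert_int k al 0)))%C with ((Ci * Ci) * (vert_int k al m - vert_int k al 0))%C by ring.
  replace (Ci * Ci)%C with (- (1))%C by (unfold Ci, Cmult, Copp, RtoC; cbn; f_equal; ring). ring.
Qed.

(** As [1 - exp (- t) = t + O (t ^ 2)], the pole at [u0] is simple with residue [expexp rho u0]. *)
Lemma ml_kernel_pole u0 : exists M d, 0 < d /\ forall w, w <> u0 -> Cmod (w - u0) < d ->
  Cmod (ml_kernel rho (Cexp u0) w - expexp rho u0 / (w - u0)) <= M.
Proof.
  destruct (cderiv_expexp rho u0) as [l Hl]. destruct (Hl 1 Rlt_0_1) as (d & Hd & K).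
  set (A := expexp rho u0).
  exists (2 * (1 + Cmod l) + 6 * Cmod A), (Rmin d (1/6)). split; [apply Rmin_glb_lt; lra|].
  intros w Hw Hd'. assert (D1 := Rlt_le_trans _ _ _ Hd' (Rmin_l _ _)). assert (D2 := Rlt_le_trans _ _ _ Hd' (Rmin_r _ _)).
  specialize (K w D1). fold A in K.
  set (t := (w - u0)%C) in *. assert (Pt : 0 < Cmod t) by now apply Cdist_pos.
  rewrite ml_kernel_Cexp. replace (u0 - w)%C with (- t)%C by (unfold t; ring).
  assert (Mt : Cmod (- t) = Cmod t) by apply Cmod_opp.
  destruct (Cexp_minus_1_bounds (- t)) as [L _]; [lra|]. rewrite Mt, Cmod_minus_sym in L.
  assert (T := Cexp_taylor1 (- t) ltac:(lra)). rewrite Mt in T.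
  set (D := (1 - Cexp (- t))%C) in *.
  assert (PD : 0 < Cmod D) by lra. assert (ND : D <> 0%C) by now apply Cmod_gt_0.
  assert (Nt : t <> 0%C) by now apply Cmod_gt_0.
  assert (TD : Cmod (t - D) <= 3 * (Cmod t * Cmod t)).
  { replace (t - D)%C with (Cexp (- t) - 1 - - t)%C by (unfold D; ring). auto. }
  assert (KA : Cmod (expexp rho w - A) <= (1 + Cmod l) * Cmod t).
  { replace (expexp rho w - A)%C with ((expexp rho w - A - l * t) + l * t)%C by ring.
    eapply Rle_trans; [apply Cmod_triangle|]. rewrite Cmod_mult. lra. }
  replace (expexp rho w / D - A / t)%C with ((expexp rho w - A) / D + A * ((t - D) / (D * t)))%C by (field; auto).
  eapply Rle_trans; [apply Cmod_triangle|]. apply Rplus_le_compat.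
  - rewrite Cmod_div by auto. apply Rle_div_l; [lra|]. generalize (Cmod_ge_0 l). nra.
  - rewrite Cmod_mult.
    replace (6 * Cmod A) with (Cmod A * 6) by ring.
    apply Rmult_le_compat_l; [apply Cmod_ge_0|].
    rewrite Cmod_div, Cmod_mult by now apply Cmult_neq_0.
    apply Rle_div_l; [now apply Rmult_lt_0_compat|]. nra.
Qed.

(** Now the rectangle contains exactly one pole. The factor [i] of its contribution
    [2 PI i expexp rho u0] disappears because arcs are integrated against the argument [v]. *)
Lemma arc_inside u0 m : off_path u0 -> Rabs (snd u0) < al -> fst u0 < m ->
  vert_int (ml_kernel rho (Cexp u0)) al m = (2 * PI * expexp rho u0 + ml_path (ml_kernel rho (Cexp u0)) al m)%C.
Proof.
  intros H Hv Hm. assert (Ha := al_pos rho al Hrho Hal). set (k := ml_kernel rho (Cexp u0)).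
  assert (HP : al < PI) by (generalize PI_RGT_0; nra).
  assert (Hx0 : 1 <= fst u0) by apply H.
  assert (Hd : forall x y, 0 <= x <= m -> - al <= y <= al -> (x, y) <> u0 -> exists l, cderiv k (x, y) l).
  { intros x y Hx Hy Hne. apply cderiv_ml_kernel. rewrite <- Cexp_plus. intros E.
    assert (E' : Cexp (u0 - (x, y)) = 1%C).
    { symmetry. now apply Ceq_minus. }
    destruct u0 as [x0 v0]. cbn [snd] in Hv.
    assert (Rabs (v0 - y) < 2 * PI).
    { unfold Rminus. eapply Rle_lt_trans; [apply Rabs_triang|]. rewrite Rabs_Ropp.
      assert (Rabs y <= al) by (apply Rabs_le; lra). lra. }
    apply Cexp_eq_1 in E'; auto. inversion E' as [[E1 E2]].
    apply Hne. f_equal; lra. }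
  apply Rabs_def2 in Hv.
  assert (Hc : forall x y, 0 <= x <= m -> - al <= y <= al -> (x, y) <> u0 -> Ccont k (x, y)).
  { intros x y Hx Hy Hne. destruct (Hd x y Hx Hy Hne) as [l Hl]. eapply cderiv_cont, Hl. }
  destruct (ml_kernel_pole u0) as (M & d & Hd0 & HM).
  assert (G := residue_rect k 0 m (- al) al u0 (expexp rho u0) M d ltac:(lra) ltac:(lra) Hd Hd0 HM).
  assert (Ne : forall x y, x <> fst u0 \/ y <> snd u0 -> (x, y) <> u0).
  { intros x y N E. rewrite <- E in N. cbn in N. lra. }
  rewrite rect_int_vert_horiz in G; try lra;
    try (apply contR_vertical; intros; apply Hc; auto; lra); try (apply contR_horizontal; intros; apply Hc; auto; lra);
    try (apply contR_vertical; intros; apply Hc; [lra|lra|apply Ne; lra]);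
    try (apply contR_horizontal; intros; apply Hc; [lra|lra|apply Ne; lra]).
  unfold ml_path.
  assert (W : (horiz_int k al 0 m = Ci * (vert_int k al m - vert_int k al 0) - 2 * PI * Ci * expexp rho u0)%C).
  { rewrite <- G. ring. }
  rewrite W.
  replace (Ci * (Ci * (vert_int k al m - vert_int k al 0) - 2 * PI * Ci * expexp rho u0))%C
    with ((Ci * Ci) * ((vert_int k al m - vert_int k al 0) - 2 * PI * expexp rho u0))%C by ring.
  replace (Ci * Ci)%C with (- (1))%C by (unfold Ci, Cmult, Copp, RtoC; cbn; f_equal; ring). ring.
Qed.

End Asymptotics.

Lemma cos_le_away_from_0 d t : 0 <= d <= PI -> d <= Rabs t <= 2 * PI - d -> cos t <= cos d.
Proof.
  intros Hd Ht. rewrite <- (cos_Rabs t). destruct (Rle_dec (Rabs t) PI) as [H|H].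
  - apply cos_decr_1; lra.
  - replace (cos (Rabs t)) with (cos (2 * PI - Rabs t)).
    + apply cos_decr_1; lra.
    + replace (2 * PI - Rabs t) with (- (Rabs t) + 2 * INR 1 * PI) by (simpl; ring).
      rewrite cos_period. apply cos_neg.
Qed.

(** Both angles define the same coefficients: between them [cos (rho * v) < 0], so the extra pieces
    of the arcs vanish in the limit. Two contours are needed because the bounds on [ml_path]
    degenerate near the rays. *)
Lemma ml_coef_limit_smaller_angle rho al1 al2 a K : 1 < rho ->
  PI / 2 < rho * al1 < PI -> PI / 2 < rho * al2 < PI -> al1 <= al2 ->
  (forall n (m : nat), Cmod (a n - vert_int (ml_coef rho n) al2 (INR m)) <= K * exp (- INR m) * exp (- INR m) ^ n) ->
  exists K', 0 < K' /\ forall n (m : nat),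
    Cmod (a n - vert_int (ml_coef rho n) al1 (INR m)) <= K' * exp (- INR m) * exp (- INR m) ^ n.
Proof.
  intros Hr H1 H2 Hle Ha.
  assert (P1 := al_pos rho al1 Hr H1).
  destruct (expexp_sector rho al1 ltac:(lra) H1) as (K1 & HK1 & B).
  destruct (expexp_horizontal rho al1 ltac:(lra) H1) as (K2 & HK2 & B2).
  exists (4 * K2). split; [lra|]. intros n m.
  assert (E1 : forall m : nat, 0 < exp (- INR m) <= 1).
  { intros k. split; [apply exp_pos|]. rewrite <- exp_0. apply exp_mono. generalize (pos_INR k); lra. }
  assert (D : forall m : nat, Cmod (vert_int (ml_coef rho n) al2 (INR m) - vert_int (ml_coef rho n) al1 (INR m))
     <= 4 * K1 * (al2 - al1) * exp (- INR m)).
  { intros k. destruct (E1 k) as [E2 E3]. unfold vert_int.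
    assert (Cc : forall s t, contR (fun v => ml_coef rho n (INR k, v)) s t).
    { intros s t. apply contR_vertical. intros; apply ml_coef_cont. }
    rewrite (CInt_Chasles _ (- al2) (- al1) al2), (CInt_Chasles _ (- al1) al1 al2) by (auto; lra).
    match goal with |- Cmod ?x <= _ => replace x with
      (CInt (fun v => ml_coef rho n (INR k, v)) (- al2) (- al1) + CInt (fun v => ml_coef rho n (INR k, v)) al1 al2)%C by ring end.
    assert (Bv : forall v, al1 <= Rabs v <= al2 -> Cmod (ml_coef rho n (INR k, v)) <= K1 * exp (- INR k)).
    { intros v Hv. unfold ml_coef. rewrite Cmod_mult, Cmod_pow, Cmod_Cexp_opp.
      assert (A := B (INR k) v (pos_INR k) (proj1 Hv) ltac:(nra)).
      assert (exp (- INR k) ^ n <= 1) by (rewrite <- (pow1 n); apply pow_incr; lra).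
      assert (0 < exp (- INR k) ^ n) by (now apply pow_lt).
      assert (exp (- INR k) ^ 3 <= exp (- INR k)).
      { replace (exp (- INR k) ^ 3) with (exp (- INR k) * (exp (- INR k) * exp (- INR k))) by ring. nra. }
      rewrite <- (Rmult_1_r (K1 * exp (- INR k))).
      apply Rmult_le_compat; auto using Cmod_ge_0; [lra|]. eapply Rle_trans; [apply A|].
      apply Rmult_le_compat_l; lra. }
    eapply Rle_trans; [apply Cmod_triangle|].
    assert (A1 : Cmod (CInt (fun v => ml_coef rho n (INR k, v)) (- al2) (- al1)) <= 2 * (K1 * exp (- INR k)) * (- al1 - - al2)).
    { apply CInt_bound_const; auto; [lra|]. intros v Hv. apply Bv.
      rewrite Rabs_left1; lra. }
    assert (A2 : Cmod (CInt (fun v => ml_coef rho n (INR k, v)) al1 al2) <= 2 * (K1 * exp (- INR k)) * (al2 - al1)).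
    { apply CInt_bound_const; auto. intros v Hv. apply Bv. rewrite Rabs_pos_eq; lra. }
    lra. }
  assert (L2 : Clim (fun m => vert_int (ml_coef rho n) al1 (INR m)) (a n)).
  { apply (Clim_squeeze _ _ (fun m => (Rabs K + 4 * K1 * (al2 - al1)) * exp (- INR m))).
    - intros k. destruct (E1 k) as [E2 E3].
      replace (vert_int (ml_coef rho n) al1 (INR k) - a n)%C
        with (- (a n - vert_int (ml_coef rho n) al2 (INR k)) - (vert_int (ml_coef rho n) al2 (INR k) - vert_int (ml_coef rho n) al1 (INR k)))%C by ring.
      eapply Rle_trans; [apply Cmod_triangle_minus|]. rewrite Cmod_opp.
      specialize (Ha n k). specialize (D k).
      assert (exp (- INR k) ^ n <= 1) by (rewrite <- (pow1 n); apply pow_incr; lra).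
      assert (0 < exp (- INR k) ^ n) by (now apply pow_lt).
      assert (K * exp (- INR k) * exp (- INR k) ^ n <= Rabs K * exp (- INR k)).
      { assert (0 <= Rabs K * exp (- INR k)) by (apply Rmult_le_pos; [apply Rabs_pos|lra]).
        apply Rle_trans with (Rabs K * exp (- INR k) * exp (- INR k) ^ n).
        - apply Rmult_le_compat_r; [lra|]. apply Rmult_le_compat_r; [lra|apply Rle_abs].
        - nra. }
      lra.
    - replace (Finite 0) with (Rbar_mult (Rabs K + 4 * K1 * (al2 - al1)) 0) by (simpl; f_equal; ring).
      apply is_lim_seq_scal_l, is_lim_seq_exp_opp. }
  apply (Clim_le _ _ _ _ L2). exists m. intros m' Hm.
  apply (ml_coef_shift rho al1 K2 n); auto. split; [apply pos_INR|now apply le_INR].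
Qed.

(** In use [r] is the residue term (or 0) and [P m] the contour integral truncated at [m]: bounds on
    [P] uniform in [m] then pass to the entire function. *)
Lemma arc_limit rho al K a f u : 1 < rho -> 0 < al -> 0 < K -> ent f a ->
  (forall n (m : nat), Cmod (a n - vert_int (ml_coef rho n) al (INR m)) <= K * exp (- INR m) * exp (- INR m) ^ n) ->
  forall P (r : C), (forall m : nat, fst u < INR m -> vert_int (ml_kernel rho (Cexp u)) al (INR m) = (r + P m)%C) ->
  Clim P (f (Cexp u) - r).
Proof.
  intros Hr Hal HK Hf Ha P r HP e He.
  assert (L := is_lim_seq_exp_opp). apply is_lim_seq_spec in L.
  assert (He1 : 0 < Rmin (e / (2 * K)) (exp (- fst u) / 2)).
  { apply Rmin_glb_lt; [apply Rdiv_lt_0_compat; lra|]. generalize (exp_pos (- fst u)). lra. }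
  destruct (L (mkposreal _ He1)) as [N HN]. destruct (INR_unbounded (fst u)) as [N' HN'].
  exists (max N N'). intros m Hm. specialize (HN m ltac:(lia)). cbn in HN.
  rewrite Rminus_0_r, Rabs_pos_eq in HN by (left; apply exp_pos).
  assert (M1 := Rlt_le_trans _ _ _ HN (Rmin_l _ _)). assert (M2 := Rlt_le_trans _ _ _ HN (Rmin_r _ _)).
  assert (HmN : INR N' <= INR m) by (apply le_INR; lia).
  assert (T := ml_series_arc rho al K a f (Cexp u) m Hal HK Hf Ha).
  rewrite (HP m) in T by lra.
  replace (P m - (f (Cexp u) - r))%C with (- (f (Cexp u) - (r + P m)))%C by ring. rewrite Cmod_opp.
  eapply Rle_lt_trans; [apply T|].
  - rewrite Cmod_Cexp; rewrite (exp_Ropp (fst u)) in M2. assert (Px := exp_pos (fst u)).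
    apply Rle_trans with (exp (fst u) * (/ exp (fst u) / 2)); [apply Rmult_le_compat_l; lra|]. right; field; apply Rgt_not_eq, Px.
  - apply Rlt_div_r in M1; lra.
Qed.

Theorem mittag_leffler rho : 1 < rho -> exists E, entire E /\ exists C, 0 < C /\
  (forall u, 1 <= fst u -> Rabs (snd u) <= 3 * PI / (4 * rho) -> Cmod (E (Cexp u) - expexp rho u) <= C) /\
  (forall u, 1 <= fst u -> 3 * PI / (4 * rho) <= Rabs (snd u) <= PI -> Cmod (E (Cexp u)) <= C) /\
  (forall u u', 1 <= fst u -> Rabs (snd u) <= 3 * PI / (4 * rho) ->
     1 <= fst u' -> Rabs (snd u') <= 3 * PI / (4 * rho) ->
     Cmod ((E (Cexp u) - expexp rho u) - (E (Cexp u') - expexp rho u')) <= C * Cmod (Cexp u - Cexp u')).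
Proof.
  intros Hr. assert (HPI := PI_RGT_0).
  (* In units of [d], the sector where [exp (z ^ rho)] is large ends at [6 d]. Contours at [8 d] and
     [10 d] leave an angular margin [d] on either side of the dividing direction
     [9 d = 3 PI / (4 rho)]. *)
  set (d := PI / (12 * rho)).
  assert (Hd : 0 < d) by (apply Rdiv_lt_0_compat; lra).
  assert (Ed : PI = 12 * rho * d) by (unfold d; field; lra).
  assert (Hd12 : 12 * d <= PI) by nra.
  set (al1 := 8 * d). set (al2 := 10 * d).
  replace (3 * PI / (4 * rho)) with (9 * d) by (unfold d; field; lra).
  assert (H1 : PI / 2 < rho * al1 < PI) by (unfold al1; nra).
  assert (H2 : PI / 2 < rho * al2 < PI) by (unfold al2; nra).
  destruct (ml_coef_limit rho Hr al2 H2) as (a & Ha & K2 & HK2 & B2).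
  destruct (ml_coef_limit_smaller_angle rho al1 al2 a K2 Hr H1 H2 ltac:(unfold al1, al2; lra) B2) as (K1 & HK1 & B1).
  destruct (ent_exists a Ha) as [f Hf].
  set (c0 := cos d). set (s := Rmin (1/2) (sin d)).
  assert (Hsd : 0 < sin d) by (apply sin_gt_0; lra).
  assert (Hs : 0 < s <= 1/2) by (split; [apply Rmin_glb_lt; lra|apply Rmin_l]).
  assert (Hsc : s * s <= 1 - c0 * c0).
  { assert (s <= sin d) by apply Rmin_r. assert (T := sin2_cos2 d). unfold Rsqr in T. unfold c0.
    assert (s * s <= sin d * sin d) by (apply Rmult_le_compat; lra). lra. }
  destruct (ml_path_estimates rho al1 c0 s Hr H1 Hs Hsc) as (C1 & HC1 & E1 & _).
  destruct (ml_path_estimates rho al2 c0 s Hr H2 Hs Hsc) as (C2 & HC2 & E2 & F2).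
  assert (P1 := al_pos rho al1 Hr H1). assert (P2 := al_pos rho al2 Hr H2).
  assert (O1 : forall u, 1 <= fst u -> 9 * d <= Rabs (snd u) <= PI -> off_path al1 c0 u).
  { intros u Hu Hv. split; auto. intros v Hvv. apply cos_le_away_from_0; [lra|].
    assert (A1 := Rabs_triang_inv (snd u) v). assert (A2 := Rabs_triang (snd u) (- v)). rewrite Rabs_Ropp in A2.
    assert (A3 : Rabs v = al1) by (destruct Hvv as [->| ->]; rewrite ?Rabs_Ropp, Rabs_pos_eq; lra).
    unfold Rminus at 2 3. unfold al1 in *. fold (snd u - v) in *. lra. }
  assert (O2 : forall u, 1 <= fst u -> Rabs (snd u) <= 9 * d -> off_path al2 c0 u).
  { intros u Hu Hv. split; auto. intros v Hvv. apply cos_le_away_from_0; [lra|].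
    assert (A1 := Rabs_triang_inv v (snd u)). rewrite Rabs_minus_sym in A1.
    assert (A2 := Rabs_triang (snd u) (- v)). rewrite Rabs_Ropp in A2.
    assert (A3 : Rabs v = al2) by (destruct Hvv as [->| ->]; rewrite ?Rabs_Ropp, Rabs_pos_eq; lra).
    unfold al2 in *. fold (snd u - v) in *. lra. }
  assert (L1 : forall u, 1 <= fst u -> 9 * d <= Rabs (snd u) <= PI ->
     Clim (fun m => ml_path (ml_kernel rho (Cexp u)) al1 (INR m)) (f (Cexp u) - 0)).
  { intros u Hu Hv. apply (arc_limit rho al1 K1 a f u Hr P1 HK1 Hf B1). intros m Hm.
    rewrite Cplus_0_l. apply (arc_outside rho al1 c0 s); auto.
    - unfold al1; lra.
    - apply pos_INR. }
  assert (L2 : forall u, 1 <= fst u -> Rabs (snd u) <= 9 * d ->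
     Clim (fun m => ml_path (ml_kernel rho (Cexp u)) al2 (INR m)) (f (Cexp u) - 2 * PI * expexp rho u)).
  { intros u Hu Hv. apply (arc_limit rho al2 K2 a f u Hr P2 HK2 Hf B2). intros m Hm.
    apply (arc_inside rho al2 c0 s); auto. unfold al2; lra. }
  exists (fun z => / (2 * PI) * f z)%C. split; [apply entire_scal; now exists a|].
  assert (N2 : (RtoC 2 * PI)%C <> 0%C).
  { apply Cmult_neq_0; intros E; inversion E; lra. }
  assert (N3 : RtoC PI <> 0%C) by (intros E; inversion E; lra).
  assert (N4 : RtoC 2 <> 0%C) by (intros E; inversion E; lra).
  assert (Mi : Cmod (/ (2 * PI)) <= 1).
  { rewrite Cmod_inv, Cmod_mult, !Cmod_R, !Rabs_pos_eq by (auto; lra).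
    apply Rle_trans with (/ 1); [|rewrite Rinv_1; lra]. apply Rinv_le_contravar; generalize PI2_3_2; lra. }
  assert (Mi' : forall z, Cmod (/ (2 * PI) * z) <= Cmod z).
  { intros z. rewrite Cmod_mult. generalize (Cmod_ge_0 z). nra. }
  exists (C1 + C2). split; [lra|].
  split; [|split].
  - intros u Hu Hv.
    replace (/ (2 * PI) * f (Cexp u) - expexp rho u)%C with (/ (2 * PI) * (f (Cexp u) - 2 * PI * expexp rho u - 0))%C
      by (field; repeat split; auto).
    eapply Rle_trans; [apply Mi'|]. apply Rle_trans with C2; [|lra].
    apply (Clim_le _ _ _ _ (L2 u Hu Hv)). exists O. intros m _.
    unfold Cminus. rewrite Copp_0, Cplus_0_r. apply E2; [now apply O2|apply pos_INR].
  - intros u Hu Hv. eapply Rle_trans; [apply Mi'|]. apply Rle_trans with C1; [|lra].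
    replace (f (Cexp u)) with (f (Cexp u) - 0 - 0)%C by ring.
    apply (Clim_le _ _ _ _ (L1 u Hu Hv)). exists O. intros m _.
    unfold Cminus. rewrite Copp_0, Cplus_0_r. apply E1; [now apply O1|apply pos_INR].
  - intros u u' Hu Hv Hu' Hv'.
    replace (/ (2 * PI) * f (Cexp u) - expexp rho u - (/ (2 * PI) * f (Cexp u') - expexp rho u'))%C
      with (/ (2 * PI) * ((f (Cexp u) - 2 * PI * expexp rho u) + - (1) * (f (Cexp u') - 2 * PI * expexp rho u') - 0))%C
      by (field; repeat split; auto).
    eapply Rle_trans; [apply Mi'|]. apply Rle_trans with (C2 * Cmod (Cexp u - Cexp u')).
    2:{ apply Rmult_le_compat_r; [apply Cmod_ge_0|lra]. }
    apply (Clim_le _ _ _ _ (Clim_plus _ _ _ _ (L2 u Hu Hv) (Clim_scal (- (1)) _ _ (L2 u' Hu' Hv')))).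
    exists O. intros m _.
    match goal with |- Cmod ?x <= _ => replace x with
      (ml_path (ml_kernel rho (Cexp u)) al2 (INR m) - ml_path (ml_kernel rho (Cexp u')) al2 (INR m))%C by ring end.
    apply F2; auto. apply pos_INR.
Qed.

(** * Zeros of [E z + z ^ k + c] *)

Lemma exp_dominates_quadratic K a : 0 < a ->
  exists x0, 1 <= x0 /\ forall x, x0 <= x -> K * (1 + x) ^ 2 <= exp (a * x).
Proof.
  intros Ha. set (M := Rabs K).
  (* [108 = 4 * 27]: the 4 comes from [1 + x <= 2 x], the 27 from [cube_le_exp]. *)
  exists (Rmax 1 (108 * M / a ^ 3)). split; [apply Rmax_l|]. intros x Hx.
  assert (H1 : 1 <= x) by (eapply Rle_trans; [apply Rmax_l|apply Hx]).
  assert (H2 : 108 * M / a ^ 3 <= x) by (eapply Rle_trans; [apply Rmax_r|apply Hx]).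
  assert (Pa : 0 < a ^ 3) by now apply pow_lt.
  apply Rle_div_l in H2; auto.
  assert (HM : 0 <= M) by apply Rabs_pos.
  assert (E3 : (a * x / 3) ^ 3 <= exp (a * x)).
  { apply cube_le_exp. nra. }
  eapply Rle_trans; [|apply E3].
  replace ((a * x / 3) ^ 3) with (x * a ^ 3 * (x ^ 2 / 27)) by field.
  apply Rle_trans with (108 * M * (x ^ 2 / 27)).
  - replace (108 * M * (x ^ 2 / 27)) with (M * (2 * x) ^ 2) by field.
    apply Rle_trans with (M * (1 + x) ^ 2).
    + apply Rmult_le_compat_r; [apply pow2_ge_0|apply Rle_abs].
    + apply Rmult_le_compat_l; auto. apply pow_incr. lra.
  - apply Rmult_le_compat_r; auto. generalize (pow2_ge_0 x). lra.
Qed.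

Lemma exp_dominates_const K a : 0 < a ->
  exists x0, 1 <= x0 /\ forall x, x0 <= x -> K <= exp (a * x).
Proof.
  intros Ha. destruct (exp_dominates_quadratic (Rabs K) a Ha) as (x0 & H0 & B).
  exists x0. split; auto. intros x Hx. eapply Rle_trans; [|apply B; auto].
  generalize (Rle_abs K) (Rabs_pos K). intros. assert (1 <= (1 + x) ^ 2) by (simpl; nra). nra.
Qed.

Lemma mult_cos_le_sin y : 0 <= y <= PI / 2 -> y * cos y <= sin y.
Proof.
  intros Hy. destruct (MVT_gen sin 0 y cos) as (c & Hc & E).
  - intros; apply is_derive_sin.
  - intros; apply continuity_sin.
  - rewrite sin_0, !Rminus_0_r in E. rewrite E, Rmult_comm. apply Rmult_le_compat_r; [lra|].
    rewrite Rmin_left, Rmax_right in Hc by lra. apply cos_decr_1; lra.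
Qed.

(** A quantitative logarithm near 1: in the strip [|Im t| <= PI] the only preimage of 1 is 0. *)
Lemma Cexp_near_1 t : Rabs (snd t) <= PI -> Cmod (Cexp t - 1) <= 1/4 ->
  Cmod t <= 6 * Cmod (Cexp t - 1).
Proof.
  destruct t as [x y]. cbn [snd]. intros Hy He. set (e := Cmod (Cexp (x, y) - 1)) in *.
  assert (H1 := Re_le_Cmod (Cexp (x, y) - 1)%C). assert (H2 := Im_le_Cmod (Cexp (x, y) - 1)%C).
  fold e in H1, H2. unfold Cexp, Cminus, Cplus, Copp, RtoC in H1, H2; cbn [fst snd] in H1, H2.
  assert (A1 := Cmod_triangle_inv (Cexp (x, y)) 1). assert (A2 := Cmod_triangle_inv 1 (Cexp (x, y))).
  rewrite (Cmod_minus_sym 1) in A2. fold e in A1, A2. rewrite Cmod_Cexp, Cmod_1 in A1, A2. cbn [fst] in A1, A2.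
  set (r := exp x) in *. assert (Hx1 : 1 + x <= r) by apply exp_ineq1_le.
  assert (Hx2 : 1 - x <= / r).
  { unfold r. rewrite <- exp_Ropp. replace (1 - x) with (1 + - x) by ring. apply exp_ineq1_le. }
  assert (Pr : 3/4 <= r <= 5/4) by lra.
  assert (Hx3 : / r - 1 <= 4/3 * e).
  { replace (/ r - 1) with ((1 - r) / r) by (field; lra). apply Rle_div_l; [lra|].
    assert (0 <= e) by apply Cmod_ge_0. nra. }
  assert (HX : Rabs x <= 4/3 * e) by (apply Rabs_le; assert (0 <= e) by apply Cmod_ge_0; lra).
  apply Rabs_le_between in H1.
  assert (Hc : 1/2 <= cos y) by nra.
  assert (HS : Rabs (sin y) <= 4/3 * e).
  { replace (r * sin y + - 0) with (r * sin y) in H2 by ring. rewrite Rabs_mult, (Rabs_pos_eq r) in H2 by lra.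
    generalize (Rabs_pos (sin y)). nra. }
  assert (Cy := cos_Rabs y). assert (Sy := sin_Rabs_le y).
  assert (Hy2 : Rabs y <= PI / 2).
  { apply Rnot_lt_le. intros K. assert (cos (Rabs y) <= 0); [|lra].
    generalize PI_RGT_0; intros. apply cos_le_0; lra. }
  assert (Py := Rabs_pos y).
  assert (HY : Rabs y <= 8/3 * e).
  { assert (T := mult_cos_le_sin (Rabs y) ltac:(lra)). rewrite Cy in T. nra. }
  eapply Rle_trans; [apply Cmod_le_abs|]. cbn [fst snd]. assert (0 <= e) by apply Cmod_ge_0. lra.
Qed.

Section Zeros.

Variables (rho : R) (k : nat) (E : C -> C) (Cb : R).
Hypothesis Hrho : 1 < rho.
Hypothesis Hk : (1 <= k)%nat.
Hypothesis HCb : 0 < Cb.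
Hypothesis HE1 : forall u, 1 <= fst u -> Rabs (snd u) <= 3 * PI / (4 * rho) ->
  Cmod (E (Cexp u) - expexp rho u) <= Cb.
Hypothesis HE2 : forall u, 1 <= fst u -> 3 * PI / (4 * rho) <= Rabs (snd u) <= PI -> Cmod (E (Cexp u)) <= Cb.
Hypothesis HE3 : forall u u', 1 <= fst u -> Rabs (snd u) <= 3 * PI / (4 * rho) ->
     1 <= fst u' -> Rabs (snd u') <= 3 * PI / (4 * rho) ->
     Cmod ((E (Cexp u) - expexp rho u) - (E (Cexp u') - expexp rho u')) <= Cb * Cmod (Cexp u - Cexp u').

Definition MLF (c z : C) : C := (E z + z ^ k + c)%C.

Lemma kR : 1 <= INR k.
Proof. apply (le_INR 1) in Hk. exact Hk. Qed.

Lemma Cmod_pow_Cexp u : Cmod (Cexp u ^ k) = exp (INR k * fst u).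
Proof. rewrite Cmod_pow, Cmod_Cexp. apply exp_pow_nat. Qed.

Lemma MLF_inner_split c u : Cmod c <= 1 -> 1 <= fst u -> Rabs (snd u) <= 3 * PI / (4 * rho) ->
  Cmod (MLF c (Cexp u) - expexp rho u - Cexp u ^ k) <= Cb + 1.
Proof.
  intros Hc Hu Hv. unfold MLF.
  replace (E (Cexp u) + Cexp u ^ k + c - expexp rho u - Cexp u ^ k)%C with ((E (Cexp u) - expexp rho u) + c)%C by ring.
  eapply Rle_trans; [apply Cmod_triangle|]. specialize (HE1 u Hu Hv). lra.
Qed.

Lemma MLF_outer_split c u : Cmod c <= 1 -> 1 <= fst u -> 3 * PI / (4 * rho) <= Rabs (snd u) <= PI ->
  Cmod (MLF c (Cexp u) - Cexp u ^ k) <= Cb + 1.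
Proof.
  intros Hc Hu Hv. unfold MLF.
  replace (E (Cexp u) + Cexp u ^ k + c - Cexp u ^ k)%C with (E (Cexp u) + c)%C by ring.
  eapply Rle_trans; [apply Cmod_triangle|]. specialize (HE2 u Hu Hv). lra.
Qed.

Lemma expexp_left x v : PI / (2 * rho) <= Rabs v <= 3 * PI / (4 * rho) -> Cmod (expexp rho (x, v)) <= 1.
Proof.
  intros Hv. rewrite Cmod_expexp. rewrite <- exp_0. apply exp_mono.
  assert (cos (rho * v) <= 0); [|generalize (exp_pos (rho * x)); nra].
  rewrite <- (cos_mult_Rabs rho v). assert (H1 : PI / 2 <= rho * Rabs v).
  { replace (PI / 2) with (rho * (PI / (2 * rho))) by (field; lra). apply Rmult_le_compat_l; lra. }
  assert (H2 : rho * Rabs v <= 3 * PI / 4).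
  { replace (3 * PI / 4) with (rho * (3 * PI / (4 * rho))) by (field; lra). apply Rmult_le_compat_l; lra. }
  generalize PI_RGT_0; intros. apply cos_le_0; lra.
Qed.

(** Beyond the edge of the sector the exponential term is at most 1, and further out [E] is bounded,
    so [z ^ k] dominates. *)
Lemma MLF_outside : exists x0, 1 <= x0 /\ forall c, Cmod c <= 1 -> forall u, x0 <= fst u ->
  PI / (2 * rho) <= Rabs (snd u) <= PI -> exp (INR k * fst u) / 2 <= Cmod (MLF c (Cexp u)).
Proof.
  destruct (exp_dominates_const (2 * (Cb + 2)) (INR k)) as (x0 & H0 & B); [generalize kR; lra|].
  exists x0. split; auto. intros c Hc u Hu Hv. specialize (B (fst u) Hu).
  rewrite <- (Cmod_pow_Cexp u) in *.
  destruct (Rle_dec (Rabs (snd u)) (3 * PI / (4 * rho))) as [H|H].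
  - assert (T := MLF_inner_split c u Hc ltac:(lra) H).
    assert (X : Cmod (expexp rho u) <= 1) by (destruct u; apply expexp_left; cbn in *; lra).
    assert (Y := Cmod_triangle_inv (Cexp u ^ k) (MLF c (Cexp u))).
    assert (Z : Cmod (Cexp u ^ k - MLF c (Cexp u)) <= Cb + 1 + 1).
    { replace (Cexp u ^ k - MLF c (Cexp u))%C with (- (MLF c (Cexp u) - expexp rho u - Cexp u ^ k) - expexp rho u)%C by ring.
      eapply Rle_trans; [apply Cmod_triangle_minus|]. rewrite Cmod_opp. lra. }
    lra.
  - assert (T := MLF_outer_split c u Hc ltac:(lra) ltac:(lra)). rewrite Cmod_minus_sym in T.
    assert (Y := Cmod_triangle_inv (Cexp u ^ k) (MLF c (Cexp u))). lra.
Qed.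

Lemma Cexp_diff_bounds a (u u' : C) : 0 <= a -> a * Cmod (u - u') <= 1/6 ->
  exp (a * fst u') * (a * Cmod (u - u') / 2) <= Cmod (Cexp (a * u) - Cexp (a * u')) <= exp (a * fst u') * (2 * (a * Cmod (u - u'))).
Proof.
  intros Ha H.
  replace (Cexp (a * u) - Cexp (a * u'))%C with (Cexp (a * u') * (Cexp (a * (u - u')) - 1))%C.
  - rewrite Cmod_mult, Cmod_Cexp.
    replace (fst (a * u')%C) with (a * fst u') by (cbn; ring).
    assert (M : Cmod (a * (u - u')) = a * Cmod (u - u')) by (rewrite Cmod_mult, Cmod_R, Rabs_pos_eq; auto).
    destruct (Cexp_minus_1_bounds (a * (u - u'))%C) as [L1 L2]; [lra|]. rewrite M in *.
    assert (P := exp_pos (a * fst u')). split; apply Rmult_le_compat_l; lra.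
  - replace (Cexp (a * u)) with (Cexp (a * u') * Cexp (a * (u - u')))%C by (rewrite <- Cexp_plus; f_equal; ring). ring.
Qed.

(** At a zero the exponential term is comparable to [|z| ^ k]. A step [D] in the logarithmic
    coordinate changes [z ^ rho] by about [rho W D] with [W = |z| ^ rho], hence the exponential term
    by a multiple of [|z| ^ k W D], while all other terms change by [O (|z| ^ k D)] only. For large
    [W] the exponential wins, and [eta / W] is the scale on which it is still nearly linear.
    Separation of zeros, bounds for the derivative and the distance to the circles all follow from
    this. *)
Lemma MLF_near_zero : exists x0 eta, 2 <= x0 /\ 0 < eta <= 1/6 /\ forall c, Cmod c <= 1 -> forall u u',
  x0 <= fst u' -> Rabs (snd u') <= PI / (2 * rho) -> MLF c (Cexp u') = 0%C ->
  Cmod (u - u') <= eta * exp (- (rho * fst u')) ->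
  Cmod (u - u') * exp (INR k * fst u') <= Cmod (MLF c (Cexp u)) <=
    9 * rho * exp ((INR k + rho) * fst u') * Cmod (u - u').
Proof.
  assert (K1 := kR). assert (HPI := PI_RGT_0).
  (* [L * |z| ^ k] bounds the Lipschitz constant of [F - expexp] in the coordinate [u]; [x2] makes
     the exponential term beat it and still leave the factor 1 of the lower bound. *)
  set (L := 2 * INR k + 2 * Cb).
  assert (HL : 0 < L) by (unfold L; lra).
  destruct (exp_dominates_const (2 * (Cb + 1)) (INR k)) as (x1 & H1 & B1); [lra|].
  destruct (exp_dominates_const (8 * (L + 1)) 1) as (x2 & H2 & B2); [lra|].
  (* The first bound gives [|dw| <= 1/6], the second [k |u - u'| <= 1/6], and the third keeps [u] in
     the sector where [HE3] applies. *)
  set (eta := Rmin (Rmin (1 / (12 * rho)) (1 / (6 * INR k))) (PI / (4 * rho))).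
  assert (He : 0 < eta).
  { unfold eta. repeat apply Rmin_glb_lt; apply Rdiv_lt_0_compat; lra. }
  assert (e1 : eta <= 1 / (12 * rho)) by (unfold eta; eapply Rle_trans; [apply Rmin_l|apply Rmin_l]).
  assert (e2 : eta <= 1 / (6 * INR k)) by (unfold eta; eapply Rle_trans; [apply Rmin_l|apply Rmin_r]).
  assert (e3 : eta <= PI / (4 * rho)) by apply Rmin_r.
  apply Rle_div_r in e1; [|lra]. apply Rle_div_r in e2; [|lra].
  exists (Rmax 2 (Rmax x1 x2)), eta. split; [apply Rmax_l|]. split; [nra|].
  intros c Hc u u' Hu Hv Hz Hd.
  assert (X2 : 2 <= fst u') by (eapply Rle_trans; [apply Rmax_l|apply Hu]).
  assert (Y1 : x1 <= fst u') by (eapply Rle_trans; [eapply Rle_trans; [apply Rmax_l|apply Rmax_r]|apply Hu]).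
  assert (Y2 : x2 <= fst u') by (eapply Rle_trans; [eapply Rle_trans; [apply Rmax_r|apply Rmax_r]|apply Hu]).
  specialize (B1 _ Y1). specialize (B2 _ Y2). rewrite Rmult_1_l in B2.
  set (D := Cmod (u - u')) in *. assert (HD : 0 <= D) by apply Cmod_ge_0.
  set (W := exp (rho * fst u')). assert (PW : 0 < W) by apply exp_pos.
  assert (HW : exp (fst u') <= W) by (apply exp_mono; nra).
  assert (W1 : 1 <= W) by lra.
  rewrite exp_Ropp in Hd. fold W in Hd.
  assert (DW : D * W <= eta).
  { apply Rmult_le_compat_r with (r := W) in Hd; [|lra]. rewrite Rmult_assoc, Rinv_l, Rmult_1_r in Hd; lra. }
  assert (De : D <= eta) by nra.
  assert (Hx : Rabs (fst u - fst u') <= D) by apply (Re_le_Cmod (u - u')%C).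
  assert (Hy : Rabs (snd u - snd u') <= D) by apply (Im_le_Cmod (u - u')%C).
  assert (Ux : 1 <= fst u).
  { apply Rabs_le_between in Hx. assert (eta <= 1) by nra. lra. }
  assert (Q : PI / (2 * rho) + PI / (4 * rho) = 3 * PI / (4 * rho)) by (field; lra).
  assert (Uv : Rabs (snd u) <= 3 * PI / (4 * rho)).
  { replace (snd u) with (snd u' + (snd u - snd u')) by ring.
    eapply Rle_trans; [apply Rabs_triang|]. lra. }
  assert (Uv' : Rabs (snd u') <= 3 * PI / (4 * rho)).
  { assert (0 < PI / (4 * rho)) by (apply Rdiv_lt_0_compat; lra). lra. }
  set (Kx := exp (INR k * fst u')) in *. assert (PK : 0 < Kx) by apply exp_pos.
  assert (S : Kx / 2 <= Cmod (expexp rho u') <= 2 * Kx).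
  { assert (T := MLF_inner_split c u' Hc ltac:(lra) Uv'). rewrite Hz in T.
    assert (M := Cmod_pow_Cexp u'). fold Kx in M.
    replace (0 - expexp rho u' - Cexp u' ^ k)%C with (- (expexp rho u' - - (Cexp u' ^ k)))%C in T by ring.
    rewrite Cmod_opp in T.
    assert (A1 := Cmod_triangle_inv (expexp rho u') (- (Cexp u' ^ k))).
    assert (A2 := Cmod_triangle_inv (- (Cexp u' ^ k)) (expexp rho u')).
    rewrite Cmod_minus_sym in A2. rewrite Cmod_opp, M in *. lra. }
  destruct (Cexp_diff_bounds rho u u') as [V1 V2]; [lra|fold D; nra|]. fold D W in V1, V2.
  set (dw := (Cexp (rho * u) - Cexp (rho * u'))%C) in *.
  assert (Hdw : Cmod dw <= 1/6).
  { eapply Rle_trans; [apply V2|]. nra. }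
  assert (Edw : (expexp rho u - expexp rho u')%C = (expexp rho u' * (Cexp dw - 1))%C).
  { unfold expexp, dw. rewrite Cexp_minus. field. apply Cexp_nz. }
  destruct (Cexp_minus_1_bounds dw Hdw) as [T1 T2].
  assert (G : Cmod ((MLF c (Cexp u) - expexp rho u) - (MLF c (Cexp u') - expexp rho u')) <= L * Kx * D).
  { unfold MLF.
    replace (E (Cexp u) + Cexp u ^ k + c - expexp rho u - (E (Cexp u') + Cexp u' ^ k + c - expexp rho u'))%C
      with ((E (Cexp u) - expexp rho u - (E (Cexp u') - expexp rho u')) + (Cexp u ^ k - Cexp u' ^ k))%C by ring.
    eapply Rle_trans; [apply Cmod_triangle|].
    assert (J := HE3 u u' Ux Uv ltac:(lra) Uv').
    destruct (Cexp_diff_bounds 1 u u') as [_ V3]; [lra|fold D; nra|].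
    rewrite !Cmult_1_l, !Rmult_1_l in V3. fold D in V3.
    destruct (Cexp_diff_bounds (INR k) u u') as [_ V4]; [lra|fold D; nra|]. fold D Kx in V4.
    rewrite !Cexp_pow.
    assert (KK : exp (fst u') <= Kx) by (apply exp_mono; nra).
    assert (Cb * Cmod (Cexp u - Cexp u') <= Cb * (Kx * (2 * D))).
    { apply Rmult_le_compat_l; [lra|]. eapply Rle_trans; [apply V3|]. apply Rmult_le_compat_r; lra. }
    unfold L. lra. }
  rewrite Hz in G.
  assert (Fe : MLF c (Cexp u) = ((expexp rho u - expexp rho u') + (MLF c (Cexp u) - expexp rho u - (0 - expexp rho u')))%C) by ring.
  assert (N1 : Cmod (expexp rho u - expexp rho u') = Cmod (expexp rho u') * Cmod (Cexp dw - 1)) by (rewrite Edw; apply Cmod_mult).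
  assert (PD : 0 <= Kx * D) by nra.
  split.
  - assert (A := Cmod_triangle_inv (expexp rho u - expexp rho u') (- (MLF c (Cexp u) - expexp rho u - (0 - expexp rho u')))).
    replace (expexp rho u - expexp rho u' - - (MLF c (Cexp u) - expexp rho u - (0 - expexp rho u')))%C with (MLF c (Cexp u)) in A by ring.
    rewrite Cmod_opp, N1 in A.
    assert (Lw : Kx / 2 * (W * (rho * D / 4)) <= Cmod (expexp rho u') * Cmod (Cexp dw - 1)).
    { apply Rmult_le_compat; try lra. }
    assert (Z : (L + 1) * (Kx * D) <= Kx / 2 * (W * (rho * D / 4))).
    { replace (Kx / 2 * (W * (rho * D / 4))) with (W * rho / 8 * (Kx * D)) by field.
      apply Rmult_le_compat_r; auto. nra. }
    lra.
  - rewrite Fe. eapply Rle_trans; [apply Cmod_triangle|]. rewrite N1.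
    assert (Up : Cmod (expexp rho u') * Cmod (Cexp dw - 1) <= 2 * Kx * (2 * (W * (2 * (rho * D))))).
    { apply Rmult_le_compat; try apply Cmod_ge_0; lra. }
    assert (EK : exp ((INR k + rho) * fst u') = Kx * W).
    { unfold Kx, W. rewrite <- exp_plus. f_equal. ring. }
    rewrite EK.
    assert (Z : L * (Kx * D) <= W * rho * (Kx * D)).
    { apply Rmult_le_compat_r; auto. nra. }
    lra.
Qed.

(** On the circle of radius [R], at [arg z = PI / (2 rho)], the number [exp (z ^ rho)] has argument
    [R ^ rho] and [z ^ k] has argument [k PI / (2 rho)]. These radii make the two agree modulo
    [2 PI], and by symmetry also at the opposite edge. *)
Definition log_radius (m : nat) : R := ln (INR k * PI / (2 * rho) + 2 * PI * INR m) / rho.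

Lemma exp_rho_log_radius m : exp (rho * log_radius m) = INR k * PI / (2 * rho) + 2 * PI * INR m.
Proof.
  unfold log_radius. replace (rho * (ln (INR k * PI / (2 * rho) + 2 * PI * INR m) / rho))
    with (ln (INR k * PI / (2 * rho) + 2 * PI * INR m)) by (field; lra).
  apply exp_ln. generalize PI_RGT_0 (pos_INR m) kR. intros.
  assert (0 < INR k * PI / (2 * rho)) by (apply Rdiv_lt_0_compat; nra). nra.
Qed.

Lemma log_radius_unbounded X : exists N, forall m, (N <= m)%nat -> X <= log_radius m.
Proof.
  destruct (INR_unbounded (exp (rho * X))) as [N HN]. exists N. intros m Hm.
  apply Rmult_le_reg_l with rho; [lra|]. apply Rnot_lt_le. intros H.
  apply exp_increasing in H. rewrite exp_rho_log_radius in H.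
  assert (INR N <= INR m) by now apply le_INR.
  generalize PI2_3_2 (pos_INR m) kR. intros.
  assert (0 < INR k * PI / (2 * rho)) by (apply Rdiv_lt_0_compat; nra). nra.
Qed.

(* On the critical part of the circle both terms of [expexp rho u + Cexp u ^ k] have
   comparable moduli; the radius is chosen so that their arguments agree there. *)
Lemma expexp_plus_power_on_circle : exists x0, 1 <= x0 /\ forall m v, x0 <= log_radius m ->
  Rabs v <= PI / (2 * rho) ->
  3 / 4 * exp (INR k * log_radius m) <= Cmod (expexp rho (log_radius m, v) + Cexp (log_radius m, v) ^ k).
Proof.
  assert (K1 := kR). assert (HPI := PI_RGT_0).
  (* Chosen so that [b ^ 2 + 2 k b <= W] for the [b] below; this bounds the phase error by 1. *)
  set (A := (INR k + 2) * (INR k + 2) + 2 * INR k * (INR k + 2)).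
  destruct (exp_dominates_quadratic A 1) as (x0 & H0 & B); [lra|].
  exists x0. split; auto. intros m v Hm Hv. specialize (B _ Hm). rewrite Rmult_1_l in B.
  set (x := log_radius m) in *. set (W := exp (rho * x)). set (Kx := exp (INR k * x)).
  assert (PW : 0 < W) by apply exp_pos. assert (PK : 0 < Kx) by apply exp_pos.
  assert (HW : A * (1 + x) ^ 2 <= W).
  { eapply Rle_trans; [apply B|]. apply exp_mono. nra. }
  assert (EW : W = INR k * PI / (2 * rho) + 2 * PI * INR m) by apply exp_rho_log_radius.
  set (h := expexp rho (x, v)). set (p := (Cexp (x, v) ^ k)%C).
  assert (Mh : Cmod h = exp (W * cos (rho * v))) by apply Cmod_expexp.
  assert (Mp : Cmod p = Kx) by apply (Cmod_pow_Cexp (x, v)).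
  (* Unless [Kx / 4 < |h| < 4 Kx], the triangle inequality already suffices. *)
  destruct (Rle_dec (Cmod h) (Kx / 4)) as [L1|L1].
  { generalize (Cmod_triangle_inv p (- h)). replace (p - - h)%C with (h + p)%C by ring. rewrite Cmod_opp. lra. }
  destruct (Rle_dec (4 * Kx) (Cmod h)) as [L2|L2].
  { generalize (Cmod_triangle_inv h (- p)). replace (h - - p)%C with (h + p)%C by ring. rewrite Cmod_opp. lra. }
  set (a := Rabs v) in *. assert (Pa : 0 <= a) by apply Rabs_pos.
  (* [psi] measures the distance to the edge of the sector. Comparable moduli force
     [W sin psi <= k x + 2], so [psi] is at most of order [x / W]. *)
  set (psi := PI / 2 - rho * a).
  assert (Hra : rho * a <= PI / 2).
  { replace (PI / 2) with (rho * (PI / (2 * rho))) by (field; lra). apply Rmult_le_compat_l; lra. }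
  assert (Hpsi : 0 <= psi <= PI / 2) by (unfold psi; nra).
  set (s := sin psi). set (q := cos psi).
  assert (Ps : 0 <= s) by (apply sin_ge_0; lra). assert (Pq : 0 <= q <= 1) by (split; [apply cos_ge_0; lra|apply COS_bound]).
  assert (T : s * s + q * q = 1) by (unfold s, q; generalize (sin2_cos2 psi); unfold Rsqr; lra).
  assert (Ec : cos (rho * v) = s).
  { unfold s, psi. rewrite sin_shift. unfold a. now rewrite cos_mult_Rabs. }
  assert (Es : sin (rho * a) = q).
  { unfold q, psi. now rewrite cos_shift. }
  assert (Hs : W * s <= INR k * x + 2).
  { apply Rnot_lt_le. intros K. apply L2. rewrite Mh, Ec. left.
    apply Rle_lt_trans with (exp (INR k * x + 2)); [|now apply exp_increasing].
    rewrite exp_plus. fold Kx. rewrite Rmult_comm. apply Rmult_le_compat_l; [lra|].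
    replace 2 with (1 + 1) by ring. rewrite exp_plus. assert (2 <= exp 1) by (generalize (exp_ineq1_le 1); lra). nra. }
  assert (Hx : 1 <= x) by lra.
  assert (Hk2 : INR k * x + 2 <= (INR k + 2) * (1 + x)) by nra.
  set (b := (INR k + 2) * (1 + x)) in *.
  assert (Hb : 1 <= b) by (unfold b; nra).
  assert (HA : b * b + 2 * INR k * b <= W).
  { eapply Rle_trans; [|apply HW]. unfold A, b.
    replace (((INR k + 2) * (INR k + 2) + 2 * INR k * (INR k + 2)) * (1 + x) ^ 2)
      with ((INR k + 2) * (1 + x) * ((INR k + 2) * (1 + x)) + 2 * INR k * ((INR k + 2) * (1 + x)) * (1 + x)) by ring.
    assert (Pz : 0 <= 2 * INR k * ((INR k + 2) * (1 + x))) by (repeat apply Rmult_le_pos; lra).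
    apply Rplus_le_compat_l. rewrite <- (Rmult_1_r (2 * INR k * ((INR k + 2) * (1 + x)))) at 1.
    apply Rmult_le_compat_l; lra. }
  assert (Hbk : 2 * b <= W) by nra.
  assert (s12 : s <= 1/2).
  { apply Rmult_le_reg_l with W; auto. lra. }
  assert (q12 : 1/2 <= q) by nra.
  assert (psi2 : psi <= 2 * s).
  { assert (M := mult_cos_le_sin psi Hpsi). fold s q in M. nra. }
  assert (q1 : 1 - q <= s * s) by nra.
  (* Up to sign this is the phase difference of [h] and [p]. It differs from [2 PI m] by two errors,
     bounded by [b ^ 2 / W] and [2 k b / W]. *)
  set (th := W * q - INR k * a).
  assert (Eth : th = - (W * (1 - q)) + INR k * psi / rho + 2 * INR m * PI).
  { unfold th. replace a with ((PI / 2 - psi) / rho) by (unfold psi; field; lra).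
    replace (W * q) with (- (W * (1 - q)) + W) by ring. rewrite EW at 2. field. lra. }
  assert (Bth : Rabs (- (W * (1 - q)) + INR k * psi / rho) <= 1).
  { assert (X1 : 0 <= W * (1 - q)) by nra.
    assert (Pws : 0 <= W * s) by (apply Rmult_le_pos; lra).
    assert (X2 : W * (1 - q) <= b * b / W).
    { apply -> Rle_div_r; [|exact PW]. assert (W * (1 - q) * W <= W * (s * s) * W) by (apply Rmult_le_compat_r; [lra|]; apply Rmult_le_compat_l; lra).
      assert ((W * s) * (W * s) <= b * b) by (apply Rmult_le_compat; lra). lra. }
    assert (X3 : 0 <= INR k * psi / rho) by (apply Rdiv_le_0_compat; nra).
    assert (X4 : INR k * psi / rho <= 2 * INR k * b / W).
    { apply Rle_trans with (INR k * psi).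
      - apply Rle_div_l; [lra|]. assert (0 <= INR k * psi) by nra. nra.
      - apply -> Rle_div_r; [|exact PW]. assert (W * psi <= W * (2 * s)) by (apply Rmult_le_compat_l; lra).
        replace (INR k * psi * W) with (INR k * (W * psi)) by ring.
        replace (2 * INR k * b) with (INR k * (2 * b)) by ring. apply Rmult_le_compat_l; lra. }
    assert (X5 : b * b / W + 2 * INR k * b / W <= 1).
    { replace (b * b / W + 2 * INR k * b / W) with ((b * b + 2 * INR k * b) / W) by (field; lra).
      apply Rle_div_l; lra. }
    assert (0 <= b * b / W) by (apply Rdiv_le_0_compat; nra).
    assert (0 <= 2 * INR k * b / W) by (apply Rdiv_le_0_compat; nra).
    apply Rabs_le. lra. }
  assert (Cth : 0 <= cos th).
  { rewrite Eth, cos_period. apply Rabs_le_between in Bth. generalize PI2_3_2. intros. apply cos_ge_0; lra. }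
  assert (Cv : cos (W * sin (rho * v) - INR k * v) = cos th).
  { unfold th. rewrite <- Es. unfold a, Rabs. destruct (Rcase_abs v); auto.
    rewrite <- cos_neg. f_equal. replace (rho * - v) with (- (rho * v)) by ring. rewrite sin_neg. ring. }
  (* As [cos th >= 0], the two vectors cannot cancel and [|h + p| >= |p|]. *)
  assert (Sq : Kx * Kx <= Cmod (h + p) * Cmod (h + p)).
  { assert (Eh : h = (exp (W * s) * cos (W * sin (rho * v)), exp (W * s) * sin (W * sin (rho * v)))).
    { unfold h, expexp. unfold Cexp at 2. unfold Cexp, Cmult, RtoC; cbn [fst snd].
      replace (rho * x - 0 * v) with (rho * x) by ring. replace (rho * v + 0 * x) with (rho * v) by ring.
      fold W. rewrite Ec. reflexivity. }
    assert (Ep : p = (Kx * cos (INR k * v), Kx * sin (INR k * v))).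
    { unfold p. rewrite Cexp_pow. unfold Cexp, Cmult, RtoC; cbn [fst snd].
      replace (INR k * x - 0 * v) with (INR k * x) by ring. replace (INR k * v + 0 * x) with (INR k * v) by ring. reflexivity. }
    rewrite Cmod_sqr, Eh, Ep. cbn [fst snd Cplus]. set (H := exp (W * s)). assert (PH : 0 < H) by apply exp_pos.
    set (f := W * sin (rho * v)) in *. set (g := INR k * v) in *.
    rewrite cos_minus in Cv.
    assert (T1 := sin2_cos2 f). assert (T2 := sin2_cos2 g). unfold Rsqr in T1, T2.
    replace ((H * cos f + Kx * cos g) * (H * cos f + Kx * cos g) + (H * sin f + Kx * sin g) * (H * sin f + Kx * sin g))
      with (H * H * (sin f * sin f + cos f * cos f) + Kx * Kx * (sin g * sin g + cos g * cos g) + 2 * H * Kx * (cos f * cos g + sin f * sin g)) by ring.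
    rewrite T1, T2, Cv. assert (0 <= 2 * H * Kx * cos th) by (repeat apply Rmult_le_pos; lra). nra. }
  assert (Kx <= Cmod (h + p)); [|lra].
  apply Rsqr_incr_0_var; [exact Sq|apply Cmod_ge_0].
Qed.

Lemma MLF_circle : exists x0, 1 <= x0 /\ forall c, Cmod c <= 1 -> forall m z, x0 <= log_radius m ->
  Cmod z = exp (log_radius m) -> exp (INR k * log_radius m) / 2 <= Cmod (MLF c z).
Proof.
  destruct MLF_outside as (x1 & H1 & O). destruct expexp_plus_power_on_circle as (x2 & H2 & B).
  destruct (exp_dominates_const (4 * (Cb + 1)) (INR k)) as (x3 & H3 & D); [generalize kR; lra|].
  exists (Rmax x1 (Rmax x2 x3)).
  split; [eapply Rle_trans; [apply H1|apply Rmax_l]|].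
  intros c Hc m z Hm Hz.
  assert (Y1 : x1 <= log_radius m) by (eapply Rle_trans; [apply Rmax_l|apply Hm]).
  assert (Y2 : x2 <= log_radius m) by (eapply Rle_trans; [eapply Rle_trans; [apply Rmax_l|apply Rmax_r]|apply Hm]).
  assert (Y3 : x3 <= log_radius m) by (eapply Rle_trans; [eapply Rle_trans; [apply Rmax_r|apply Rmax_r]|apply Hm]).
  assert (Nz : z <> 0%C). { apply Cmod_gt_0. rewrite Hz. apply exp_pos. }
  destruct (Cexp_polar_exists z Nz) as ((x & v) & Ez & Hv). cbn [snd] in Hv.
  assert (Ex : x = log_radius m).
  { apply exp_inv. rewrite <- Hz, <- Ez, Cmod_Cexp. reflexivity. }
  subst x. rewrite <- Ez.
  assert (Hv' : Rabs v <= PI) by (apply Rabs_le; lra).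
  destruct (Rle_dec (PI / (2 * rho)) (Rabs v)) as [L|L].
  - apply (O c Hc (log_radius m, v)); cbn [fst snd]; auto.
  - specialize (B m v Y2 ltac:(lra)). specialize (D _ Y3).
    assert (HPI := PI_RGT_0).
    assert (Q : PI / (2 * rho) <= 3 * PI / (4 * rho)).
    { replace (3 * PI / (4 * rho)) with (PI / (2 * rho) + PI / (4 * rho)) by (field; lra).
      assert (0 < PI / (4 * rho)) by (apply Rdiv_lt_0_compat; lra). lra. }
    assert (T := MLF_inner_split c (log_radius m, v) Hc ltac:(cbn; lra) ltac:(cbn; lra)).
    set (F := MLF c (Cexp (log_radius m, v))) in *.
    assert (A := Cmod_triangle_inv (expexp rho (log_radius m, v) + Cexp (log_radius m, v) ^ k) F).
    rewrite Cmod_minus_sym in A.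
    replace (F - (expexp rho (log_radius m, v) + Cexp (log_radius m, v) ^ k))%C
      with (F - expexp rho (log_radius m, v) - Cexp (log_radius m, v) ^ k)%C in A by ring.
    lra.
Qed.

Lemma MLF_zero_location : exists x0, 1 <= x0 /\ forall c, Cmod c <= 1 -> forall t, exp x0 <= Cmod t ->
  MLF c t = 0%C -> exists u, Cexp u = t /\ x0 <= fst u /\ Rabs (snd u) < PI / (2 * rho).
Proof.
  destruct MLF_outside as (x0 & H0 & O). exists x0. split; auto. intros c Hc t Ht Hz.
  assert (Nz : t <> 0%C). { apply Cmod_gt_0. generalize (exp_pos x0); lra. }
  destruct (Cexp_polar_exists t Nz) as (u & Eu & Hu). exists u. split; auto.
  assert (Hx : x0 <= fst u).
  { rewrite <- Eu, Cmod_Cexp in Ht. apply Rnot_lt_le. intros L. apply exp_increasing in L. lra. }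
  split; auto. apply Rnot_le_lt. intros L.
  assert (A := O c Hc u Hx (conj L (Rabs_le _ _ Hu))). rewrite Eu, Hz, Cmod_0 in A.
  generalize (exp_pos (INR k * fst u)). lra.
Qed.

(** For a small real increment [h] of the logarithm, [MLF_near_zero] gives [|F| >= h |t| ^ k], while
    the point moves by at most [2 h |t|]. The quotient bounds the derivative. *)
Lemma MLF_zero_deriv : exists x0, 1 <= x0 /\ forall c, Cmod c <= 1 -> forall t l, exp x0 <= Cmod t ->
  MLF c t = 0%C -> cderiv (MLF c) t l -> Cmod t ^ (k - 1) / 2 <= Cmod l.
Proof.
  destruct MLF_zero_location as (x1 & H1 & Loc). destruct MLF_near_zero as (x2 & eta & H2 & Heta & Near).
  exists (Rmax x1 x2). split; [eapply Rle_trans; [apply H1|apply Rmax_l]|].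
  intros c Hc t l Ht Hz Hl.
  assert (T1 : exp x1 <= Cmod t) by (eapply Rle_trans; [apply exp_mono, Rmax_l|apply Ht]).
  assert (T2 : exp x2 <= Cmod t) by (eapply Rle_trans; [apply exp_mono, Rmax_r|apply Ht]).
  destruct (Loc c Hc t T1 Hz) as (u & Eu & Hx & Hv).
  assert (Hx2 : x2 <= fst u).
  { rewrite <- Eu, Cmod_Cexp in T2. apply Rnot_lt_le. intros L. apply exp_increasing in L. lra. }
  assert (Mt : Cmod t = exp (fst u)) by (rewrite <- Eu; apply Cmod_Cexp).
  assert (Pt : 0 < Cmod t) by (rewrite Mt; apply exp_pos).
  assert (EK : exp (INR k * fst u) = Cmod t ^ (k - 1) * Cmod t).
  { rewrite <- exp_pow_nat, <- Mt. replace k with (S (k - 1)) at 1 by lia. simpl. ring. }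
  set (T := Cmod t ^ (k - 1)) in *.
  apply le_epsilon. intros e He. destruct (Hl e He) as (d & Hd & B).
  (* The first bound is the range of [MLF_near_zero]; the second gives
     [|Cexp u1 - t| <= 2 h |t| < d]. *)
  set (h := Rmin (eta * exp (- (rho * fst u))) (d / (4 * Cmod t))).
  assert (Hh : 0 < h).
  { unfold h. apply Rmin_glb_lt; [apply Rmult_lt_0_compat; [lra|apply exp_pos]|apply Rdiv_lt_0_compat; lra]. }
  assert (h1 : h <= eta * exp (- (rho * fst u))) by apply Rmin_l.
  assert (h2 : h <= d / (4 * Cmod t)) by apply Rmin_r.
  apply Rle_div_r in h2; [|lra].
  assert (h3 : h <= 1/6).
  { eapply Rle_trans; [apply h1|].
    assert (exp (- (rho * fst u)) <= 1) by (rewrite <- exp_0; apply exp_mono; nra).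
    generalize (exp_pos (- (rho * fst u))). nra. }
  set (u1 := (u + h)%C).
  assert (D : Cmod (u1 - u) = h).
  { unfold u1. replace (u + h - u)%C with (RtoC h) by ring. rewrite Cmod_R, Rabs_pos_eq; lra. }
  destruct (Near c Hc u1 u Hx2 ltac:(lra)) as [N1 _]; [now rewrite Eu|now rewrite D|].
  rewrite D, EK in N1.
  destruct (Cexp_diff_bounds 1 u1 u) as [V1 V2]; [lra|rewrite D; lra|].
  rewrite !Cmult_1_l, !Rmult_1_l, D, <- Mt, Eu in V1, V2.
  specialize (B (Cexp u1)). rewrite Hz in B.
  set (y := Cmod (Cexp u1 - t)) in *.
  assert (Hy : y < d) by nra. specialize (B Hy).
  assert (Py : 0 < y) by nra.
  assert (A : Cmod (MLF c (Cexp u1)) <= (Cmod l + e) * y).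
  { replace (MLF c (Cexp u1)) with ((MLF c (Cexp u1) - 0 - l * (Cexp u1 - t)) + l * (Cexp u1 - t))%C by ring.
    eapply Rle_trans; [apply Cmod_triangle|]. rewrite Cmod_mult. fold y. lra. }
  assert (PT : 0 < T) by now apply pow_lt.
  apply Rmult_le_reg_r with y; auto.
  apply Rle_trans with (h * (T * Cmod t)); [|lra]. nra.
Qed.

(** The floor of [x / s]; the value 0 on negative quotients is a default. *)
Definition grid_index (s x : R) : nat := match Rle_dec 0 (x / s) with
  | left h => proj1_sig (nfloor_ex (x / s) h) | right _ => O end.

Lemma grid_index_spec s x : 0 < s -> 0 <= x -> INR (grid_index s x) * s <= x < (INR (grid_index s x) + 1) * s.
Proof.
  intros Hs Hx. unfold grid_index. destruct (Rle_dec 0 (x / s)) as [h|h].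
  - destruct (nfloor_ex (x / s) h) as [n [H1 H2]]. cbn [proj1_sig]. split.
    + now apply Rle_div_r.
    + now apply Rlt_div_l.
  - elim h. now apply Rdiv_le_0_compat.
Qed.

Lemma NoDup_map_inj {A B : Type} (g : A -> B) (l : list A) :
  (forall x y, In x l -> In y l -> g x = g y -> x = y) -> NoDup l -> NoDup (map g l).
Proof.
  induction l as [|a l IH]; intros Hg H; cbn; [constructor|]. inversion H; subst. constructor.
  - intros I. apply in_map_iff in I. destruct I as (x & Ex & Ix).
    assert (x = a) by (apply Hg; auto; [now right|now left]). now subst.
  - apply IH; auto. intros; apply Hg; auto; now right.
Qed.

(** In the logarithmic coordinate, two zeros in one grid cell of side [s] are within the range of
    [MLF_near_zero], whose lower bound forces them to coincide. About [X / s] cells in each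
    direction, with [X] absorbed by [exp X], give the exponent [2 (rho + 1)]. *)
Lemma MLF_zero_count : exists x0 K, 1 <= x0 /\ 0 < K /\ forall c, Cmod c <= 1 -> forall X l, x0 <= X -> NoDup l ->
  (forall z, In z l -> MLF c z = 0%C /\ exp x0 <= Cmod z <= exp X) ->
  INR (length l) <= K * exp ((2 * rho + 2) * X).
Proof.
  destruct MLF_zero_location as (x1 & H1 & Loc). destruct MLF_near_zero as (x2 & eta & H2 & Heta & Near).
  set (x0 := Rmax x1 x2).
  exists x0, ((60 / eta) * (60 / eta)).
  assert (H0 : 2 <= x0) by (eapply Rle_trans; [apply H2|apply Rmax_r]).
  split; [lra|]. split; [apply Rmult_lt_0_compat; apply Rdiv_lt_0_compat; lra|].
  intros c Hc X l HX HN Hl.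
  set (s := eta / 2 * exp (- (rho * X))).
  assert (Hs : 0 < s) by (apply Rmult_lt_0_compat; [lra|apply exp_pos]).
  assert (HPI : 3 < PI <= 4) by (split; [generalize PI2_3_2; lra|apply PI_4]).
  assert (Z : forall z, In z l -> exists u, Cexp u = z /\ x0 <= fst u <= X /\ Rabs (snd u) < PI / (2 * rho)).
  { intros z Iz. destruct (Hl z Iz) as (Fz & Z1 & Z2).
    destruct (Loc c Hc z) as (u & Eu & Hx & Hv); auto.
    { eapply Rle_trans; [apply exp_mono, (Rmax_l x1 x2)|auto]. }
    exists u. split; auto. rewrite <- Eu, Cmod_Cexp in Z1, Z2. split; auto.
    split; apply Rnot_lt_le; intros L; apply exp_increasing in L; lra. }
  set (P := fun z u => Cexp u = z /\ x0 <= fst u <= X /\ Rabs (snd u) < PI / (2 * rho)).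
  set (lg := fun z => epsilon (inhabits (RtoC 0)) (P z)).
  assert (Hlg : forall z, In z l -> P z (lg z)) by (intros z Iz; apply epsilon_spec; now apply Z).
  assert (Hpr : PI / (2 * rho) <= 2) by (apply Rle_div_l; lra).
  (* The shift by 4 makes the second coordinate positive, since
     [|snd (lg z)| < PI / (2 rho) <= 2]. *)
  set (g := fun z => (grid_index s (fst (lg z)), grid_index s (snd (lg z) + 4))).
  assert (Inj : forall z w, In z l -> In w l -> g z = g w -> z = w).
  { intros z w Iz Iw E0. unfold g in E0. injection E0 as E1 E2.
    destruct (Hlg z Iz) as (Ez & Xz & Vz). destruct (Hlg w Iw) as (Ew & Xw & Vw).
    apply Rabs_def2 in Vz as Vz'. apply Rabs_def2 in Vw as Vw'.
    assert (A1 := grid_index_spec s (fst (lg z)) Hs ltac:(lra)). assert (A2 := grid_index_spec s (fst (lg w)) Hs ltac:(lra)).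
    assert (A3 := grid_index_spec s (snd (lg z) + 4) Hs ltac:(lra)). assert (A4 := grid_index_spec s (snd (lg w) + 4) Hs ltac:(lra)).
    rewrite E1 in A1. rewrite E2 in A3.
    assert (D : Cmod (lg z - lg w) <= eta * exp (- (rho * fst (lg w)))).
    { eapply Rle_trans; [apply Cmod_le_abs|]. cbn [fst snd Cminus Cplus Copp].
      assert (Rabs (fst (lg z) + - fst (lg w)) <= s) by (apply Rabs_le; lra).
      assert (Rabs (snd (lg z) + - snd (lg w)) <= s) by (apply Rabs_le; lra).
      assert (exp (- (rho * X)) <= exp (- (rho * fst (lg w)))) by (apply exp_mono; nra).
      assert (2 * s <= eta * exp (- (rho * fst (lg w)))).
      { replace (2 * s) with (eta * exp (- (rho * X))) by (unfold s; field). apply Rmult_le_compat_l; lra. }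
      lra. }
    destruct (Near c Hc (lg z) (lg w)) as [N1 _]; auto; try lra.
    { eapply Rle_trans; [apply (Rmax_r x1 x2)|apply Xw]. }
    { rewrite Ew. now apply Hl. }
    rewrite Ez in N1. rewrite (proj1 (Hl z Iz)), Cmod_0 in N1.
    assert (PK := exp_pos (INR k * fst (lg w))). assert (PD := Cmod_ge_0 (lg z - lg w)).
    assert (Cmod (lg z - lg w) = 0) by nra.
    rewrite <- Ez, <- Ew. f_equal. apply Ceq_minus. now apply Cmod_eq_0. }
  (* [X + 8] exceeds both coordinates, which are at most [X] and 6. *)
  set (M := S (grid_index s (X + 8))).
  assert (Gm : forall x y, 0 <= x <= y -> (grid_index s x <= grid_index s y)%nat).
  { intros x y Hxy. assert (A1 := grid_index_spec s x Hs ltac:(lra)). assert (A2 := grid_index_spec s y Hs ltac:(lra)).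
    apply Nat.lt_succ_r. apply INR_lt. rewrite S_INR. apply Rmult_lt_reg_r with s; lra. }
  assert (Len : (length l <= M * M)%nat).
  { rewrite <- (length_map g l). rewrite <- (length_seq M 0) at 1. rewrite <- (length_seq M 0) at 2. rewrite <- length_prod.
    apply NoDup_incl_length; [now apply NoDup_map_inj|].
    intros q Iq. apply in_map_iff in Iq. destruct Iq as (z & <- & Iz).
    destruct (Hlg z Iz) as (_ & Xz & Vz). apply Rabs_def2 in Vz.
    apply in_prod; apply in_seq; unfold M; split; try lia; apply Nat.lt_succ_r, Gm; lra. }
  assert (HM : INR M <= 60 / eta * exp ((rho + 1) * X)).
  { assert (A := grid_index_spec s (X + 8) Hs ltac:(lra)). unfold M. rewrite S_INR.
    apply Rmult_le_reg_r with s; auto.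
    apply Rle_trans with (X + 9).
    - assert (s <= 1). { unfold s. assert (exp (- (rho * X)) <= 1) by (rewrite <- exp_0; apply exp_mono; nra). generalize (exp_pos (- (rho * X))). nra. }
      lra.
    - replace (60 / eta * exp ((rho + 1) * X) * s) with (30 * exp X).
      + assert (1 + X <= exp X) by apply exp_ineq1_le. lra.
      + unfold s. replace ((rho + 1) * X) with (rho * X + X) by ring. rewrite exp_plus, exp_Ropp.
        field. generalize (exp_pos (rho * X)); split; lra. }
  apply le_INR in Len. rewrite mult_INR in Len. eapply Rle_trans; [apply Len|].
  replace ((2 * rho + 2) * X) with ((rho + 1) * X + (rho + 1) * X) by ring. rewrite exp_plus.
  replace (60 / eta * (60 / eta) * (exp ((rho + 1) * X) * exp ((rho + 1) * X)))
    with ((60 / eta * exp ((rho + 1) * X)) * (60 / eta * exp ((rho + 1) * X))) by ring.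
  apply Rmult_le_compat; auto; apply pos_INR.
Qed.

(** On the circle [|F z| >= |z| ^ k / 2]. A zero closer to [z] than [mu |t| / |t| ^ rho] would force
    [|F z| <= |t| ^ k / 4] by the upper bound of [MLF_near_zero]. The power [(1 + |t|) ^ r] absorbs
    [|t| ^ rho]; zeros with [|t| <= |z| / 2] are far from [z] anyway. *)
Lemma MLF_zero_distance r : rho <= INR r -> exists x0 K, 1 <= x0 /\ 0 < K /\ forall c, Cmod c <= 1 ->
  forall m z t, x0 <= log_radius m -> Cmod z = exp (log_radius m) -> MLF c t = 0%C -> Cmod t <= Cmod z ->
  / Cmod (z - t) <= K * (1 + Cmod t) ^ r / Cmod z.
Proof.
  intros Hr. assert (K1 := kR).
  destruct MLF_zero_location as (x1 & H1 & Loc). destruct MLF_near_zero as (x2 & eta & H2 & Heta & Near).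
  destruct MLF_circle as (x3 & H3 & Cir).
  (* The 6 is the constant of [Cexp_near_1], applied to the logarithm of [z / t]; [216 = 9 * 6 * 4]
     leaves the final bound [1/4]. *)
  set (x4 := Rmax x1 x2). set (mu := Rmin (eta / 6) (1 / (216 * rho))).
  assert (Hmu : 0 < mu).
  { unfold mu. apply Rmin_glb_lt; apply Rdiv_lt_0_compat; lra. }
  assert (mu1 : mu <= eta / 6) by apply Rmin_l. assert (mu2 : mu <= 1 / (216 * rho)) by apply Rmin_r.
  apply Rle_div_r in mu2; [|lra].
  exists (Rmax x3 (x4 + 1)), (2 + 2 / mu). split; [eapply Rle_trans; [apply H3|apply Rmax_l]|].
  assert (H2mu : 0 < 2 / mu) by (apply Rdiv_lt_0_compat; lra).
  split; [lra|]. intros c Hc m z t Hm Hz Ft Htz.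
  assert (Y3 : x3 <= log_radius m) by (eapply Rle_trans; [apply Rmax_l|apply Hm]).
  assert (Y4 : x4 + 1 <= log_radius m) by (eapply Rle_trans; [apply Rmax_r|apply Hm]).
  assert (Fz := Cir c Hc m z Y3 Hz).
  set (R := Cmod z) in *. assert (PR : 0 < R) by (rewrite Hz; apply exp_pos).
  assert (Pt := Cmod_ge_0 t).
  assert (Pp : 1 <= (1 + Cmod t) ^ r) by (apply pow_R1_Rle; lra).
  destruct (Rle_dec (Cmod t) (R / 2)) as [L|L].
  - assert (A := Cmod_triangle_inv z t). fold R in A.
    apply Rle_trans with (/ (R / 2)); [apply Rinv_le_contravar; lra|].
    replace (/ (R / 2)) with (2 / R) by (field; lra).
    unfold Rdiv. apply Rmult_le_compat_r; [left; now apply Rinv_0_lt_compat|]. unfold Rdiv in H2mu. nra.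
  - assert (Ht4 : exp x4 <= Cmod t).
    { assert (exp x4 * 2 <= R).
      { rewrite Hz. apply Rle_trans with (exp (x4 + 1)); [|now apply exp_mono].
        rewrite exp_plus. apply Rmult_le_compat_l; [left; apply exp_pos|]. generalize (exp_ineq1_le 1); lra. }
      lra. }
    destruct (Loc c Hc t) as (u & Eu & Hx & Hv); auto.
    { eapply Rle_trans; [apply exp_mono, (Rmax_l x1 x2)|auto]. }
    assert (Mt : Cmod t = exp (fst u)) by (rewrite <- Eu; apply Cmod_Cexp).
    assert (Hx4 : x4 <= fst u).
    { rewrite Mt in Ht4. apply Rnot_lt_le. intros Q. apply exp_increasing in Q. lra. }
    assert (Hx2 : x2 <= fst u) by (eapply Rle_trans; [apply (Rmax_r x1 x2)|auto]).
    assert (Pt' : 0 < Cmod t) by (rewrite Mt; apply exp_pos).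
    assert (Nt : t <> 0%C) by now apply Cmod_gt_0.
    set (W := exp (rho * fst u)). assert (PW : 0 < W) by apply exp_pos.
    assert (W1 : 1 <= W) by (unfold W; rewrite <- exp_0; apply exp_mono; nra).
    assert (D : mu * Cmod t * / W <= Cmod (z - t)).
    { apply Rnot_lt_le. intros Q.
      set (q := (z / t)%C).
      assert (Q1 : Cmod (q - 1) < mu * / W).
      { replace (q - 1)%C with ((z - t) / t)%C by (unfold q; field; auto).
        rewrite Cmod_div by auto. apply Rlt_div_l; auto. lra. }
      assert (Nz : z <> 0%C) by (apply Cmod_gt_0; exact PR).
      assert (Nq : q <> 0%C).
      { apply Cmod_gt_0. unfold q. rewrite Cmod_div by auto. apply Rdiv_lt_0_compat; auto. }
      destruct (Cexp_polar_exists q Nq) as (tau & Etau & Htau).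
      assert (iW : / W <= 1) by (rewrite <- Rinv_1; apply Rinv_le_contravar; lra).
      assert (iWp : 0 < / W) by now apply Rinv_0_lt_compat.
      assert (Mtau : Cmod tau <= 6 * Cmod (q - 1)).
      { rewrite <- Etau. apply Cexp_near_1; [apply Rabs_le; lra|]. rewrite Etau. nra. }
      assert (Ez : Cexp (u + tau) = z).
      { rewrite Cexp_plus, Eu, Etau. unfold q. field. auto. }
      assert (Du : Cmod (u + tau - u) = Cmod tau) by (f_equal; ring).
      assert (Du2 : Cmod (u + tau - u) <= eta * exp (- (rho * fst u))).
      { rewrite Du, exp_Ropp. fold W. apply Rle_trans with (6 * (mu * / W)); [lra|].
        replace (6 * (mu * / W)) with (6 * mu * / W) by ring. apply Rmult_le_compat_r; lra. }
      destruct (Near c Hc (u + tau)%C u Hx2 ltac:(lra)) as [_ N2]; [now rewrite Eu|auto|].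
      rewrite Ez, Du in N2.
      set (Kt := exp (INR k * fst u)).
      assert (EK : exp ((INR k + rho) * fst u) = Kt * W).
      { unfold Kt, W. rewrite <- exp_plus. f_equal. ring. }
      rewrite EK in N2.
      assert (PK : 0 < Kt) by apply exp_pos.
      assert (KK : Kt <= exp (INR k * log_radius m)).
      { apply exp_mono. apply Rmult_le_compat_l; [lra|]. rewrite Mt, Hz in Htz.
        apply Rnot_lt_le. intros Q2. apply exp_increasing in Q2. lra. }
      assert (9 * rho * (Kt * W) * Cmod tau <= 9 * rho * (Kt * W) * (6 * (mu * / W))).
      { apply Rmult_le_compat_l; [|lra]. repeat apply Rmult_le_pos; lra. }
      replace (9 * rho * (Kt * W) * (6 * (mu * / W))) with (Kt * (mu * (216 * rho)) / 4) in H by (field; lra).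
      assert (Kt * (mu * (216 * rho)) <= Kt * 1) by (apply Rmult_le_compat_l; lra).
      lra. }
    assert (PD : 0 < mu * Cmod t * / W).
    { repeat apply Rmult_lt_0_compat; auto. now apply Rinv_0_lt_compat. }
    apply Rle_trans with (/ (mu * Cmod t * / W)); [now apply Rinv_le_contravar|].
    assert (WP : W <= (1 + Cmod t) ^ r).
    { apply Rle_trans with (Cmod t ^ r); [|apply pow_incr; lra].
      rewrite Mt, exp_pow_nat. apply exp_mono. apply Rmult_le_compat_r; lra. }
    replace (/ (mu * Cmod t * / W)) with (W / mu * / Cmod t) by (field; repeat split; lra).
    apply Rle_trans with (W / mu * (2 / R)).
    + apply Rmult_le_compat_l; [apply Rdiv_le_0_compat; lra|].
      replace (2 / R) with (/ (R / 2)) by (field; lra). apply Rinv_le_contravar; lra.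
    + replace (W / mu * (2 / R)) with (2 / mu * W / R) by (field; split; lra).
      unfold Rdiv at 1 3. apply Rmult_le_compat_r; [left; now apply Rinv_0_lt_compat|].
      apply Rmult_le_compat; lra.
Qed.

(** For large [y] all terms but the exponential one are below [exp (exp (rho y) / 2)], the square
    root of its maximum. This leaves room for both bounds. *)
Lemma MLF_growth : exists y0, 1 <= y0 /\ forall c, Cmod c <= 1 ->
  (forall z y, Cmod z = exp y -> y0 <= y -> Cmod (MLF c z) <= exp (exp (rho * y) + 1)) /\
  (forall y, y0 <= y -> exp (exp (rho * y) / 2) <= Cmod (MLF c (exp y))).
Proof.
  assert (K1 := kR). assert (HPI := PI_RGT_0).
  destruct (exp_dominates_const (Cb + 3) 1) as (y1 & H1 & B1); [lra|].
  destruct (exp_dominates_quadratic (2 * (INR k + 1)) 1) as (y2 & H2 & B2); [lra|].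
  exists (Rmax y1 y2). split; [eapply Rle_trans; [apply H1|apply Rmax_l]|].
  assert (Key : forall y, Rmax y1 y2 <= y -> 1 <= y /\ exp (INR k * y) + Cb + 2 <= exp (exp (rho * y) / 2) /\
     exp (exp (rho * y)) = exp (exp (rho * y) / 2) * exp (exp (rho * y) / 2)).
  { intros y Hy. assert (Y1 : y1 <= y) by (eapply Rle_trans; [apply Rmax_l|apply Hy]).
    assert (Y2 : y2 <= y) by (eapply Rle_trans; [apply Rmax_r|apply Hy]).
    specialize (B1 y Y1). specialize (B2 y Y2). rewrite Rmult_1_l in B1, B2.
    split; [lra|]. split; [|rewrite <- exp_plus; f_equal; field].
    assert (E1 : exp y <= exp (rho * y)) by (apply exp_mono; nra).
    assert (E2 : (INR k + 1) * y <= exp (rho * y) / 2).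
    { assert (2 * (INR k + 1) * y <= 2 * (INR k + 1) * (1 + y) ^ 2); [|lra].
      apply Rmult_le_compat_l; [lra|]. simpl. nra. }
    apply Rle_trans with (exp ((INR k + 1) * y)); [|now apply exp_mono].
    replace ((INR k + 1) * y) with (INR k * y + y) by ring. rewrite exp_plus.
    assert (1 <= exp (INR k * y)) by (rewrite <- exp_0; apply exp_mono; nra). nra. }
  intros c Hc. split.
  - intros z y Hz Hy. destruct (Key y Hy) as (Q1 & Q2 & Q3).
    assert (Nz : z <> 0%C) by (apply Cmod_gt_0; rewrite Hz; apply exp_pos).
    destruct (Cexp_polar_exists z Nz) as ((x & v) & Ez & Hv). cbn [snd] in Hv.
    assert (Ex : x = y). { apply exp_inv. rewrite <- Hz, <- Ez, Cmod_Cexp. reflexivity. }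
    subst x. rewrite <- Ez.
    assert (P := exp_pos (exp (rho * y) / 2)).
    assert (PI0 := exp_pos (INR k * y)).
    assert (U : Cmod (MLF c (Cexp (y, v))) <= exp (exp (rho * y)) + exp (INR k * y) + (Cb + 1)).
    { assert (M := Cmod_pow_Cexp (y, v)). cbn [fst] in M.
      destruct (Rle_dec (Rabs v) (3 * PI / (4 * rho))) as [L|L].
      - assert (T := MLF_inner_split c (y, v) Hc Q1 L).
        replace (MLF c (Cexp (y, v))) with ((MLF c (Cexp (y, v)) - expexp rho (y, v) - Cexp (y, v) ^ k) + (expexp rho (y, v) + Cexp (y, v) ^ k))%C by ring.
        eapply Rle_trans; [apply Cmod_triangle|].
        assert (S := Cmod_triangle (expexp rho (y, v)) (Cexp (y, v) ^ k)). rewrite M, Cmod_expexp in S.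
        assert (exp (exp (rho * y) * cos (rho * v)) <= exp (exp (rho * y))).
        { apply exp_mono. generalize (COS_bound (rho * v)) (exp_pos (rho * y)). nra. }
        lra.
      - assert (T := MLF_outer_split c (y, v) Hc Q1 ltac:(cbn; split; [lra|apply Rabs_le; lra])).
        replace (MLF c (Cexp (y, v))) with ((MLF c (Cexp (y, v)) - Cexp (y, v) ^ k) + Cexp (y, v) ^ k)%C by ring.
        eapply Rle_trans; [apply Cmod_triangle|]. rewrite M. generalize (exp_pos (exp (rho * y))). lra. }
    eapply Rle_trans; [apply U|]. rewrite exp_plus.
    assert (2 <= exp 1) by (generalize (exp_ineq1_le 1); lra). rewrite Q3 in *.
    assert (exp (exp (rho * y) / 2) <= exp (exp (rho * y) / 2) * exp (exp (rho * y) / 2)) by nra. nra.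
  - intros y Hy. destruct (Key y Hy) as (Q1 & Q2 & Q3).
    assert (Ey : RtoC (exp y) = Cexp (y, 0)).
    { unfold Cexp; cbn [fst snd]. rewrite cos_0, sin_0. unfold RtoC. f_equal; ring. }
    rewrite Ey.
    assert (Hv : Rabs 0 <= 3 * PI / (4 * rho)) by (rewrite Rabs_R0; apply Rdiv_le_0_compat; lra).
    assert (T := MLF_inner_split c (y, 0) Hc Q1 Hv).
    assert (M := Cmod_pow_Cexp (y, 0)). cbn [fst] in M.
    assert (X : Cmod (expexp rho (y, 0)) = exp (exp (rho * y))).
    { rewrite Cmod_expexp, Rmult_0_r, cos_0. f_equal; ring. }
    set (Fz := MLF c (Cexp (y, 0))) in *.
    assert (A := Cmod_triangle_inv (expexp rho (y, 0)) (- (Cexp (y, 0) ^ k + (Fz - expexp rho (y, 0) - Cexp (y, 0) ^ k)))).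
    replace (expexp rho (y, 0) - - (Cexp (y, 0) ^ k + (Fz - expexp rho (y, 0) - Cexp (y, 0) ^ k)))%C with Fz in A by ring.
    rewrite Cmod_opp, X in A.
    assert (S := Cmod_triangle (Cexp (y, 0) ^ k) (Fz - expexp rho (y, 0) - Cexp (y, 0) ^ k)). rewrite M in S.
    assert (PK := exp_pos (INR k * y)). rewrite Q3 in A. nra.
Qed.

End Zeros.

(** * Enumeration of the zeros *)

Lemma NoDup_seq_image {A : Type} (s : nat -> A) n : (forall i j, s i = s j -> i = j) -> NoDup (map s (seq 0 n)).
Proof. intros H. apply NoDup_map_inj; [auto|apply seq_NoDup]. Qed.

Lemma injective_escapes {A : Type} (s : nat -> A) (l : list A) : (forall i j, s i = s j -> i = j) ->
  exists j, ~ In (s j) l.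
Proof.
  intros H. apply NNPP. intros N.
  assert (I : incl (map s (seq 0 (S (length l)))) l).
  { intros x Ix. apply in_map_iff in Ix. destruct Ix as (j & <- & _). apply NNPP. intros K. apply N. now exists j. }
  apply NoDup_incl_length in I; [|now apply NoDup_seq_image].
  rewrite length_map, length_seq in I. lia.
Qed.

(** Greedy choice: the next term is an element of least modulus not yet listed. An element never
    reached would bound the moduli of all terms, and an injective sequence would fit into a finite
    list. *)
Lemma enumerate_discrete (Z : C -> Prop) :
  (forall R, exists l, forall z, Cmod z <= R -> Z z -> In z l) -> (forall l, exists z, Z z /\ ~ In z l) ->
  exists t : nat -> C, (forall m n, t m = t n -> m = n) /\ (forall z, Z z <-> exists n, t n = z) /\
    (forall m n, (m <= n)%nat -> Cmod (t m) <= Cmod (t n)).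
Proof.
  intros Hfin Hinf.
  set (nextP := fun l z => Z z /\ ~ In z l /\ forall w, Z w -> ~ In w l -> Cmod z <= Cmod w).
  assert (Hnext : forall l, exists z, nextP l z).
  { intros l. destruct (Hinf l) as (w0 & Zw & Nw). destruct (Hfin (Cmod w0)) as [L HL].
    set (q := fun z => if excluded_middle_informative (Z z /\ ~ In z l) then true else false).
    assert (Hq : forall z, q z = true <-> Z z /\ ~ In z l).
    { intros z. unfold q. destruct (excluded_middle_informative (Z z /\ ~ In z l)); intuition discriminate. }
    assert (Iw : In w0 (filter q L)).
    { apply filter_In. split; [apply HL; auto; lra|now apply Hq]. }
    destruct (list_argmax (fun z => - Cmod z) (filter q L)) as (z & Iz & Mz).
    { intros E. rewrite E in Iw. destruct Iw. }
    apply filter_In in Iz as Iz'. destruct Iz' as [_ Qz]. apply Hq in Qz.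
    exists z. split; [apply Qz|]. split; [apply Qz|]. intros w Zw' Nw'.
    destruct (Rle_dec (Cmod w) (Cmod w0)) as [H|H].
    - assert (Iw' : In w (filter q L)) by (apply filter_In; split; [now apply HL|now apply Hq]).
      specialize (Mz w Iw'). lra.
    - specialize (Mz w0 Iw). lra. }
  set (next := fun l => epsilon (inhabits (RtoC 0)) (nextP l)).
  assert (Nx : forall l, nextP l (next l)) by (intros l; apply epsilon_spec, Hnext).
  set (L := fix L (n : nat) : list C := match n with O => nil | S n => next (L n) :: L n end).
  set (t := fun n => next (L n)).
  assert (InL : forall n z, In z (L n) <-> exists m, (m < n)%nat /\ t m = z).
  { induction n as [|n IH]; intros z; cbn [L].
    - split; [intros []|intros (m & Hm & _); lia].
    - cbn [In]. rewrite IH. split.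
      + intros [<-|(m & Hm & <-)]; [exists n; auto|exists m; auto].
      + intros (m & Hm & <-). destruct (Nat.eq_dec m n) as [->|]; [now left|]. right. exists m. split; auto. lia. }
  assert (Inj : forall m n, (m < n)%nat -> t m <> t n).
  { intros m n H E. destruct (Nx (L n)) as (_ & N & _). apply N. apply InL. now exists m. }
  assert (Srt : forall m n, (m <= n)%nat -> Cmod (t m) <= Cmod (t n)).
  { intros m n H. destruct (Nx (L m)) as (_ & _ & M). apply M; [apply (Nx (L n))|].
    intros I. apply InL in I. destruct I as (j & Hj & E). apply (Inj j n); auto. lia. }
  exists t. split; [|split; auto].
  - intros m n E. destruct (Nat.lt_total m n) as [H|[H|H]]; auto; exfalso.
    + now apply (Inj m n).
    + now apply (Inj n m).
  - intros z. split; [|intros (n & <-); apply (Nx (L n))].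
    intros Zz. apply NNPP. intros N.
    assert (B : forall n, Cmod (t n) <= Cmod z).
    { intros n. apply (Nx (L n)); auto. intros I. apply InL in I. destruct I as (j & _ & E). apply N. now exists j. }
    destruct (Hfin (Cmod z)) as [l Hl].
    destruct (injective_escapes t l) as (j & Hj).
    { intros i j E. destruct (Nat.lt_total i j) as [H|[H|H]]; auto; exfalso;
        [now apply (Inj i j)|now apply (Inj j i)]. }
    apply Hj. apply Hl; auto. apply (Nx (L j)).
Qed.

(** * Sums over the zeros *)

Lemma inv_sqr_telescope n : / (INR n + 1) ^ 2 <= 2 * (/ (INR n + 1) - / (INR n + 2)).
Proof.
  assert (P := pos_INR n).
  replace (2 * (/ (INR n + 1) - / (INR n + 2))) with (2 / ((INR n + 1) * (INR n + 2))) by (field; lra).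
  replace (/ (INR n + 1) ^ 2) with (1 / (INR n + 1) ^ 2) by (field; lra).
  apply Rle_div_l; [apply pow_lt; lra|].
  replace (2 / ((INR n + 1) * (INR n + 2)) * (INR n + 1) ^ 2) with (2 * (INR n + 1) / (INR n + 2)) by (field; lra).
  apply -> Rle_div_r; lra.
Qed.

Lemma bound_all_from_eventually (a : nat -> R) N B : (forall n, (N <= n)%nat -> a n <= B / (INR n + 1) ^ 2) ->
  exists B', 0 < B' /\ forall n, a n <= B' / (INR n + 1) ^ 2.
Proof.
  intros H.
  assert (K : forall m, exists B', 0 < B' /\ forall n, (n < m)%nat \/ (N <= n)%nat -> a n <= B' / (INR n + 1) ^ 2).
  { assert (Q : forall n, 0 < (INR n + 1) ^ 2) by (intros; apply pow_lt; generalize (pos_INR n); lra).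
    assert (Mo : forall n x y, x <= y -> x / (INR n + 1) ^ 2 <= y / (INR n + 1) ^ 2).
    { intros n x y L. apply Rmult_le_compat_r; auto. left. now apply Rinv_0_lt_compat. }
    induction m as [|m (B' & HB' & IH)].
    - exists (Rabs B + 1). split; [generalize (Rabs_pos B); lra|]. intros n [L|L]; [lia|].
      eapply Rle_trans; [now apply H|]. apply Mo. generalize (Rle_abs B); lra.
    - exists (B' + Rabs (a m) * (INR m + 1) ^ 2).
      assert (P : 0 <= Rabs (a m) * (INR m + 1) ^ 2) by (apply Rmult_le_pos; [apply Rabs_pos|left; auto]).
      split; [lra|]. intros n Hn. destruct (Nat.eq_dec n m) as [->|Ne].
      + apply (proj1 (Rle_div_r _ _ _ (Q m))). assert (Rabs (a m) * (INR m + 1) ^ 2 >= a m * (INR m + 1) ^ 2); [|lra].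
        apply Rle_ge, Rmult_le_compat_r; [left; auto|apply Rle_abs].
      + eapply Rle_trans; [apply IH; lia|]. apply Mo. lra. }
  destruct (K N) as (B' & HB' & K'). exists B'. split; auto. intros n. apply K'. lia.
Qed.

Lemma infinite_sum_of_inv_sqr_bound (a : nat -> R) B : 0 < B ->
  (forall n, 0 <= a n <= B / (INR n + 1) ^ 2) -> exists l, infinite_sum a l.
Proof.
  intros HB H.
  assert (Bd : forall n, sum_f_R0 a n <= 2 * B * (1 - / (INR n + 2))).
  { induction n as [|n IH].
    - cbn [sum_f_R0]. destruct (H O) as [_ H0]. simpl in *. lra.
    - cbn [sum_f_R0]. destruct (H (S n)) as [_ H0]. assert (T := inv_sqr_telescope (S n)).
      rewrite S_INR in *. replace (INR n + 1 + 1) with (INR n + 2) in * by ring.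
      unfold Rdiv in H0. assert (B * / (INR n + 2) ^ 2 <= B * (2 * (/ (INR n + 2) - / (INR n + 1 + 2)))) by (apply Rmult_le_compat_l; lra).
      lra. }
  destruct (ex_finite_lim_seq_incr (sum_f_R0 a) (2 * B)) as [l Hl].
  - intros n. cbn [sum_f_R0]. generalize (H (S n)). lra.
  - intros n. eapply Rle_trans; [apply Bd|].
    assert (0 < / (INR n + 2)) by (apply Rinv_0_lt_compat; generalize (pos_INR n); lra). nra.
  - exists l. apply is_lim_seq_Reals in Hl. exact Hl.
Qed.

Lemma pfrac_snoc F' l x z : pfrac F' (l ++ x :: nil) z = (pfrac F' l z + / (F' x * (z - x)))%C.
Proof.
  induction l as [|t l IH]; cbn; [ring|]. fold (pfrac F' (l ++ x :: nil) z). fold (pfrac F' l z).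
  rewrite IH. ring.
Qed.

Lemma pfrac_seq_S F' (t : nat -> C) n z :
  pfrac F' (map t (seq 0 (S n))) z = (pfrac F' (map t (seq 0 n)) z + / (F' (t n) * (z - t n)))%C.
Proof. rewrite seq_S, map_app. apply pfrac_snoc. Qed.

(** The factor [1 / (a + 1)] comes from telescoping. With [a = 0] this bounds a whole sum on a
    circle, with large [a] a tail. *)
Lemma pfrac_seq_bound F' (t : nat -> C) (z : C) K B a n : 0 <= K -> 0 <= B -> (a <= n)%nat ->
  (forall j, (a <= j < n)%nat -> Cmod (/ (F' (t j) * (z - t j))) <= K * (B / (INR j + 1) ^ 2)) ->
  Cmod (pfrac F' (map t (seq 0 n)) z - pfrac F' (map t (seq 0 a)) z) <= 2 * K * B / (INR a + 1).
Proof.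
  intros HK HB L H.
  assert (P : forall n, 0 < INR n + 1) by (intros i; generalize (pos_INR i); lra).
  assert (S : Cmod (pfrac F' (map t (seq 0 n)) z - pfrac F' (map t (seq 0 a)) z) <= 2 * K * B * (/ (INR a + 1) - / (INR n + 1))).
  { induction L as [|n L IH].
    - replace (pfrac F' (map t (seq 0 a)) z - pfrac F' (map t (seq 0 a)) z)%C with (RtoC 0) by ring.
      rewrite Cmod_0. right; ring.
    - rewrite pfrac_seq_S.
      replace (pfrac F' (map t (seq 0 n)) z + / (F' (t n) * (z - t n)) - pfrac F' (map t (seq 0 a)) z)%C
        with ((pfrac F' (map t (seq 0 n)) z - pfrac F' (map t (seq 0 a)) z) + / (F' (t n) * (z - t n)))%C by ring.
      eapply Rle_trans; [apply Cmod_triangle|].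
      assert (I1 := IH ltac:(intros; apply H; lia)). assert (H1 := H n ltac:(lia)).
      assert (T := inv_sqr_telescope n). rewrite S_INR. replace (INR n + 1 + 1) with (INR n + 2) by ring.
      unfold Rdiv in H1. assert (K * B * / (INR n + 1) ^ 2 <= K * B * (2 * (/ (INR n + 1) - / (INR n + 2)))) by (apply Rmult_le_compat_l; nra).
      lra. }
  eapply Rle_trans; [apply S|]. unfold Rdiv.
  assert (0 < / (INR n + 1)) by (apply Rinv_0_lt_compat; auto).
  apply Rmult_le_compat_l; [nra|lra].
Qed.

(** * Decay of rational functions *)

(** The residues [d] are arbitrary because the induction below changes them. *)
Definition simple_frac (d : C -> C) (l : list C) (x : R) : C :=
  fold_right (fun t s => d t / (x - t) + s)%C (RtoC 0) l.

Lemma simple_frac_decay d l : exists M X, 0 < M /\ 1 <= X /\ forall x, X <= x ->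
  Cmod (simple_frac d l x) <= M / x /\ forall t, In t l -> (x - t)%C <> 0%C.
Proof.
  induction l as [|a l (M & X & HM & HX & IH)].
  - exists 1, 1. split; [lra|]. split; [lra|]. intros x Hx. split; [|intros t []].
    cbn. rewrite Cmod_0. apply Rdiv_le_0_compat; lra.
  - exists (2 * Cmod (d a) + M), (Rmax X (2 * Cmod a + 1)).
    assert (Pd := Cmod_ge_0 (d a)). assert (Pa := Cmod_ge_0 a). split; [lra|].
    split; [eapply Rle_trans; [apply HX|apply Rmax_l]|]. intros x Hx.
    assert (X1 : X <= x) by (eapply Rle_trans; [apply Rmax_l|apply Hx]).
    assert (X2 : 2 * Cmod a + 1 <= x) by (eapply Rle_trans; [apply Rmax_r|apply Hx]).
    destruct (IH x X1) as [B1 B2].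
    assert (D : x / 2 <= Cmod (x - a)).
    { generalize (Cmod_triangle_inv x a). rewrite Cmod_R, (Rabs_pos_eq x) by lra. lra. }
    assert (N : (x - a)%C <> 0%C) by (apply Cmod_gt_0; lra).
    split; [|intros t [<-|I]; auto].
    cbn. eapply Rle_trans; [apply Cmod_triangle|]. fold (simple_frac d l x).
    rewrite Cmod_div by auto. replace ((2 * Cmod (d a) + M) / x) with (Cmod (d a) / (x / 2) + M / x) by (field; lra).
    apply Rplus_le_compat; auto. apply Rmult_le_compat_l; auto. apply Rinv_le_contravar; lra.
Qed.

(** Multiplication by [x - a] removes the pole [a] and leaves a constant [D] plus fractions with
    residues [d t (t - a)]. Decay gives [D = 0], the rest decays rapidly again, and [t - a] is
    nonzero because the poles are distinct. Finally [d a] is [D] minus residues that vanish. *)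
Lemma simple_frac_rapid_decay l : NoDup l -> forall d,
  (forall n, exists M X, forall x, X <= x -> Cmod (simple_frac d l x) * x ^ n <= M) ->
  forall t, In t l -> d t = 0%C.
Proof.
  induction l as [|a l IH]; intros HN d Hd; [intros t []|]. inversion HN as [|b l' Na HN']; subst.
  set (d' := fun t => (d t * (t - a))%C). set (D := (d a + fold_right (fun t s => d t + s)%C (RtoC 0) l)%C).
  assert (Id : forall x : R, (forall t, In t (a :: l) -> (x - t)%C <> 0%C) ->
     ((x - a) * simple_frac d (a :: l) x = D + simple_frac d' l x)%C).
  { intros x Hx. cbn. fold (simple_frac d l x). rewrite Cmult_plus_distr_l. unfold D. rewrite <- Cplus_assoc. f_equal.
    - field. apply Hx. now left.
    - assert (Hl : forall t, In t l -> (x - t)%C <> 0%C) by (intros; apply Hx; now right). clear - Hl.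
      induction l as [|b l IHl]; cbn; [ring|]. fold (simple_frac d l x) (simple_frac d' l x).
      rewrite Cmult_plus_distr_l, IHl by (intros; apply Hl; now right). unfold d'. field. apply Hl. now left. }
  destruct (simple_frac_decay d' l) as (M1 & X1 & HM1 & HX1 & B1).
  destruct (simple_frac_decay d (a :: l)) as (M2 & X2 & HM2 & HX2 & B2).
  assert (Big : forall x, Cmod a + 1 <= x -> Cmod (x - a) <= 2 * x).
  { intros x Hx. eapply Rle_trans; [apply Cmod_triangle_minus|]. rewrite Cmod_R, Rabs_pos_eq; [lra|].
    generalize (Cmod_ge_0 a); lra. }
  assert (HD : D = 0%C).
  { apply Cmod_small_0. intros e He. destruct (Hd 2%nat) as (M & X & B).
    set (x := Rmax (Rmax X (Cmod a + 1)) (Rmax (Rmax X1 X2) ((2 * Rabs M + M1) / e))).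
    assert (Y1 : X <= x) by (unfold x; eapply Rle_trans; [apply Rmax_l|apply Rmax_l]).
    assert (Y2 : Cmod a + 1 <= x) by (unfold x; eapply Rle_trans; [apply Rmax_r|apply Rmax_l]).
    assert (Y3 : X1 <= x) by (unfold x; eapply Rle_trans; [eapply Rle_trans; [apply Rmax_l|apply Rmax_l]|apply Rmax_r]).
    assert (Y4 : X2 <= x) by (unfold x; eapply Rle_trans; [eapply Rle_trans; [apply Rmax_r|apply Rmax_l]|apply Rmax_r]).
    assert (Y5 : (2 * Rabs M + M1) / e <= x) by (unfold x; eapply Rle_trans; [apply Rmax_r|apply Rmax_r]).
    clearbody x. assert (Px : 1 <= x) by lra. apply Rle_div_l in Y5; auto.
    specialize (B x Y1). destruct (B1 x Y3) as [B1' _]. destruct (B2 x Y4) as [_ B2'].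
    assert (E := Id x B2').
    replace D with ((x - a) * simple_frac d (a :: l) x - simple_frac d' l x)%C by (rewrite E; ring).
    eapply Rle_trans; [apply Cmod_triangle_minus|]. rewrite Cmod_mult.
    assert (G := Big x Y2).
    set (S := Cmod (simple_frac d (a :: l) x)) in *. assert (PS : 0 <= S) by apply Cmod_ge_0.
    assert (Z1 : Cmod (x - a) * S <= 2 * Rabs M / x).
    { apply -> Rle_div_r; [|lra]. apply Rle_trans with (2 * (S * x ^ 2)).
      - apply Rle_trans with ((2 * x) * S * x); [|right; ring].
        apply Rmult_le_compat_r; [lra|]. apply Rmult_le_compat_r; lra.
      - generalize (Rle_abs M). lra. }
    assert (Z2 : 2 * Rabs M / x + M1 / x <= e).
    { replace (2 * Rabs M / x + M1 / x) with ((2 * Rabs M + M1) / x) by (field; lra). apply Rle_div_l; lra. }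
    lra. }
  assert (Hl : forall t, In t l -> d t = 0%C).
  { intros t It. assert (Z : d' t = 0%C).
    { apply IH; auto. intros n. destruct (Hd (S n)) as (M & X & B).
      exists (2 * M), (Rmax (Rmax X (Cmod a + 1)) X2). intros x Hx.
      assert (Y1 : X <= x) by (eapply Rle_trans; [eapply Rle_trans; [apply Rmax_l|apply Rmax_l]|apply Hx]).
      assert (Y2 : Cmod a + 1 <= x) by (eapply Rle_trans; [eapply Rle_trans; [apply Rmax_r|apply Rmax_l]|apply Hx]).
      assert (Y3 : X2 <= x) by (eapply Rle_trans; [apply Rmax_r|apply Hx]).
      destruct (B2 x Y3) as [_ B2']. assert (E := Id x B2'). rewrite HD, Cplus_0_l in E. rewrite <- E, Cmod_mult.
      specialize (B x Y1). cbn [pow] in B. assert (G := Big x Y2).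
      set (T := Cmod (simple_frac d (a :: l) x)) in *. assert (PT : 0 <= T) by apply Cmod_ge_0.
      assert (0 <= x ^ n) by (apply pow_le; lra).
      apply Rle_trans with ((2 * x) * T * x ^ n); [|apply Rle_trans with (2 * (T * (x * x ^ n))); [right; ring|lra]].
      apply Rmult_le_compat_r; auto. apply Rmult_le_compat_r; auto. }
    unfold d' in Z. destruct (Ceq_dec (d t) 0) as [|N]; auto. exfalso.
    apply (Cmult_neq_0 _ _ N (Cminus_eq_contra t a ltac:(intros ->; contradiction)) Z). }
  intros t [<-|It]; auto.
  replace (d a) with D; auto. unfold D. clear - Hl.
  replace (fold_right (fun t s => d t + s)%C (RtoC 0) l) with (RtoC 0); [ring|].
  induction l as [|b l IHl]; cbn; auto. rewrite <- IHl by (intros; apply Hl; now right).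
  rewrite (Hl b) by now left. ring.
Qed.

(** * The partial fraction expansion of [1 / F] *)

Section PartialFractions.

Variables (F F' : C -> C) (K : R) (r : nat).
Hypothesis HF : entire F.
Hypothesis HF' : forall z, cderiv F z (F' z).
Hypothesis Hsimple : forall t, F t = 0%C -> F' t <> 0%C.
Hypothesis HK : 0 < K.
(** The factor [1 / R] makes the partial sums small on the circles; the loss [(1 + |t|) ^ r] is paid
    for by the derivatives, through [HtB] below. *)
Hypothesis Hcircle : forall e X, 0 < e -> exists R, X <= R /\ 1 <= R /\
  forall z, Cmod z = R -> F z <> 0%C /\ Cmod (/ F z) <= e /\
    forall t, F t = 0%C -> Cmod t <= R -> / Cmod (z - t) <= K * (1 + Cmod t) ^ r / R.

Lemma exists_nonzero : exists z, F z <> 0%C.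
Proof.
  destruct (Hcircle 1 1 Rlt_0_1) as (R & _ & HR & H). exists (RtoC R).
  apply H. rewrite Cmod_R, Rabs_pos_eq; lra.
Qed.

Lemma pfrac_circle_bound l : (forall t, In t l -> F t = 0%C) ->
  exists S, 0 <= S /\ forall R z, 0 < R -> F z <> 0%C ->
    (forall t, In t l -> / Cmod (z - t) <= K * (1 + Cmod t) ^ r / R) -> Cmod (pfrac F' l z) <= S / R.
Proof.
  induction l as [|a l IH]; intros Hl.
  - exists 0. split; [lra|]. intros R z HR _ _. cbn. rewrite Cmod_0. right; field; lra.
  - destruct IH as (S & HS & B); [intros; apply Hl; now right|].
    assert (Fa : F a = 0%C) by (apply Hl; now left). assert (Na := Hsimple a Fa).
    assert (Pa : 0 < Cmod (F' a)) by now apply Cmod_gt_0.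
    assert (Pr : 0 <= (1 + Cmod a) ^ r) by (apply pow_le; generalize (Cmod_ge_0 a); lra).
    exists (/ Cmod (F' a) * (K * (1 + Cmod a) ^ r) + S).
    assert (P0 : 0 <= / Cmod (F' a) * (K * (1 + Cmod a) ^ r)).
    { apply Rmult_le_pos; [left; now apply Rinv_0_lt_compat|]. apply Rmult_le_pos; lra. }
    split; [lra|]. intros R z HR Fz Hz. cbn. fold (pfrac F' l z).
    eapply Rle_trans; [apply Cmod_triangle|].
    assert (za : (z - a)%C <> 0%C) by (apply Cminus_eq_contra; intros ->; contradiction).
    rewrite Cmod_inv, Cmod_mult, Rinv_mult by now apply Cmult_neq_0.
    assert (B' := B R z HR Fz (fun t It => Hz t (or_intror It))). assert (Ha := Hz a (or_introl eq_refl)).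
    unfold Rdiv at 1. rewrite Rmult_plus_distr_r. apply Rplus_le_compat; auto.
    rewrite Rmult_assoc. apply Rmult_le_compat_l; auto. left; now apply Rinv_0_lt_compat.
Qed.

(** With finitely many zeros, both [1 / F] and its principal parts tend to 0 on the circles, so the
    maximum principle makes them equal. Rapid decay then forces every residue [1 / F' t] to vanish,
    which is absurd; if there is no zero at all, [1 / F] itself would be 0. *)
Lemma infinitely_many_zeros :
  (forall n, exists M X, forall x, X <= x -> F (RtoC x) <> 0%C /\ Cmod (/ F (RtoC x)) * x ^ n <= M) ->
  forall l, exists z, F z = 0%C /\ ~ In z l.
Proof.
  intros Hdecay l. apply NNPP. intros N.
  assert (Hl : forall z, F z = 0%C -> In z l).
  { intros z Fz. apply NNPP. intros I. apply N. now exists z. }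
  assert (exists R0, forall z, In z l -> Cmod z <= R0) as [R0 HR0].
  { clear. induction l as [|a l [R0 IH]]; [exists 0; intros z []|].
    exists (Rmax R0 (Cmod a)). intros z [<-|I]; [apply Rmax_r|]. eapply Rle_trans; [now apply IH|apply Rmax_l]. }
  destruct (entire_finite_zeros F R0 HF exists_nonzero) as (L & NL & HL).
  assert (HL' : forall z, In z L <-> F z = 0%C).
  { intros z. rewrite HL. split; [tauto|]. intros Fz. split; auto. }
  destruct (pfrac_circle_bound L) as (S & HS & B); [intros t; apply HL'|].
  assert (E : forall z, F z <> 0%C -> (/ F z)%C = pfrac F' L z).
  { intros z Fz. apply Ceq_minus, Cmod_small_0. intros e He.
    destruct (Hcircle (e / 2) (Rmax (Rmax R0 (Cmod z)) (2 * S / e))) as (R & HX & H1 & HR); [lra|].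
    assert (X1 : R0 <= R) by (eapply Rle_trans; [eapply Rle_trans; [apply Rmax_l|apply Rmax_l]|apply HX]).
    assert (X2 : Cmod z <= R) by (eapply Rle_trans; [eapply Rle_trans; [apply Rmax_r|apply Rmax_l]|apply HX]).
    assert (X3 : 2 * S / e <= R) by (eapply Rle_trans; [apply Rmax_r|apply HX]).
    apply Rle_div_l in X3; auto.
    apply (partial_fractions_disc F F' L R e HF HF'); auto; try lra.
    - intros w. rewrite HL'. split; [|tauto]. intros Fw. split; auto. apply Rle_trans with R0; auto.
    - intros t It. apply Hsimple. now apply HL'.
    - intros w Hw. destruct (HR w Hw) as (Fw & I & D). split; auto.
      eapply Rle_trans; [apply Cmod_triangle_minus|].
      assert (Cmod (pfrac F' L w) <= S / R).
      { apply B; auto; [lra|]. intros t It. apply D; [now apply HL'|]. apply Rle_trans with R0; auto. apply HR0, Hl, HL', It. }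
      assert (S / R <= e / 2) by (apply Rle_div_l; lra). lra. }
  assert (Z : forall t, In t L -> (/ F' t)%C = 0%C).
  { apply (simple_frac_rapid_decay L NL (fun t => / F' t)%C). intros n.
    destruct (Hdecay n) as (M & X & HM). exists M, X. intros x Hx. destruct (HM x Hx) as [Fx B'].
    replace (simple_frac (fun t => / F' t)%C L x) with (/ F (RtoC x))%C; auto.
    rewrite E by auto.
    assert (G : forall l', (forall t, In t l' -> F t = 0%C) -> pfrac F' l' (RtoC x) = simple_frac (fun t => / F' t)%C l' x).
    { induction l' as [|a l' IH]; intros Hl'; auto. cbn. fold (pfrac F' l' (RtoC x)). fold (simple_frac (fun t => / F' t)%C l' x).
      rewrite IH by (intros; apply Hl'; now right). f_equal.
      assert (Fa : F a = 0%C) by (apply Hl'; now left). assert (Na := Hsimple a Fa).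
      assert (xa : (x - a)%C <> 0%C) by (apply Cminus_eq_contra; intros Ea; apply Fx; now rewrite Ea).
      field. auto. }
    apply G. intros t. apply HL'. }
  destruct exists_nonzero as [z Fz].
  destruct L as [|a L].
  - specialize (E z Fz). cbn in E. apply C1_nz. rewrite <- (Cinv_r _ Fz), E. ring.
  - assert (Fa : F a = 0%C) by (apply HL'; now left). assert (Na := Hsimple a Fa).
    specialize (Z a (or_introl eq_refl)). apply C1_nz. rewrite <- (Cinv_r _ Na), Z. ring.
Qed.

Variable t : nat -> C.
Variable B : R.
Hypothesis Ht : forall m n, t m = t n -> m = n.
Hypothesis Hzero : forall z, F z = 0%C <-> exists n, t n = z.
Hypothesis Hsorted : forall m n, (m <= n)%nat -> Cmod (t m) <= Cmod (t n).
Hypothesis HB : 0 < B.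
Hypothesis HtB : forall n, / Cmod (F' (t n)) * (1 + Cmod (t n)) ^ r <= B / (INR n + 1) ^ 2.

Lemma zeros_unbounded R : exists n, R < Cmod (t n).
Proof.
  apply NNPP. intros N.
  destruct (entire_finite_zeros F R HF exists_nonzero) as (L & _ & HL).
  destruct (injective_escapes t L Ht) as (j & Hj). apply Hj. apply HL. split.
  - apply Rnot_lt_le. intros Q. apply N. now exists j.
  - apply Hzero. now exists j.
Qed.

(** Because of the ordering, the sum over the zeros in a disc is a partial sum of the series, and
    the maximum principle applies to it. *)
Lemma zeros_initial_segment R : exists N, forall j, (j < N)%nat <-> Cmod (t j) <= R.
Proof.
  destruct (zeros_unbounded R) as [n Hn]. induction n as [|n IH].
  - exists O. intros j. split; [lia|]. intros L. specialize (Hsorted O j ltac:(lia)). lra.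
  - destruct (Rlt_dec R (Cmod (t n))) as [H|H]; auto. exists (S n). intros j. split.
    + intros L. assert (A := Hsorted j n ltac:(lia)). lra.
    + intros L. apply Nat.lt_nge. intros G. specialize (Hsorted (S n) j G). lra.
Qed.

(** For given [e] one circle suffices. It controls the partial sum over its [N] zeros; later terms
    are bounded directly, since [R >= 2 |z| + 2] keeps the other zeros at distance at least 1 from
    [z]. So all partial sums converge, not only those attached to circles. *)
Lemma partial_fraction_series z : F z <> 0%C ->
  Clim (fun N => pfrac F' (map t (seq 0 N)) z) (/ F z).
Proof.
  intros Fz e He.
  (* The circle will enclose [t n0], so [N > n0] and the tail [2 B / (N + 1)] is at most [e / 4]. *)
  destruct (INR_unbounded (Rmax 1 (8 * B / e))) as [n0 Hn0].
  assert (N1 : 8 * B / e < INR n0 + 1) by (generalize (Rmax_r 1 (8 * B / e)); lra).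
  apply Rlt_div_l in N1; auto.
  destruct (Hcircle (e / 4) (Rmax (Rmax (2 * Cmod z + 2) (Cmod (t n0))) (8 * K * B / e))) as (R & HX & HR1 & HR); [lra|].
  assert (X1 : 2 * Cmod z + 2 <= R) by (eapply Rle_trans; [eapply Rle_trans; [apply Rmax_l|apply Rmax_l]|apply HX]).
  assert (X2 : Cmod (t n0) <= R) by (eapply Rle_trans; [eapply Rle_trans; [apply Rmax_r|apply Rmax_l]|apply HX]).
  assert (X3 : 8 * K * B / e <= R) by (eapply Rle_trans; [apply Rmax_r|apply HX]).
  apply Rle_div_l in X3; auto.
  assert (Pz := Cmod_ge_0 z).
  destruct (zeros_initial_segment R) as [N HN].
  assert (Hn0N : (n0 < N)%nat) by now apply HN.
  assert (Fac : forall j w, F w <> 0%C -> Cmod (/ (F' (t j) * (w - t j))) = / Cmod (F' (t j)) * / Cmod (w - t j)).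
  { intros j w Fw. assert (Fj : F (t j) = 0%C) by (apply Hzero; now exists j).
    assert (w - t j <> 0)%C by (apply Cminus_eq_contra; intros E; apply Fw; now rewrite E).
    rewrite Cmod_inv, Cmod_mult, Rinv_mult; auto. apply Cmult_neq_0; auto. }
  assert (Pc : forall j, 0 < / Cmod (F' (t j))).
  { intros j. apply Rinv_0_lt_compat, Cmod_gt_0, Hsimple, Hzero. now exists j. }
  assert (M0 : Cmod (/ F z - pfrac F' (map t (seq 0 N)) z) <= e / 2).
  { apply (partial_fractions_disc F F' (map t (seq 0 N)) R (e / 2) HF HF'); auto; try lra.
    - now apply NoDup_seq_image.
    - intros w. rewrite in_map_iff. split.
      + intros (j & <- & Ij). apply in_seq in Ij. split; [apply HN; lia|apply Hzero; now exists j].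
      + intros [Lw Fw]. apply Hzero in Fw. destruct Fw as (j & <-). exists j. split; auto.
        apply in_seq. split; [lia|]. apply HN in Lw. lia.
    - intros s Is. apply in_map_iff in Is. destruct Is as (j & <- & _). apply Hsimple, Hzero. now exists j.
    - intros w Hw. destruct (HR w Hw) as (Fw & I & D). split; auto.
      eapply Rle_trans; [apply Cmod_triangle_minus|].
      assert (PB := pfrac_seq_bound F' t w (K / R) B 0 N ltac:(apply Rdiv_le_0_compat; lra) ltac:(lra) ltac:(lia)).
      cbn [seq map] in PB. unfold pfrac at 2 in PB. cbn [fold_right INR] in PB.
      replace (pfrac F' (map t (seq 0 N)) w - 0)%C with (pfrac F' (map t (seq 0 N)) w) in PB by ring.
      assert (PB' : Cmod (pfrac F' (map t (seq 0 N)) w) <= 2 * (K / R) * B / (0 + 1)).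
      { apply PB. intros j Hj. rewrite Fac by auto.
        assert (Dj := D (t j) ltac:(apply Hzero; now exists j) ltac:(apply HN; lia)).
        apply Rle_trans with (/ Cmod (F' (t j)) * (K * (1 + Cmod (t j)) ^ r / R)).
        - apply Rmult_le_compat_l; [left; auto|auto].
        - replace (/ Cmod (F' (t j)) * (K * (1 + Cmod (t j)) ^ r / R)) with (K / R * (/ Cmod (F' (t j)) * (1 + Cmod (t j)) ^ r)).
          + apply Rmult_le_compat_l; [apply Rdiv_le_0_compat; lra|auto].
          + field. split; [lra|]. generalize (Pc j). intros P E. rewrite E, Rinv_0 in P. lra. }
      assert (2 * (K / R) * B / (0 + 1) <= e / 4).
      { replace (2 * (K / R) * B / (0 + 1)) with (2 * K * B / R) by (field; lra). apply Rle_div_l; lra. }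
      lra. }
  exists N. intros n Hn.
  assert (T := pfrac_seq_bound F' t z 1 B N n ltac:(lra) ltac:(lra) Hn).
  assert (T' : Cmod (pfrac F' (map t (seq 0 n)) z - pfrac F' (map t (seq 0 N)) z) <= 2 * 1 * B / (INR N + 1)).
  { apply T. intros j Hj. rewrite Fac, Rmult_1_l by auto.
    assert (Lj : R < Cmod (t j)).
    { apply Rnot_le_lt. intros Q. apply HN in Q. lia. }
    assert (A := Cmod_triangle_inv (t j) z). rewrite Cmod_minus_sym in A.
    eapply Rle_trans; [|apply HtB]. apply Rmult_le_compat_l; [left; auto|].
    apply Rle_trans with 1; [|apply pow_R1_Rle; generalize (Cmod_ge_0 (t j)); lra].
    rewrite <- Rinv_1. apply Rinv_le_contravar; lra. }
  assert (2 * 1 * B / (INR N + 1) <= e / 4).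
  { assert (INR n0 <= INR N) by (apply le_INR; lia). apply Rle_div_l; [generalize (pos_INR N); lra|].
    assert (e * (INR n0 + 1) <= e * (INR N + 1)) by (apply Rmult_le_compat_l; lra). lra. }
  replace (pfrac F' (map t (seq 0 n)) z - / F z)%C
    with ((pfrac F' (map t (seq 0 n)) z - pfrac F' (map t (seq 0 N)) z) - (/ F z - pfrac F' (map t (seq 0 N)) z))%C by ring.
  eapply Rle_lt_trans; [apply Cmod_triangle_minus|]. lra.
Qed.

End PartialFractions.

(** * Construction before translation *)

Lemma cderiv_zero_const f : (forall z, cderiv f z 0) -> forall x : R, f (RtoC x) = f (RtoC 0).
Proof.
  intros H x.
  assert (K : forall p : C -> R, (forall z w, p (z - w)%C = p z - p w) -> (forall z, Rabs (p z) <= Cmod z) ->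
     p (f (RtoC x)) = p (f (RtoC 0))).
  { intros p Hp Hp'.
    assert (D : forall y, is_derive (fun y => p (f (RtoC y))) y 0).
    { intros y. apply is_derive_Reals. intros e He. destruct (H (RtoC y) (e / 2)) as (d & Hd & B); [lra|].
      exists (mkposreal d Hd). intros h Hh Hhd. cbn in Hhd. specialize (B (RtoC (y + h))).
      assert (E : (RtoC (y + h) - RtoC y)%C = RtoC h) by (rewrite RtoC_plus; ring).
      rewrite E, Cmod_R in B. specialize (B Hhd).
      replace (f (RtoC (y + h)) - f (RtoC y) - 0 * h)%C with (f (RtoC (y + h)) - f (RtoC y))%C in B by ring.
      rewrite Rminus_0_r. unfold Rdiv. rewrite Rabs_mult, Rabs_inv, <- Hp.
      assert (Ph : 0 < Rabs h) by now apply Rabs_pos_lt.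
      apply Rle_lt_trans with (e / 2); [|lra]. apply Rle_div_l; auto.
      eapply Rle_trans; [apply Hp'|auto]. }
    destruct (MVT_gen (fun y => p (f (RtoC y))) 0 x (fun _ => 0)) as (c & _ & E).
    - intros y _. apply D.
    - intros y _. apply continuity_pt_filterlim, (ex_derive_continuous (V := R_NormedModule)). eexists; apply D.
    - lra. }
  apply injective_projections; apply K; auto using Re_le_Cmod, Im_le_Cmod.
Qed.

Lemma power_le_exp_half n : exists M, 0 < M /\ forall x, 1 <= x -> x ^ n <= M * exp (x / 2).
Proof.
  set (a := 2 * (INR n + 1)). assert (Pa : 0 < a) by (unfold a; generalize (pos_INR n); lra).
  exists (a ^ S n). split; [now apply pow_lt|]. intros x Hx.
  apply Rle_trans with (x ^ S n); [simpl; assert (0 < x ^ n) by (apply pow_lt; lra); nra|].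
  replace (exp (x / 2)) with (exp (x / a) ^ S n).
  - rewrite <- Rpow_mult_distr. apply pow_incr. split; [lra|].
    assert (x / a <= exp (x / a)) by (generalize (exp_ineq1_le (x / a)); lra).
    apply Rle_trans with (a * (x / a)); [right; field; lra|]. apply Rmult_le_compat_l; lra.
  - rewrite exp_pow_nat, S_INR. f_equal. unfold a. field. generalize (pos_INR n); lra.
Qed.

Lemma exists_function_unshifted rho : 1 < rho -> exists (F F' : C -> C) (t : nat -> C),
  (forall z, cderiv F z (F' z)) /\
  (forall m n, t m = t n -> m = n) /\
  (forall z, F z = 0%C <-> exists n, t n = z) /\
  (forall n, F' (t n) <> 0%C) /\
  (exists l, infinite_sum (fun n => / Cmod (F' (t n))) l) /\
  (forall z, F z <> 0%C -> Clim (fun N => pfrac F' (map t (seq 0 N)) z) (/ F z)) /\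
  (exists y0, 1 <= y0 /\ (forall z y, Cmod z = exp y -> y0 <= y -> Cmod (F z) <= exp (exp (rho * y) + 1)) /\
     (forall y, y0 <= y -> exp (exp (rho * y) / 2) <= Cmod (F (RtoC (exp y))))) /\
  (exists R0, forall n, Cmod (t n) <= R0 \/ exists u, Cexp u = t n /\ Rabs (snd u) < PI / (2 * rho)).
Proof.
  intros Hr. destruct (mittag_leffler rho Hr) as (E & HE & Cb & HCb & HE1 & HE2 & HE3).
  destruct (INR_unbounded rho) as [r Hr1]. destruct (INR_unbounded (2 * rho + 2)) as [p Hp].
  (* Then [|F' t| >= |t| ^ (2 p + r) / 2]. After the loss [(1 + |t|) ^ r] there remains
     [|t| ^ (- 2 p)], which is [O (1 / (n + 1) ^ 2)] because [n + 1 = O (|t| ^ p)]. *)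
  set (k := (p + p + r + 1)%nat). assert (Hk : (1 <= k)%nat) by (unfold k; lia).
  destruct (MLF_zero_deriv rho k E Cb) as (xd & Hxd & Deriv); try assumption.
  destruct (MLF_zero_count rho k E Cb) as (xc & Kc & Hxc & HKc & Count); try assumption.
  destruct (MLF_zero_distance rho k E Cb) with (r := r) as (xs & Ks & Hxs & HKs & Dist); try assumption; [lra|].
  destruct (MLF_circle rho k E Cb) as (xo & Hxo & Circ); try assumption.
  destruct (MLF_zero_location rho k E Cb) as (xl & Hxl & Loc); try assumption.
  destruct (MLF_growth rho k E Cb) as (y0 & Hy0 & Grow); try assumption.
  assert (K1 : 1 <= INR k) by (apply (le_INR 1) in Hk; exact Hk).
  assert (Ent : forall c, entire (MLF k E c)).
  { intros c. apply entire_plus; [apply entire_plus; [exact HE|apply entire_monomial]|apply entire_const]. }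
  destruct (entire_deriv _ (Ent (RtoC 0))) as (F' & HF'e & HF'0).
  (* The constant [c] shifts values only: one derivative and one set of critical points serve every
     [c]. *)
  assert (HF' : forall c z, cderiv (MLF k E c) z (F' z)).
  { intros c z e He. destruct (HF'0 z e He) as (d & Hd & B). exists d. split; auto. intros w Hw.
    replace (MLF k E c w - MLF k E c z)%C with (MLF k E 0 w - MLF k E 0 z)%C by (unfold MLF; ring). auto. }
  assert (Nz : exists z, F' z <> 0%C).
  { apply NNPP. intros N.
    assert (Z : forall z, cderiv (MLF k E 0) z 0).
    { intros z. replace (RtoC 0) with (F' z) at 2; auto. apply NNPP. intros Q. apply N. now exists z. }
    assert (Cst := cderiv_zero_const _ Z).
    destruct (exp_dominates_const (2 * Cmod (MLF k E 0 (RtoC 0))) rho) as (x1 & Hx1 & B); [lra|].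
    destruct (Grow (RtoC 0)) as [_ G]; [rewrite Cmod_0; lra|].
    specialize (G (Rmax y0 x1) (Rmax_l _ _)). specialize (B (Rmax y0 x1) (Rmax_r _ _)). rewrite Cst in G.
    generalize (exp_ineq1_le (exp (rho * Rmax y0 x1) / 2)). lra. }
  destruct (entire_finite_zeros F' (exp xd) HF'e Nz) as (L & _ & HL).
  (* Infinitely many candidates for [c] in the unit disc. One of them avoids the finitely many
     values [- MLF k E 0 z] at critical points with [|z| <= exp xd]; beyond that radius [Deriv]
     excludes multiple zeros. *)
  set (s := fun j : nat => RtoC (/ (INR j + 1))).
  assert (Inj : forall i j, s i = s j -> i = j).
  { intros i j Eij. apply INR_eq. apply RtoC_inj in Eij.
    apply Rinv_eq_reg in Eij. lra. }
  destruct (injective_escapes s (map (fun z => - MLF k E 0 z)%C L) Inj) as [j Hj].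
  set (c := s j).
  assert (Hc : Cmod c <= 1).
  { unfold c, s. rewrite Cmod_R. assert (P := pos_INR j).
    rewrite Rabs_pos_eq by (left; apply Rinv_0_lt_compat; lra). rewrite <- Rinv_1. apply Rinv_le_contravar; lra. }
  set (F := MLF k E c). assert (HF : entire F) by apply Ent. assert (DF : forall z, cderiv F z (F' z)) by apply HF'.
  assert (Simple : forall t, F t = 0%C -> F' t <> 0%C).
  { intros t Ft Z. destruct (Rle_dec (Cmod t) (exp xd)) as [Q|Q].
    - apply Hj. apply in_map_iff. exists t. split; [|apply HL; auto].
      fold c. replace c with (F t - MLF k E 0 t)%C by (unfold F, MLF; ring). rewrite Ft. ring.
    - assert (A := Deriv c Hc t (F' t) ltac:(lra) Ft (DF t)). rewrite Z, Cmod_0 in A.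
      assert (0 < Cmod t ^ (k - 1)) by (apply pow_lt; generalize (exp_pos xd); lra). lra. }
  assert (Hcircle : forall e X, 0 < e -> exists R, X <= R /\ 1 <= R /\
    forall z, Cmod z = R -> F z <> 0%C /\ Cmod (/ F z) <= e /\
      forall t, F t = 0%C -> Cmod t <= R -> / Cmod (z - t) <= Ks * (1 + Cmod t) ^ r / R).
  { intros e X He. set (x1 := Rmax (Rmax xo xs) (Rmax X (2 / e))).
    destruct (log_radius_unbounded rho k Hr Hk x1) as [m Hm]. specialize (Hm m (le_n _)).
    set (x := log_radius rho k m) in *.
    assert (Y1 : xo <= x) by (eapply Rle_trans; [|apply Hm]; unfold x1; eapply Rle_trans; [apply Rmax_l|apply Rmax_l]).
    assert (Y2 : xs <= x) by (eapply Rle_trans; [|apply Hm]; unfold x1; eapply Rle_trans; [apply Rmax_r|apply Rmax_l]).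
    assert (Y3 : X <= x) by (eapply Rle_trans; [|apply Hm]; unfold x1; eapply Rle_trans; [apply Rmax_l|apply Rmax_r]).
    assert (Y4 : 2 / e <= x) by (eapply Rle_trans; [|apply Hm]; unfold x1; eapply Rle_trans; [apply Rmax_r|apply Rmax_r]).
    assert (Ex : 1 + x <= exp x) by apply exp_ineq1_le.
    exists (exp x). split; [lra|]. split; [lra|]. intros z Hz.
    assert (A := Circ c Hc m z Y1 Hz). fold F x in A.
    assert (EK : exp x <= exp (INR k * x)) by (apply exp_mono; nra).
    assert (PF : 0 < Cmod (F z)) by (generalize (exp_pos x); lra).
    assert (NF : F z <> 0%C) by now apply Cmod_gt_0.
    split; auto. split.
    - rewrite Cmod_inv by auto. apply Rle_trans with (/ (1 / e)).
      + apply Rinv_le_contravar; [apply Rdiv_lt_0_compat; lra|].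
        replace (1 / e) with (2 / e / 2) by (field; lra). lra.
      + right; field; lra.
    - intros t Ft Htz. rewrite <- Hz in Htz |- *. apply (Dist c Hc m z t Y2 Hz Ft Htz). }
  assert (Decay : forall n, exists M X, forall x, X <= x -> F (RtoC x) <> 0%C /\ Cmod (/ F (RtoC x)) * x ^ n <= M).
  { intros n. destruct (power_le_exp_half n) as (M & HM & B). exists M, (exp y0). intros x Hx.
    assert (P0 := exp_pos y0). assert (E1 : 1 + y0 <= exp y0) by apply exp_ineq1_le.
    destruct (Grow c Hc) as [_ G]. specialize (G (ln x)).
    assert (Ly : y0 <= ln x). { rewrite <- (ln_exp y0). apply ln_le; auto. }
    specialize (G Ly). rewrite exp_ln in G by lra. fold F in G.
    assert (Q : exp (x / 2) <= exp (exp (rho * ln x) / 2)).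
    { apply exp_mono. assert (x <= exp (rho * ln x)); [|lra].
      rewrite <- (exp_ln x) at 1 by lra. apply exp_mono. nra. }
    assert (P1 := exp_pos (x / 2)). assert (NF : F (RtoC x) <> 0%C) by (apply Cmod_gt_0; lra).
    split; auto. rewrite Cmod_inv by auto.
    apply Rle_trans with (/ exp (x / 2) * (M * exp (x / 2))).
    - apply Rmult_le_compat; [|apply pow_le; lra| |apply B; lra].
      + left. apply Rinv_0_lt_compat. lra.
      + apply Rinv_le_contravar; lra.
    - right. field. lra. }
  assert (Hne := exists_nonzero F Ks r Hcircle).
  destruct (enumerate_discrete (fun z => F z = 0%C)) as (t & Ht & Hz & Hs).
  { intros R. destruct (entire_finite_zeros F R HF Hne) as (l & _ & Hl). exists l. intros z H1 H2. apply Hl. auto. }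
  { apply (infinitely_many_zeros F F' Ks r HF DF Simple HKs Hcircle Decay). }
  assert (Zt : forall n, F (t n) = 0%C) by (intros n; apply Hz; now exists n).
  set (xb := Rmax xd xc).
  destruct (zeros_unbounded F Ks r HF Hcircle t Ht Hz (exp xb)) as [n1 Hn1].
  assert (Asy : exists B, 0 < B /\ forall n, / Cmod (F' (t n)) * (1 + Cmod (t n)) ^ r <= B / (INR n + 1) ^ 2).
  (* The counting bound holds beyond [exp xb], so the first [n1] zeros are discarded. For
     [n >= 2 * n1] at least half of the indices up to [n] remain, which costs a factor 2. *)
  { apply (bound_all_from_eventually (fun n => / Cmod (F' (t n)) * (1 + Cmod (t n)) ^ r) (2 * n1) (2 * 2 ^ r * (2 * Kc) ^ 2)). intros n Hn.
    assert (Ln : exp xb < Cmod (t n)) by (specialize (Hs n1 n ltac:(lia)); lra).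
    assert (Hb : 1 <= xb) by (unfold xb; eapply Rle_trans; [apply Hxd|apply Rmax_l]).
    set (T := Cmod (t n)) in *.
    assert (Eb : 1 + xb <= exp xb) by apply exp_ineq1_le.
    assert (T1 : 1 <= T) by lra.
    set (X := ln T). assert (EX : exp X = T) by (apply exp_ln; lra).
    assert (HX : xb <= X). { unfold X. rewrite <- (ln_exp xb). apply ln_le; [apply exp_pos|lra]. }
    assert (Cn : INR (S n - n1) <= Kc * exp ((2 * rho + 2) * X)).
    { rewrite <- (length_seq (S n - n1) n1), <- (length_map t). apply (Count c Hc X).
      - apply Rle_trans with xb; [apply Rmax_r|auto].
      - apply NoDup_map_inj; [auto|apply seq_NoDup].
      - intros z Iz. apply in_map_iff in Iz. destruct Iz as (i & <- & Ii). apply in_seq in Ii.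
        split; [apply Zt|]. split.
        + apply Rle_trans with (exp xb); [apply exp_mono, Rmax_r|]. specialize (Hs n1 i ltac:(lia)). lra.
        + rewrite EX. apply Hs. lia. }
    assert (Cp : exp ((2 * rho + 2) * X) <= T ^ p).
    { rewrite <- EX, exp_pow_nat. apply exp_mono. apply Rmult_le_compat_r; lra. }
    assert (Cn2 : INR n + 1 <= 2 * Kc * T ^ p).
    { assert (INR n + 1 <= 2 * INR (S n - n1)).
      { rewrite <- S_INR. replace 2 with (INR 2) by reflexivity. rewrite <- mult_INR. apply le_INR. lia. }
      assert (Kc * exp ((2 * rho + 2) * X) <= Kc * T ^ p) by (apply Rmult_le_compat_l; lra). lra. }
    assert (Dxd : exp xd <= T).
    { apply Rle_trans with (exp xb); [apply exp_mono, Rmax_l|lra]. }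
    assert (Dn := Deriv c Hc (t n) (F' (t n)) Dxd (Zt n) (DF (t n))).
    fold T in Dn. replace (k - 1)%nat with (p + p + r)%nat in Dn by (unfold k; lia).
    rewrite !pow_add in Dn.
    assert (PT : 0 < T ^ p) by (apply pow_lt; lra). assert (PTr : 0 < T ^ r) by (apply pow_lt; lra).
    assert (PD : 0 < T ^ p * T ^ p * T ^ r / 2) by (apply Rdiv_lt_0_compat; [repeat apply Rmult_lt_0_compat; auto|lra]).
    assert (Pn : 0 < INR n + 1) by (generalize (pos_INR n); lra).
    assert (Tr : (1 + T) ^ r <= 2 ^ r * T ^ r) by (rewrite <- Rpow_mult_distr; apply pow_incr; lra).
    assert (P2r : 0 < 2 ^ r) by (apply pow_lt; lra).
    apply Rle_trans with (/ (T ^ p * T ^ p * T ^ r / 2) * (2 ^ r * T ^ r)).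
    - apply Rmult_le_compat; auto.
      + left. apply Rinv_0_lt_compat. lra.
      + apply pow_le. lra.
      + apply Rinv_le_contravar; auto.
    - replace (/ (T ^ p * T ^ p * T ^ r / 2) * (2 ^ r * T ^ r)) with (2 * 2 ^ r * / (T ^ p * T ^ p)) by (field; split; lra).
      unfold Rdiv. rewrite (Rmult_assoc (2 * 2 ^ r)). apply Rmult_le_compat_l; [lra|].
      apply -> Rle_div_r; [|apply pow_lt; auto].
      rewrite Rmult_comm. apply Rle_div_l; [apply Rmult_lt_0_compat; auto|].
      replace ((2 * Kc) ^ 2 * (T ^ p * T ^ p)) with ((2 * Kc * T ^ p) * (2 * Kc * T ^ p)) by ring.
      replace ((INR n + 1) ^ 2) with ((INR n + 1) * (INR n + 1)) by ring. apply Rmult_le_compat; lra. }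
  destruct Asy as (B & HB & HtB).
  exists F, F', t. split; auto. split; auto. split; auto. split; [intros n; apply Simple, Zt|].
  split; [|split; [|split]].
  - apply (infinite_sum_of_inv_sqr_bound _ B HB). intros n.
    assert (P : 0 < / Cmod (F' (t n))) by (apply Rinv_0_lt_compat, Cmod_gt_0, Simple, Zt).
    split; [lra|]. eapply Rle_trans; [|apply HtB].
    assert (1 <= (1 + Cmod (t n)) ^ r) by (apply pow_R1_Rle; generalize (Cmod_ge_0 (t n)); lra). nra.
  - intros z Fz. apply (partial_fraction_series F F' Ks r HF DF Simple HKs Hcircle t B Ht Hz Hs HB HtB z Fz).
  - exists y0. split; auto. apply (Grow c Hc).
  - exists (exp xl). intros n. destruct (Rle_dec (Cmod (t n)) (exp xl)) as [Q|Q]; auto. right.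
    destruct (Loc c Hc (t n) ltac:(lra) (Zt n)) as (u & Eu & _ & Hu). now exists u.
Qed.

Import Defs.

(** * Translation into the sector *)

Lemma Cnorm_Cmod (z : C) : Cnorm z = Cmod z.
Proof. unfold Cnorm, Cmod. f_equal. ring. Qed.

Lemma Defs_Cinv (z : C) : Defs.Cinv z = (/ z)%C.
Proof.
  unfold Defs.Cinv, Complex.Cinv. f_equal; f_equal; ring.
Qed.

(** The slope condition says [sin (b - |arg z|) > 0]. It can be checked on coordinates, so the
    argument of a translated zero is never computed. *)
Lemma in_angle_of_slope b (z : C) : 0 < b < PI / 2 -> 0 < fst z -> Rabs (snd z) * cos b < fst z * sin b ->
  in_angle (- b) (2 * b) z.
Proof.
  intros Hb Hz Hs. assert (HPI := PI_RGT_0).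
  assert (Nz : z <> 0%C). { intros E. rewrite E in Hz. cbn in Hz. lra. }
  destruct (Cexp_polar_exists z Nz) as ((x & v) & Ez & Hv). cbn [snd] in Hv.
  exists (exp x), v. split; [apply exp_pos|]. split; [|rewrite <- Ez; reflexivity].
  assert (P := exp_pos x). rewrite <- Ez in Hz, Hs. unfold Cexp in Hz, Hs; cbn [fst snd] in Hz, Hs.
  assert (Cv : 0 < cos v) by nra.
  assert (Ca := cos_Rabs v). assert (Sa := sin_Rabs_le v).
  assert (Hv2 : Rabs v < PI / 2).
  { apply Rnot_le_lt. intros K. assert (cos (Rabs v) <= 0); [|lra].
    assert (Rabs v <= PI) by (apply Rabs_le; lra). apply cos_le_0; lra. }
  assert (Pv := Rabs_pos v).
  assert (Cb : 0 < cos b) by (apply cos_gt_0; lra).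
  assert (S : 0 < sin (b - Rabs v)).
  { rewrite sin_minus, Ca. rewrite Rabs_mult, (Rabs_pos_eq (exp x)) in Hs by lra.
    assert (H1 : Rabs (sin v) * cos b < cos v * sin b) by (apply Rmult_lt_reg_l with (exp x); lra).
    assert (sin (Rabs v) * cos b <= Rabs (sin v) * cos b) by (apply Rmult_le_compat_r; lra). lra. }
  assert (Rabs v < b).
  { apply Rnot_le_lt. intros K. assert (0 <= sin (Rabs v - b)) by (apply sin_ge_0; lra).
    replace (b - Rabs v) with (- (Rabs v - b)) in S by ring. rewrite sin_neg in S. lra. }
  apply Rabs_def2 in H. lra.
Qed.

(** [sum_f_R0 _ n] has [n + 1] terms and is matched with [seq 0 (S n)]. *)
Lemma Cseries_sum_of_pfrac F' (t : nat -> C) (z s : C) :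
  Clim (fun N => pfrac F' (map t (seq 0 N)) z) s ->
  Cseries_sum (fun n => Complex.Cinv (Cmult (F' (t n)) (Cminus z (t n)))) s.
Proof.
  intros H.
  assert (PS : forall n, pfrac F' (map t (seq 0 (S n))) z =
     (sum_f_R0 (fun n => fst (/ (F' (t n) * (z - t n)))%C) n, sum_f_R0 (fun n => snd (/ (F' (t n) * (z - t n)))%C) n)).
  { induction n as [|n IH].
    - cbn [seq map sum_f_R0]. unfold pfrac; cbn [fold_right].
      rewrite Cplus_0_r. apply surjective_pairing.
    - rewrite pfrac_seq_S, IH. reflexivity. }
  split; intros e He; destruct (H e He) as [N HN]; exists N; intros n Hn; specialize (HN (S n) ltac:(lia));
    rewrite PS in HN; unfold Rdist; (eapply Rle_lt_trans; [|exact HN]).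
  - match type of HN with Cmod ?x < _ => exact (Re_le_Cmod x) end.
  - match type of HN with Cmod ?x < _ => exact (Im_le_Cmod x) end.
Qed.

Theorem theorem1p2 :
  forall gamma : R, 0 < gamma < 1 ->
  exists (F F' : Cx -> Cx) (t : nat -> Cx) (theta0 : R),
    entire_with_deriv F F' /\
    entire_order F (/ gamma) /\
    (* t enumerates the zeros of F, each exactly once *)
    (forall m n : nat, t m = t n -> m = n) /\
    (forall z : Cx, F z = C0 <-> exists n : nat, t n = z) /\
    (* all zeros are simple *)
    (forall n : nat, F' (t n) <> C0) /\
    (* all zeros lie in an angle of size pi * gamma *)
    (forall n : nat, in_angle theta0 (PI * gamma) (t n)) /\
    (exists l : R, infinite_sum (fun n => / Cnorm (F' (t n))) l) /\
    (forall z : Cx, F z <> C0 ->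
       Cseries_sum (fun n => Cinv (Cmul (F' (t n)) (Csub z (t n)))) (Cinv (F z))).
Proof.
  intros gamma Hg. set (rho := / gamma).
  assert (Hr : 1 < rho) by (unfold rho; rewrite <- Rinv_1; apply Rinv_lt_contravar; lra).
  assert (HPI := PI_RGT_0).
  destruct (exists_function_unshifted rho Hr)
    as (F & F' & t & HF & Ht & Hz & Hs & Hsum & Hpf & (y0 & Hy0 & Up & Low) & (R0 & Loc)).
  set (b := PI / (2 * rho)).
  assert (Eb : PI * gamma = 2 * b) by (unfold b, rho; field; lra).
  assert (Hb : 0 < b < PI / 2) by nra.
  assert (Cb : 0 < cos b) by (apply cos_gt_0; lra). assert (Sb : 0 < sin b) by (apply sin_gt_0; lra).
  set (R1 := Rmax R0 0). assert (HR1 : 0 <= R1) by apply Rmax_r.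
  (* Then [(A - R1) sin b = (R1 + 1) cos b], so the disc of radius [R1] is moved into the sector,
     while zeros already in the sector stay there under a positive shift. *)
  set (A := R1 + (R1 + 1) * cos b / sin b).
  assert (HA : R1 < A).
  { unfold A. assert (0 < (R1 + 1) * cos b / sin b) by (apply Rdiv_lt_0_compat; nra). lra. }
  exists (fun z => F (z - RtoC A)%C), (fun z => F' (z - RtoC A)%C), (fun n => (t n + RtoC A)%C), (- b).
  assert (Tn : forall n, (t n + RtoC A - RtoC A)%C = t n) by (intros; ring).
  split; [|split; [|split; [|split; [|split; [|split; [|split]]]]]].
  - intros z e He. destruct (HF (z - RtoC A)%C e He) as (d & Hd & K). exists d. split; auto.
    intros h [_ Hh]. change Cx with C in *. rewrite Cnorm_Cmod in Hh |- *. rewrite Cnorm_Cmod.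
    specialize (K (z + h - RtoC A)%C).
    replace (z + h - RtoC A - (z - RtoC A))%C with h in K by ring. apply K, Hh.
  - split.
    + intros e He. assert (L2 : 0 < ln 2) by (rewrite <- ln_1; apply ln_increasing; lra).
      (* The translation costs [|z - A| <= 2 |z|] and the [+ 1] in [Up] at most a factor 2; together
         they cost [(1 + rho) ln 2], which [e ln |z|] absorbs from this radius on. *)
      set (r0 := Rmax (A + exp y0) (exp ((1 + rho) * ln 2 / e))).
      assert (P0 := exp_pos y0).
      assert (Hr0 : A + exp y0 <= r0) by apply Rmax_l.
      exists r0. split; [lra|]. intros z Hzr. change Cx with C in *. rewrite !Cnorm_Cmod in *.
      assert (MA : Cmod (RtoC A) = A) by (rewrite Cmod_R, Rabs_pos_eq; lra).
      assert (D1 := Cmod_triangle_inv z (RtoC A)). assert (D2 := Cmod_triangle_minus z (RtoC A)). rewrite MA in *.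
      set (w := (z - RtoC A)%C) in *.
      assert (Pw : exp y0 <= Cmod w) by lra.
      assert (Pz : 0 < Cmod z) by lra.
      set (y := ln (Cmod w)). assert (Ey : Cmod w = exp y) by (symmetry; apply exp_ln; lra).
      assert (Hy : y0 <= y). { unfold y. rewrite <- (ln_exp y0). apply ln_le; auto. }
      eapply Rle_trans; [apply (Up w y Ey Hy)|]. apply exp_mono. unfold Rpower.
      assert (Hyz : y <= ln (Cmod z) + ln 2).
      { rewrite <- ln_mult by lra. apply ln_le; lra. }
      assert (Hlz : (1 + rho) * ln 2 <= e * ln (Cmod z)).
      { assert ((1 + rho) * ln 2 / e <= ln (Cmod z)).
        { rewrite <- (ln_exp ((1 + rho) * ln 2 / e)). apply ln_le; [apply exp_pos|].
          eapply Rle_trans; [apply Rmax_r|apply Hzr]. }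
        apply Rle_div_l in H; lra. }
      apply Rle_trans with (exp (rho * y + ln 2)).
      * rewrite exp_plus, exp_ln by lra. assert (1 <= exp (rho * y)) by (rewrite <- exp_0; apply exp_mono; nra). lra.
      * apply exp_mono. nra.
    + intros e He r0. assert (L2 : 0 < ln 2) by (rewrite <- ln_1; apply ln_increasing; lra).
      (* The witness is [A + exp y], the translate of a point of the positive axis where [Low]
         applies. As before, [e y] absorbs [(1 + rho) ln 2]. *)
      set (y := Rmax (Rmax y0 (Rabs r0)) (Rmax (Rmax A (ln 2 + 1)) ((1 + rho) * ln 2 / e + 1))).
      assert (Y1 : y0 <= y) by (unfold y; eapply Rle_trans; [apply Rmax_l|apply Rmax_l]).
      assert (Y2 : Rabs r0 <= y) by (unfold y; eapply Rle_trans; [apply Rmax_r|apply Rmax_l]).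
      assert (Y3 : A <= y) by (unfold y; eapply Rle_trans; [eapply Rle_trans; [apply Rmax_l|apply Rmax_l]|apply Rmax_r]).
      assert (Y4 : ln 2 + 1 <= y) by (unfold y; eapply Rle_trans; [eapply Rle_trans; [apply Rmax_r|apply Rmax_l]|apply Rmax_r]).
      assert (Y5 : (1 + rho) * ln 2 / e + 1 <= y) by (unfold y; eapply Rle_trans; [apply Rmax_r|apply Rmax_r]).
      clearbody y.
      assert (Ee : (1 + rho) * ln 2 < e * y).
      { assert ((1 + rho) * ln 2 / e < y) by lra. apply Rlt_div_l in H; lra. }
      assert (Ex : 1 + y <= exp y) by apply exp_ineq1_le.
      set (z := RtoC (A + exp y)).
      assert (Mz : Cmod z = A + exp y) by (unfold z; rewrite Cmod_R, Rabs_pos_eq; lra).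
      exists z. rewrite !Cnorm_Cmod, Mz. split; [generalize (Rle_abs r0); lra|].
      replace (z - RtoC A)%C with (RtoC (exp y)) by (unfold z; rewrite RtoC_plus; ring).
      eapply Rlt_le_trans; [|apply (Low y Y1)]. apply exp_increasing. unfold Rpower.
      set (l := ln (A + exp y)).
      assert (l1 : y <= l). { unfold l. rewrite <- (ln_exp y) at 1. apply ln_le; [apply exp_pos|lra]. }
      assert (l2 : l <= y + ln 2).
      { unfold l. rewrite <- (ln_exp y) at 2. rewrite <- ln_mult by (try apply exp_pos; lra). apply ln_le; lra. }
      apply Rlt_le_trans with (exp (rho * y - ln 2)).
      (* For [e > rho] the estimate [l <= y + ln 2] points the wrong way, but then the left side is
         at most 0. *)
      * apply exp_increasing. destruct (Rle_dec 0 (rho - e)) as [Q|Q].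
        -- apply Rle_lt_trans with ((rho - e) * (y + ln 2)); [apply Rmult_le_compat_l; lra|]. nra.
        -- assert ((rho - e) * l <= 0) by nra. nra.
      * unfold Rminus. rewrite exp_plus, exp_Ropp, exp_ln by lra. right; unfold Rdiv; ring.
  - intros m n E. apply Ht. rewrite <- (Tn m), <- (Tn n). now rewrite E.
  - intros z. change Cx with C in *. change C0 with (RtoC 0). rewrite Hz. split; intros [n Hn]; exists n.
    + rewrite Hn. ring.
    + rewrite <- Hn. symmetry. apply Tn.
  - intros n. rewrite Tn. apply Hs.
  - intros n. rewrite Eb. apply in_angle_of_slope; auto.
    + destruct (Loc n) as [L|(u & Eu & Hu)].
      * assert (Q := Re_le_Cmod (t n)). apply Rabs_le_between in Q.
        assert (R0 <= R1) by apply Rmax_l. cbn [fst Cplus RtoC]. lra.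
      * apply Rabs_def2 in Hu. fold b in Hu. rewrite <- Eu. unfold Cexp; cbn [fst Cplus RtoC].
        assert (0 < cos (snd u)) by (apply cos_gt_0; lra). generalize (exp_pos (fst u)). nra.
    + destruct (Loc n) as [L|(u & Eu & Hu)].
      * assert (Q := Re_le_Cmod (t n)). apply Rabs_le_between in Q. assert (Q' := Im_le_Cmod (t n)).
        assert (R0 <= R1) by apply Rmax_l. cbn [fst snd Cplus RtoC].
        replace (snd (t n) + 0) with (snd (t n)) by ring.
        assert (EA : (A - R1) * sin b = (R1 + 1) * cos b) by (unfold A; field; lra).
        assert ((A - R1) * sin b <= (fst (t n) + A) * sin b) by (apply Rmult_le_compat_r; lra).
        assert (Rabs (snd (t n)) * cos b <= R1 * cos b) by (apply Rmult_le_compat_r; lra). lra.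
      * fold b in Hu. rewrite <- Eu. unfold Cexp; cbn [fst snd Cplus RtoC].
        assert (P := exp_pos (fst u)). rewrite Rplus_0_r, Rabs_mult, (Rabs_pos_eq (exp (fst u))) by lra.
        assert (Pu := Rabs_pos (snd u)).
        assert (S : 0 < sin (b - Rabs (snd u))) by (apply sin_gt_0; lra). rewrite sin_minus in S.
        assert (Ca := cos_Rabs (snd u)).
        assert (Sa : Rabs (sin (snd u)) = sin (Rabs (snd u))).
        { rewrite <- (Rabs_pos_eq (sin (Rabs (snd u)))) by (apply sin_ge_0; lra).
          unfold Rabs at 3. destruct (Rcase_abs (snd u)); auto. now rewrite sin_neg, Rabs_Ropp. }
        rewrite Sa. rewrite Ca in S. assert (0 < A * sin b) by nra. nra.
  - destruct Hsum as [l Hl]. exists l. intros e He. destruct (Hl e He) as [N HN]. exists N. intros n Hn.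
    rewrite (sum_eq _ (fun n => / Cmod (F' (t n)))); [now apply HN|].
    intros i _. now rewrite Tn, Cnorm_Cmod.
  - intros z Fz. change Cx with C in *. rewrite Defs_Cinv.
    assert (P := Cseries_sum_of_pfrac F' t (z - RtoC A)%C _ (Hpf _ Fz)).
    replace (fun n => Cinv (Cmul (F' (t n + RtoC A - RtoC A)%C) (Csub z (t n + RtoC A)%C)))
      with (fun n => Complex.Cinv (Cmult (F' (t n)) (Cminus (z - RtoC A) (t n)))); auto.
    apply functional_extensionality. intros n. rewrite Defs_Cinv, Tn.
    change (Cmul (F' (t n)) (Csub z (t n + RtoC A)%C)) with (F' (t n) * (z - (t n + RtoC A)))%C.
    f_equal. f_equal. ring.
Qed.
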